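(* Let $P^{(k)}$ and $Q^{(k)}$ be geometric structures of order $k$ of type $(\mathfrak g_-,G_0,G_1,\dots,G_k)$. Set $P^{(\ell)}=\mathcal S^{(\ell)}P^{(k)}$ and $Q^{(\ell)}=\mathcal S^{(\ell)}Q^{(k)}$ for $\ell\ge k+1$. (1) If there is an isomorphism $\varphi^{(k)}:P^{(k)}\to Q^{(k)}$ of geometric structures, then it induces, for all $\ell=k+1,k+2,\dots,\infty$, an isomorphism $\mathcal S^{(\ell)}\varphi^{(k)}:\mathcal S^{(\ell)}P^{(k)}\to\mathcal S^{(\ell)}Q^{(k)}$ of geometric structures, i.e. a diffeomorphism satisfying $(\mathcal S^{(\ell)}\varphi^{(k)})^*[\theta^{(\ell-1)}]_Q=[\theta^{(\ell-1)}]_P$. (2) Conversely, assuming that $G_0,\dots,G_k$ are connected, if there is a diffeomorphism $\Phi^{(i)}:P^{(i)}\to Q^{(i)}$ for some $i\ge0$ such that $(\Phi^{(i)})^*[\theta^{(i-1)}]_Q=[\theta^{(i-1)}]_P$, then $\Phi^{(i)}$ induces an isomorphism $\varphi^{(i-1)}:P^{(i-1)}\to Q^{(i-1)}$ such that the canonical lift $\mathcal S^{(i)}\varphi^{(i-1)}:\mathcal S^{(i)}P^{(i-1)}\to\mathcal S^{(i)}Q^{(i-1)}$ sends $P^{(i)}$ onto $Q^{(i)}$ and its restriction to $P^{(i)}$ is $\Phi^{(i)}$. In particular, the equivalence problem of the geometric structure $Q^{(k)}$ reduces to the equivalence problem of the absolute parallelism $(\mathcal SQ^{(k)},\theta)$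 on the completed universal frame bundle $\mathcal SQ^{(k)}$.
   Context: Filtered manifolds. A filtered manifold is a manifold $M$ with subbundles $F^p\subset TM$ ($p\in\mathbb Z$), $F^p\supset F^{p+1}$, $F^0=0$, $\bigcup_pF^p=TM$, such that the sheaves of sections satisfy $[\underline F^p,\underline F^q]\subset\underline F^{p+q}$. Brackets make $\mathrm{gr}F_x=\bigoplus_pF^p_x/F^{p+1}_x$ a nilpotent graded Lie algebra. $(M,F)$ is of type $\mathfrak g_-=\bigoplus_{p<0}\mathfrak g_p$ (a fixed finite-dimensional graded Lie algebra) if $\mathrm{gr}F_x\cong\mathfrak g_-$ for all $x$. A graded space $V$ is filtered by $F^pV=\bigoplus_{i\ge p}V_i$; for filtered $V$, $F^p\mathrm{Hom}(V,V)=\{A: AF^qV\subset F^{p+q}V\ \forall q\}$ and $F^pGL(V)=\{a\in GL(V):a-1\in F^p\mathrm{Hom}(V,V)\}$. Geometric structures (defined inductively). A geometric structure of order $-1$ is a filtered manifold $Q^{(-1)}=(M,F)$ of type $\mathfrak g_-$. A geometric structure $Q^{(k)}$ of order $k\ge0$ of type $(\mathfrak g_-,G_0,\dots,G_k)$ is a sequence $Q^{(k)}\to\cdots\to Q^{(0)}\to Q^{(-1)}=M$ such that, for $0\le i\le k$, $Q^{(i)}\to Q^{(i-1)}$ is a principal $G_i$-bundle that is a principal subbundle of the universal frame bundle $\mathcal S^{(i)}Q^{(i-1)}\to Q^{(i-1)}$. Put $\mathfrak g_i=\mathrm{Lie}(G_i)$, $E^{(k)}=\mathfrak g_-\oplus\mathfrak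 g_0\oplus\dots\oplus\mathfrak g_k$, $E^{(-1)}=\mathfrak g_-$. $TQ^{(i)}$ is filtered by $F^{i+1}TQ^{(i)}=0$ and, for $\ell\le i$, $F^\ell TQ^{(i)}$ = preimage of $F^\ell TQ^{(i-1)}$. The universal linear frame bundle $\hat{\mathcal S}^{(k+1)}Q^{(k)}$ has as fibre over $z\in Q^{(k)}$ the set of filtration preserving linear isomorphisms $\zeta:E^{(k)}\to T_zQ^{(k)}$ such that: if $k=-1$, $\mathrm{gr}\,\zeta:\mathfrak g_-\to\mathrm{gr}F_z$ is a graded Lie algebra isomorphism; if $k\ge0$, $\zeta(A)=\frac{d}{dt}|_{t=0}z\exp(tA)$ for $A\in\mathfrak g_k$ and the induced map $\bar\zeta:E^{(k-1)}\to TQ^{(k-1)}$ (at the projection of $z$) lies in $\hat{\mathcal S}^{(k)}Q^{(k-1)}$ with class $[\bar\zeta]=z$. Its structure group is the group of linear automorphisms of $E^{(k)}$ which by precomposition preserve these fibres; $\mathcal S^{(k+1)}Q^{(k)}$ is the quotient of $\hat{\mathcal S}^{(k+1)}Q^{(k)}$ by $F^{k+2}GL(E^{(k)})$. It is a geometric structure of order $k+1$. Set $\mathcal S^{(k)}Q^{(k)}=Q^{(k)}$, $\mathcal S^{(\ell+1)}Q^{(k)}=\mathcal S^{(\ell+1)}(\mathcal S^{(\ell)}Q^{(k)})$, and $\mathcal S^{(\infty)}Q^{(k)}=\mathcal SQ^{(k)}=\varprojlim_\ell\mathcal S^{(\ell)}Q^{(k)}$. Projective limits of finite-dimensional manifolds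 are treated formally as manifolds. Isomorphisms. In order $-1$: diffeomorphisms preserving the filtrations. An isomorphism $\Phi$ of structures of order $k$ of the same type has the canonical lift $\mathcal S^{(k+1)}\Phi:[\zeta]\mapsto[\Phi_*\circ\zeta]$; an isomorphism $Q^{(k+1)}\to Q'^{(k+1)}$ is the restriction of $\mathcal S^{(k+1)}\Phi$ for an isomorphism $\Phi:Q^{(k)}\to Q'^{(k)}$ whose lift maps $Q^{(k+1)}$ onto $Q'^{(k+1)}$. Iterating lifts defines $\mathcal S^{(\ell)}\varphi^{(k)}$. Canonical forms. For $i\ge0$ the canonical Pfaff class $[\theta^{(i-1)}]$ of $Q^{(i)}$ at $z=[\zeta]$ is the class, modulo the action of $F^{i+1}GL(E^{(i-1)})$, of the form $T_zQ^{(i)}\to TQ^{(i-1)}\xrightarrow{\zeta^{-1}}E^{(i-1)}$ (for $i\le k$ the $Q^{(i)}$ are the lower members of the given tower). On $\mathcal SQ^{(k)}$ these classes determine a canonical form $\theta$ with values in $E=\varprojlim E^{(\ell)}$ (its $E^{(i)}$-component on $X$ is the $E^{(i)}$-component of any representative of $[\theta^{(j)}]$ on the projection of $X$, $j$ large), which is an absolute parallelism; for $\ell=\infty$ the class $[\theta^{(\ell-1)}]$ means $\theta$. *)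

(* Defs.v *)
From HB Require Import structures.
From mathcomp Require Import all_boot all_order all_algebra.
From mathcomp Require Import all_classical all_reals all_analysis.
Set Implicit Arguments.
Unset Strict Implicit.
Unset Printing Implicit Defensive.
Import Order.TTheory GRing.Theory Num.Theory numFieldNormedType.Exports.
Local Open Scope classical_set_scope.
Local Open Scope ring_scope.

(* Smooth manifolds are described by their smooth functions (differential
   spaces in the sense of Sikorski).  A space on the type T is a set of points
   together with a set of generating real functions.  Its topology is the
   initial topology of the generators, and a function is smooth when it is
   locally a C^infinity function of finitely many generators.  Functions,
   tangent vectors and maps are only relevant on the points.  On a (Hausdorff,
   second countable) manifold with all its C^infinity functions as generators
   these are the usual notions; subsets, quotients, products and projective
   limits all have their usual smooth structure without any construction of
   charts. *)

Fixpoint Ck (R : realType) (n k : nat) (F : 'rV[R]_n -> R) : Prop :=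
  match k with
  | 0 => continuous F
  | k'.+1 => (forall x, differentiable F x) /\
             (forall v, Ck k' (fun x => 'D_v F x))
  end.

Definition Cinfty (R : realType) (n : nat) (F : 'rV[R]_n -> R) : Prop :=
  forall k, Ck k F.

Record space (R : realType) (T : Type) := Space {
  pts : set T;
  gens : set (T -> R) }.

Section Spaces.
Context {R : realType}.

Definition near_pt {T} (X : space R T) (n : nat) (a : 'I_n -> T -> R)
    (e : R) (x : T) : set T :=
  [set y | pts X y /\ forall i, `|a i y - a i x| < e].

Definition open_in {T} (X : space R T) (O : set T) : Prop :=
  forall x, pts X x -> O x ->
  exists (n : nat) (a : 'I_n -> T -> R) (e : R),
    [/\ forall i, gens X (a i), 0 < e & near_pt X a e x `<=` O].

Definition smooth_fun {T} (X : space R T) : set (T -> R) :=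
  [set f | forall x, pts X x ->
    exists (n : nat) (a : 'I_n -> T -> R) (F : 'rV[R]_n -> R) (e : R),
      [/\ forall i, gens X (a i), Cinfty F, 0 < e &
          forall y, near_pt X a e x y -> f y = F (\row_i a i y)]].

Definition smooth_map {T T'} (X : space R T) (Y : space R T') (f : T -> T') :=
  (forall x, pts X x -> pts Y (f x)) /\
  (forall h, smooth_fun Y h -> smooth_fun X (h \o f)).

Definition diffeomorphism {T T'} (X : space R T) (Y : space R T')
    (f : T -> T') : Prop :=
  smooth_map X Y f /\
  exists g : T' -> T,
    [/\ smooth_map Y X g, forall x, pts X x -> g (f x) = x &
        forall y, pts Y y -> f (g y) = y].

Definition restrict {T} (X : space R T) (O : set T) : space R T :=
  Space (pts X `&` O) (gens X).

Definition prod_space {T T'} (X : space R T) (Y : space R T') :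
    space R (T * T') :=
  Space [set p | pts X p.1 /\ pts Y p.2]
        ([set h | exists2 f, gens X f & h = f \o fst] `|`
         [set h | exists2 f, gens Y f & h = f \o snd]).

Definition euclidean (n : nat) : space R 'rV[R]_n :=
  Space setT [set h | exists i, h = (fun v : 'rV[R]_n => v ord0 i)].

(* Hausdorff (points are separated by smooth functions), with a countable
   atlas of charts onto open subsets of R^d. *)
Definition is_manifold {T} (X : space R T) : Prop :=
  (forall x y, pts X x -> pts X y -> x <> y ->
     exists2 h, smooth_fun X h & h x <> h y) /\
  exists (d : nat) (O : nat -> set T) (W : nat -> set 'rV[R]_d)
         (c : nat -> T -> 'rV[R]_d),
    (forall j, [/\ open_in X (O j), open (W j) &
        diffeomorphism (restrict X (O j)) (restrict (euclidean d) (W j)) (c j)])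
    /\ (forall x, pts X x -> exists j, O j x).

Definition is_connected {T} (X : space R T) : Prop :=
  forall O1 O2 : set T, open_in X O1 -> open_in X O2 ->
    pts X `<=` O1 `|` O2 -> pts X `&` O1 `&` O2 = set0 ->
    pts X `&` O1 = set0 \/ pts X `&` O2 = set0.

(* Tangent vectors at x are the derivations at x of the algebra of smooth
   functions, in chain rule form (which contains linearity, the Leibniz rule
   and independence of values off the points); they are extended by 0 to
   nonsmooth functions, so that they are elements of one fixed vector space. *)
Definition functional (T : Type) : lmodType R := (T -> R) -> R^o.

Definition tangent {T} (X : space R T) (x : T) : set (functional T) :=
  [set D : (T -> R) -> R^o | [/\ pts X x,
    forall f, ~ smooth_fun X f -> D f = 0 &
    forall (n : nat) (a : 'I_n -> T -> R) (F : 'rV[R]_n -> R) (f : T -> R),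
      (forall i, smooth_fun X (a i)) -> Cinfty F ->
      (forall y, pts X y -> f y = F (\row_i a i y)) ->
      D f = \sum_i 'D_(delta_mx ord0 i) F (\row_j a j x) * D (a i)]].

(* The differential of f, for a map f into Y. *)
Definition push {T T'} (Y : space R T') (f : T -> T') (D : functional T) :
    functional T' :=
  fun h => if `[< smooth_fun Y h >] then D (h \o f) else 0.

Definition vector_field {T} (X : space R T) (V : T -> functional T) : Prop :=
  forall x, pts X x ->
    tangent X x (V x) /\
    forall h, smooth_fun X h -> smooth_fun X (fun y => V y h).

Definition lie_bracket {T} (V W : T -> functional T) (x : T) : functional T :=
  fun h => V x (fun y => W y h) - W x (fun y => V y h).

Definition linear_iso {E : lmodType R} {T} (X : space R T) (x : T)
    (zeta : E -> functional T) : Prop :=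
  [/\ linear zeta, injective zeta & range zeta = tangent X x].

(* Subbundles are described by global sections; on a manifold these carry the
   same information as local sections, by means of bump functions. *)
Definition section_of {T} (X : space R T) (B : T -> set (functional T))
    (V : T -> functional T) : Prop :=
  vector_field X V /\ forall x, pts X x -> B x (V x).

Definition is_subbundle {T} (X : space R T) (B : T -> set (functional T)) :=
  forall x, pts X x ->
    [/\ B x `<=` tangent X x, B x 0,
        (forall (c : R) v w, B x v -> B x w -> B x (c *: v + w)) &
        exists (r : nat) (V : 'I_r -> T -> functional T) (O : set T),
          [/\ open_in X O, O x, forall j, section_of X B (V j) &
              forall y, pts X y -> O y -> forall v, B y v ->
                exists! c : 'rV[R]_r, v = \sum_j c ord0 j *: V j y]].

End Spaces.

Record filtration (R : realType) (T : Type) (X : space R T) := Filtration {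
  filt_at :> int -> T -> set (functional T);
  filt_subbundle : forall p, is_subbundle X (filt_at p);
  filt_decr : forall p x, pts X x -> filt_at (p + 1) x `<=` filt_at p x;
  filt_zero : forall x v, pts X x -> filt_at 0 x v -> v = 0;
  filt_exhaust : forall x v, tangent X x v -> exists p, filt_at p x v;
  filt_bracket : forall p q V W,
    section_of X (filt_at p) V -> section_of X (filt_at q) W ->
    section_of X (filt_at (p + q)) (lie_bracket V W) }.

Record neg_graded_lie (R : realType) := NegGradedLie {
  nvect :> vectType R;
  ncomp : int -> {vspace nvect};
  ndepth : nat;
  nbr : nvect -> nvect -> nvect;
  ncomp_out : forall p : int, (0 <= p) || (p < - ndepth%:Z) -> ncomp p = 0%VS;
  ncomp_direct : directv (\sum_(i < ndepth) ncomp (- i.+1%:Z));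
  ncomp_full : (\sum_(i < ndepth) ncomp (- i.+1%:Z))%VS = fullv;
  nbr_linl : forall y, linear (nbr ^~ y);
  nbr_linr : forall x, linear (nbr x);
  nbr_alt : forall x, nbr x x = 0;
  nbr_jacobi : forall x y z,
    nbr x (nbr y z) + nbr y (nbr z x) + nbr z (nbr x y) = 0;
  nbr_graded : forall p q x y,
    x \in ncomp p -> y \in ncomp q -> nbr x y \in ncomp (p + q) }.

Definition comp_set (A B C : Type) (S : set (B -> C)) (S' : set (A -> B)) :
    set (A -> C) :=
  [set h | exists2 s, S s & exists2 s', S' s' & h = s \o s'].

(* Indexing: level n stands for order n - 1.  Thus Esp n is the space
   E^(n-1) = g_- + g_0 + ... + g_(n-1), and level n of a tower is Q^(n-1);
   groups and the g_i keep their index. *)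
Fixpoint Esp (R : realType) (gm : vectType R) (gp : nat -> vectType R)
    (n : nat) : vectType R :=
  match n with
  | 0 => gm
  | n'.+1 => (Esp gm gp n' * gp n')%type
  end.

(* The group G_n is presented as in the construction of the universal frame
   bundle: its elements are classes a F^(n+1)GL(E^(n-1)) of linear
   automorphisms a of E^(n-1), but its smooth structure is arbitrary, so that
   G_n may be any (not necessarily closed) Lie subgroup. *)
Record struct_type (R : realType) := StructType {
  gneg : neg_graded_lie R;
  gpos : nat -> vectType R;
  grp : forall n : nat,
    space R (set (Esp gneg gpos n -> Esp gneg gpos n));
  liealg : forall n : nat, gpos n ->
    functional (R := R) (set (Esp gneg gpos n -> Esp gneg gpos n)) }.

Section Types.
Context {R : realType} (tau : struct_type R).

Definition Espace (n : nat) : vectType R := Esp (gneg tau) (gpos tau) n.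
Local Notation E := Espace.

Fixpoint Efilt (n : nat) (p : int) : E n -> Prop :=
  match n return E n -> Prop with
  | 0 => fun v => v \in (\sum_(i < ndepth (gneg tau) | (p <= - i.+1%:Z)%R)
                           ncomp (gneg tau) (- i.+1%:Z))%VS
  | n'.+1 => fun v => Efilt p v.1 /\ ((p <= n'%:Z) \/ v.2 = 0)
  end.

Definition linear_aut (n : nat) (a : E n -> E n) : Prop :=
  linear a /\ bijective a.

Definition FGL (n : nat) (p : int) : set (E n -> E n) :=
  [set a | linear_aut a /\
     forall q e, Efilt q e -> Efilt (p + q) (a e - e)].
Arguments FGL : clear implicits.

Definition unit_cls (n : nat) : set (E n -> E n) := FGL n n.+1%:Z.
Arguments unit_cls : clear implicits.

Definition cls (n : nat) (B : Type) (f : E n -> B) : set (E n -> B) :=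
  [set h | exists2 a, unit_cls n a & h = f \o a].

Definition is_lie_group (n : nat) : Prop :=
  let G := grp tau n in
  [/\ is_manifold G, pts G (unit_cls n),
      smooth_map (prod_space G G) G (fun c => comp_set c.1 c.2) &
      exists2 inv, smooth_map G G inv &
        forall c, pts G c ->
          comp_set c (inv c) = unit_cls n /\ comp_set (inv c) c = unit_cls n].

(* liealg identifies the vector space g_n with Lie(G_n) = T_1 G_n. *)
Definition wf_type (k : nat) : Prop :=
  (forall n, (n <= k)%N -> is_lie_group n) /\
  (forall n, linear_iso (grp tau n) (unit_cls n) (@liealg R tau n)).

(* Points of level n.+1 are pairs (z, [zeta]) of a point of level n and a
   class of frames at z. *)
Fixpoint Amb (M : Type) (n : nat) : Type :=
  match n with
  | 0 => M
  | n'.+1 => (Amb M n' * set (E n' -> functional (R := R) (Amb M n')))%type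
  end.

End Types.

Record tower (R : realType) (tau : struct_type R) := Tower {
  base : Type;
  lev : forall n : nat, space R (Amb tau base n);
  bfilt : filtration (lev 0) }.

Section Towers.
Context {R : realType} {tau : struct_type R}.
Local Notation E := (Espace tau).

Section OneTower.
Context (Q : tower tau).
Local Notation A n := (Amb tau (base Q) n).
Local Notation U n := (functional (A n)).

Definition descend (n : nat) : A n.+1 -> A n := fun z => z.1.

Definition act (n : nat) (z : A n.+1) (c : set (E n -> E n)) : A n.+1 :=
  (z.1, comp_set z.2 c).

Fixpoint Tfilt (n : nat) (p : int) : A n -> U n -> Prop :=
  match n return A n -> U n -> Prop with
  | 0 => fun z D => bfilt Q p z D
  | n'.+1 => fun z D => tangent (lev Q n'.+1) z D /\
      (if p <= n'%:Z then Tfilt p z.1 (push (lev Q n') (@descend n') D)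
       else D = 0)
  end.

(* gamma represents an isomorphism of graded Lie algebras from g_- to gr F_x,
   sending A in g_p to the class of gamma A in F^p / F^(p+1); the bracket of
   gr F_x is induced by the bracket of sections. *)
Definition gr_iso (x : A 0) (gamma : gneg tau -> U 0) : Prop :=
  let F := bfilt Q in
  [/\ linear gamma,
      forall p a, a \in ncomp (gneg tau) p -> F p x (gamma a),
      forall p v, F p x v ->
        exists2 a, a \in ncomp (gneg tau) p & F (p + 1) x (v - gamma a),
      forall p a, a \in ncomp (gneg tau) p -> F (p + 1) x (gamma a) -> a = 0 &
      forall p q a b V W,
        a \in ncomp (gneg tau) p -> b \in ncomp (gneg tau) q ->
        section_of (lev Q 0) (F p) V -> section_of (lev Q 0) (F q) W ->
        F (p + 1) x (V x - gamma a) -> F (q + 1) x (W x - gamma b) ->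
        F (p + q + 1) x (lie_bracket V W x - gamma (nbr a b))].

Definition filtered_iso (n : nat) (z : A n) (zeta : E n -> U n) : Prop :=
  linear_iso (lev Q n) z zeta /\
  (forall p e, Efilt p e -> Tfilt p z (zeta e)).

(* Fibre over z of the universal linear frame bundle.  The fundamental vector
   d/dt z exp(t a) at t = 0 is the image of a in T_1 G_n under the differential
   of the orbit map c |-> z c. *)
Fixpoint hatS_fibre (n : nat) : A n -> (E n -> U n) -> Prop :=
  match n return A n -> (E n -> U n) -> Prop with
  | 0 => fun z zeta => filtered_iso (n := 0) z zeta /\ gr_iso z zeta
  | n'.+1 => fun z zeta =>
      let zbar (e : E n') : U n' :=
        push (lev Q n') (@descend n') (zeta (e, 0)) in
      [/\ filtered_iso (n := n'.+1) z zeta,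
          forall a : gpos tau n',
            zeta (0, a) =
              push (lev Q n'.+1) (@act n' z) (@liealg R tau n' a),
          hatS_fibre z.1 zbar & cls zbar = z.2]
  end.

Definition hatS (n : nat) : space R (A n * (E n -> U n)) :=
  Space [set u | pts (lev Q n) u.1 /\ hatS_fibre u.1 u.2]
        ([set h | exists2 f, smooth_fun (lev Q n) f & h = f \o fst] `|`
         [set h | exists e, exists2 f, smooth_fun (lev Q n) f &
            h = (fun u => u.2 e f)]).

Definition univ_frame (n : nat) : space R (A n.+1) :=
  let proj (u : A n * (E n -> U n)) : A n.+1 := (u.1, cls u.2) in
  Space (proj @` pts (hatS n))
        [set h : A n.+1 -> R | smooth_fun (hatS n) (h \o proj)].

(* Structure group of the universal linear frame bundle, and its quotient. *)
Definition hat_group (n : nat) : space R (E n -> E n) :=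
  Space [set a | linear_aut a /\
           forall z zeta, pts (lev Q n) z ->
             (hatS_fibre z zeta <-> hatS_fibre z (zeta \o a))]
        [set h | exists (l : {linear E n -> R^o}) (e : E n),
           h = (fun a => l (a e))].

Definition univ_group (n : nat) : space R (set (E n -> E n)) :=
  Space (@cls R tau n (E n) @` pts (hat_group n))
        [set h : set (E n -> E n) -> R | smooth_fun (hat_group n) (h \o @cls R tau n (E n))].

Definition is_principal_bundle (n : nat) : Prop :=
  let Pn := lev Q n.+1 in let G := grp tau n in
  [/\ is_manifold Pn, smooth_map Pn (lev Q n) (@descend n),
      smooth_map (prod_space Pn G) Pn (fun u => @act n u.1 u.2) &
      forall x, pts (lev Q n) x ->
        exists (O : set (A n)) (s : A n -> A n.+1),
          [/\ open_in (lev Q n) O, O x,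
              forall y, pts (lev Q n) y -> O y -> (s y).1 = y &
              diffeomorphism (prod_space (restrict (lev Q n) O) G)
                (restrict Pn (@descend n @^-1` O)) (fun u => @act n (s u.1) u.2)]].

(* Principal G_n-bundle that is a principal subbundle of S^(n) Q^(n-1). *)
Definition is_principal_subbundle (n : nat) : Prop :=
  [/\ is_principal_bundle n,
      smooth_map (grp tau n) (univ_group n) id &
      smooth_map (lev Q n.+1) (univ_frame n) id].

(* Q is a geometric structure of order k of type (g_-, G_0, ..., G_k),
   continued above order k by Q^(l) = S^(l) Q^(k), with the structure groups
   of the universal frame bundles. *)
Definition is_geometric_structure (k : nat) : Prop :=
  [/\ is_manifold (lev Q 0),
      forall x, pts (lev Q 0) x -> exists gamma, gr_iso x gamma,
      forall n, (n <= k)%N -> is_principal_subbundle n &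
      forall n, (k < n)%N -> lev Q n.+1 = univ_frame n /\ grp tau n = univ_group n].

(* The canonical Pfaff class [theta^(n-1)] at z in Q^(n): the forms
   zeta^-1 o (projection) : T_z Q^(n) -> E^(n-1), for zeta in the class z.2,
   which is an orbit of F^(n+1)GL(E^(n-1)). Only values on tangent vectors
   matter. *)
Definition pfaff (n : nat) (z : A n.+1) : set (U n.+1 -> E n) :=
  [set alpha | exists2 zeta, z.2 zeta &
     forall X, tangent (lev Q n.+1) z X ->
       zeta (alpha X) = push (lev Q n) (@descend n) X].

(* The completed universal frame bundle (projective limit of the tower). *)
Definition SQ : space R (forall n, A n) :=
  Space [set z | forall n, pts (lev Q n) (z n) /\ (z n.+1).1 = z n]
        [set h | exists n, exists2 f, smooth_fun (lev Q n) f &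
           h = (fun z => f (z n))].

Fixpoint Eproj (m d : nat) : E (d + m) -> E m :=
  match d return E (d + m) -> E m with
  | 0 => fun e => e
  | d'.+1 => fun e => @Eproj m d' (e.1)
  end.

(* theta z X e: the canonical form takes the value e on X in T_z SQ, where e
   in E is given by its components in the E m. *)
Definition theta (z : forall n, A n) (X : functional (forall n, A n))
    (e : forall m, E m) : Prop :=
  forall m, exists d0, forall d, (d0 <= d)%N ->
    forall zeta, (z (d + m).+1).2 zeta ->
      exists2 e', zeta e' = push (lev Q (d + m)) (fun w : forall n, A n => w (d + m)%N) X &
                  @Eproj m d e' = e m.

End OneTower.

Section TwoTowers.
Context (P Q : tower tau).
Local Notation AP n := (Amb tau (base P) n).
Local Notation AQ n := (Amb tau (base Q) n).

(* The canonical lift [zeta] |-> [phi_* o zeta]. *)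
Definition clift (n : nat) (phi : AP n -> AQ n) : AP n.+1 -> AQ n.+1 :=
  fun z => (phi z.1, [set h | exists2 zeta, z.2 zeta &
                        h = push (lev Q n) phi \o zeta]).

Fixpoint iter_lift (m n : nat) (phi : AP n -> AQ n) : AP (m + n) -> AQ (m + n) :=
  match m return AP (m + n) -> AQ (m + n) with
  | 0 => phi
  | m'.+1 => clift (@iter_lift m' n phi)
  end.

(* For n'.+1 the map is the restriction of the lift of an isomorphism of the
   lower structures, mapping onto; as a morphism of bundles whose smooth
   structure need not be the induced one, it is a diffeomorphism. *)
Fixpoint is_isomorphism (n : nat) : (AP n -> AQ n) -> Prop :=
  match n return (AP n -> AQ n) -> Prop with
  | 0 => fun phi =>
      diffeomorphism (lev P 0) (lev Q 0) phi /\
      forall p x, pts (lev P 0) x ->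
        push (lev Q 0) phi @` bfilt P p x = bfilt Q p (phi x)
  | n'.+1 => fun phi =>
      diffeomorphism (lev P n'.+1) (lev Q n'.+1) phi /\
      exists psi : AP n' -> AQ n',
        [/\ is_isomorphism psi,
            clift psi @` pts (lev P n'.+1) = pts (lev Q n'.+1) &
            forall z, pts (lev P n'.+1) z -> phi z = clift psi z]
  end.

Definition pfaff_pullback (n : nat) (phi : AP n.+1 -> AQ n.+1)
    (z : AP n.+1) : set (functional (AP n.+1) -> E n) :=
  [set alpha | exists2 beta, pfaff (phi z) beta &
     forall X, tangent (lev P n.+1) z X ->
       alpha X = beta (push (lev Q n.+1) phi X)].

Definition preserves_pfaff (n : nat) (phi : AP n.+1 -> AQ n.+1) : Prop :=
  forall z, pts (lev P n.+1) z -> pfaff_pullback phi z = pfaff z.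

Definition preserves_theta (Phi : (forall n, AP n) -> (forall n, AQ n)) :=
  forall z X e, tangent (SQ P) z X ->
    (theta (Phi z) (push (SQ Q) Phi X) e <-> theta z X e).

(* Phi is the limit S^(infinity) phi of the iterated lifts of phi. *)
Definition is_limit_lift (n : nat) (phi : AP n -> AQ n)
    (Phi : (forall i, AP i) -> (forall i, AQ i)) : Prop :=
  forall z, pts (SQ P) z ->
    forall m, Phi z (m + n)%N = iter_lift (m := m) phi (z (m + n)%N).

End TwoTowers.
End Towers.

(* Main.v *)
(* (1) An isomorphism pushes frames to frames, so its canonical lift is an
   isomorphism one level higher.

   (2) A map preserving the canonical Pfaff class preserves vertical vectors,
   since zeta^-1 o (projection) vanishes exactly on them.  Hence it is constant
   along every curve in a fibre, up to the projection.  Fibres are connected: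
   up to order k because the G_n are, and above because the frames over a point
   form an affine space, so that two frame classes are joined by a straight
   line.  Thus Phi descends to some phi, and comparison of the Pfaff classes at
   z and Phi z shows that phi pushes the frames in z onto those in Phi z, i.e.
   Phi is the lift of phi.  In particular phi pushes some frame over every
   point to a frame, which already forces phi to preserve the Pfaff class of
   its own level; one descends to order -1, where a frame determines the
   filtration.

   (3) A vector of the completed bundle is vertical over the level k + 1 iff
   the corresponding component of theta vanishes, two points over the same
   point are joined by straight lines in all higher levels at once, and one
   concludes as in (2).

   Local triviality of the universal frame bundles comes from a linear normal
   form for the classes modulo F^(n+1)GL: the class of a is the affine space of
   all a + N with N raising degrees by n + 1, so a linear projection along these
   N selects representatives smoothly. *)

From Pilot Require Import Defs.
From HB Require Import structures.
From mathcomp Require Import all_boot all_order all_algebra.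
From mathcomp Require Import all_classical all_reals all_analysis.
From mathcomp Require Import ring lra zify.
(* Reclaims the name [space], which vector.v uses for bundled subspaces. *)
Import Pilot.Defs.
Set Implicit Arguments.
Unset Strict Implicit.
Unset Printing Implicit Defensive.
Import Order.TTheory GRing.Theory Num.Theory numFieldNormedType.Exports.
Local Open Scope classical_set_scope.
Local Open Scope ring_scope.

(** * Smooth functions on R^n *)

Section Calculus.
Context {R : realType}.

(** Above order [k] there are no charts: [lev Q n.+1] is then [univ_frame Q n], known only through
    its smooth functions, and likewise its group. Sections, surjectivity of differentials and
    separation of points have to come from frames. The tool is a smooth field of frames near each
    point of each level, raised one level at a time: a frame selected smoothly in each class is
    lifted horizontally along a local trivialisation and completed by fundamental vectors. At level
    0 such a field respects the filtrations only, since extending one isomorphism of graded Lie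
    algebras to nearby points need not keep the brackets; this suffices, because changes of frame
    are only required to be filtered.

    In the projective limit, two points over the same point of level [k.+1] have different
    projections on the higher levels, so their frames cannot be interpolated directly. Their
    coefficients with respect to frame fields can, provided that no domain shrinks on the way up:
    each field is defined over the full preimage of the domain below. *)

Lemma row_sumE (T : Type) n (G : 'I_n -> T -> R) :
  (fun x => \row_i G i x) =
  \sum_(i < n) (fun x => G i x *: delta_mx ord0 i : 'rV[R]_n).
Proof.
apply/funext => x; rewrite fct_sumE; apply/rowP => j.
rewrite mxE summxE (bigD1 j) //= big1 ?addr0; last first.
  by move=> i /negPf ij; rewrite !mxE eqxx eq_sym ij mulr0.
by rewrite !mxE !eqxx mulr1.
Qed.

Lemma differentiable_row (V : normedModType R) n (G : 'I_n -> V -> R) x :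
  (forall i, differentiable (G i) x) ->
  differentiable (fun x => \row_i G i x) x.
Proof.
move=> dG; rewrite row_sumE; apply: differentiable_sum => i.
exact: differentiableZl.
Qed.

Lemma derive_comp_row (V : normedModType R) n (F : 'rV[R]_n -> R)
    (G : 'I_n -> V -> R) x v :
  differentiable F (\row_i G i x) -> (forall i, differentiable (G i) x) ->
  'D_v (fun x => F (\row_i G i x)) x =
  \sum_i 'D_(delta_mx ord0 i) F (\row_j G j x) * 'D_v (G i) x.
Proof.
move=> dF dG; have dr := differentiable_row dG.
have -> : (fun x => F (\row_i G i x)) = F \o (fun x => \row_i G i x) by [].
rewrite deriveE; last exact: differentiable_comp.
rewrite diff_comp //= -[X in 'd F _ X]deriveE //.
rewrite row_sumE derive_sum -?row_sumE; last first.
  by move=> i; apply: diff_derivable; apply: differentiableZl.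
rewrite linear_sum; apply: eq_bigr => i _.
rewrite deriveE; last exact: differentiableZl.
by rewrite diffZl // linearZ /= -!deriveE // mulrC.
Qed.

Lemma continuous_row (V : topologicalType) n (G : 'I_n -> V -> R) :
  (forall i, continuous (G i)) -> continuous (fun x => \row_i G i x).
Proof.
move=> cG; rewrite row_sumE => x.
elim/big_ind: _ => [|f g cf cg|i _]; first exact: cst_continuous.
  exact: continuousD.
by apply: cvgZr_tmp; exact: cG.
Qed.

Lemma CkSE n k (F : 'rV[R]_n -> R) :
  Ck k.+1 F = ((forall x, differentiable F x) /\ (forall v, Ck k ('D_v F))).
Proof. by []. Qed.

Lemma Ck_S n k (F : 'rV[R]_n -> R) : Ck k.+1 F -> Ck k F.
Proof.
elim: k F => [|k IH] F [dF DF].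
  by move=> x; exact: differentiable_continuous.
by split=> // v; apply: IH; exact: DF.
Qed.

Lemma Ck_cst n k (c : R) : @Ck R n k (cst c).
Proof.
elim: k c => [|k IH] c; first exact: cst_continuous.
split=> [x|v]; first exact: differentiable_cst.
rewrite (_ : (fun _ => _) = cst 0); first exact: IH.
by apply/funext => x; rewrite derive_cst.
Qed.

Lemma Ck_add n k (F G : 'rV[R]_n -> R) : Ck k F -> Ck k G -> Ck k (F + G).
Proof.
elim: k F G => [|k IH] F G.
  by move=> /= cF cG x; apply: continuousD; [exact: cF|exact: cG].
rewrite !CkSE => -[dF DF] [dG DG]; split=> [x|v]; first exact: differentiableD.
rewrite (_ : (fun _ => _) = (fun x => 'D_v F x) + (fun x => 'D_v G x)).
  exact: IH.
by apply/funext => x; rewrite deriveD //; exact: diff_derivable.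
Qed.

Lemma Ck_mul n k (F G : 'rV[R]_n -> R) : Ck k F -> Ck k G -> Ck k (F * G).
Proof.
elim: k F G => [|k IH] F G.
  by move=> /= cF cG x; apply: continuousM; [exact: cF|exact: cG].
move=> CF CG; move: (CF) (CG); rewrite !CkSE => -[dF DF] [dG DG].
split=> [x|v]; first exact: differentiableM.
rewrite (_ : (fun _ => _) =
  F * (fun x => 'D_v G x) + G * (fun x => 'D_v F x)); last first.
  by apply/funext => x; rewrite deriveM //; exact: diff_derivable.
by apply: Ck_add; apply: IH => //; exact: Ck_S.
Qed.

Lemma Ck_sum n k m (F : 'I_m -> 'rV[R]_n -> R) :
  (forall i, Ck k (F i)) -> Ck k (fun x => \sum_i F i x).
Proof.
move=> CF; rewrite (_ : (fun _ => _) = \sum_i F i); last first.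
  by apply/funext => x; rewrite fct_sumE.
elim/big_ind: _ => [|f g|//]; first exact: Ck_cst.
exact: Ck_add.
Qed.

Lemma Ck_comp n m k (F : 'rV[R]_n -> R) (G : 'I_n -> 'rV[R]_m -> R) :
  Ck k F -> (forall i, Ck k (G i)) -> Ck k (fun x => F (\row_i G i x)).
Proof.
elim: k F G => [|k IH] F G.
  move=> /= cF cG x; apply: (@continuous_comp _ _ _ (fun x => \row_i G i x) F).
    exact: continuous_row.
  exact: cF.
rewrite !CkSE => -[dF DF] CG; have dG i : forall x, differentiable (G i) x by case: (CG i).
split=> [x|v].
  apply: (@differentiable_comp _ _ _ _ (fun x => \row_i G i x) F) => //.
  exact: differentiable_row.
rewrite (_ : (fun _ => _) = fun x =>
    \sum_i 'D_(delta_mx ord0 i) F (\row_j G j x) * 'D_v (G i) x); last first.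
  by apply/funext => x; exact: derive_comp_row.
apply: Ck_sum => i; apply: Ck_mul; last by case: (CG i) => _; exact.
by apply: (IH ('D_(delta_mx ord0 i) F) G) => // j; exact: Ck_S.
Qed.

Lemma Ck_coord n k (i : 'I_n) : Ck k (fun v : 'rV[R]_n => v ord0 i).
Proof.
case: k => [|k]; first by move=> x; exact: coord_continuous.
split=> [x|v]; first exact: differentiable_coord.
rewrite (_ : (fun _ => _) = cst (v ord0 i)); first exact: Ck_cst.
apply/funext => x; rewrite deriveE; last exact: differentiable_coord.
have @f : {linear 'rV[R]_n -> R}.
  by exists (fun N : 'rV[R]_n => N ord0 i); do 2![eexists]; do ?[constructor];
     rewrite ?mxE// => ? *; rewrite ?mxE//; move=> ?; rewrite !mxE.
rewrite (_ : (fun _ => _) = f) // diff_lin //; exact: coord_continuous.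
Qed.

Lemma Ck_inv n k (F : 'rV[R]_n -> R) : (forall x, 0 < F x) -> Ck k F ->
  Ck k (fun x => (F x)^-1).
Proof.
move=> F0; elim: k F F0 => [|k IH] F F0.
  move=> /= cF x; apply: continuousV; last exact: cF.
  by rewrite gt_eqF.
move=> CF; have [dF DF] := CF; split=> [x|v].
  by apply: differentiableV => //; rewrite gt_eqF.
have CV : Ck k (fun x => (F x)^-1) by apply: IH => //; exact: Ck_S.
rewrite (_ : 'D_v _ = fun x => -1 * ((F x)^-1 * (F x)^-1) * 'D_v F x).
  exact: (Ck_mul (Ck_mul (@Ck_cst n k (-1)) (Ck_mul CV CV)) (DF v)).
apply/funext => x; rewrite deriveV ?gt_eqF //; last exact: diff_derivable.
by rewrite mulN1r -[LHS]/(_ * _) expr2 invfM.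
Qed.

Lemma Cinfty_differentiable n (F : 'rV[R]_n -> R) x :
  Cinfty F -> differentiable F x.
Proof. by move=> /(_ 1%N) [dF _]; exact: dF. Qed.

Lemma Cinfty_continuous n (F : 'rV[R]_n -> R) : Cinfty F -> continuous F.
Proof. by move=> /(_ 0%N). Qed.

Lemma Cinfty_derive n (F : 'rV[R]_n -> R) v :
  Cinfty F -> Cinfty (fun x => 'D_v F x).
Proof. by move=> CF k; have [_] := CF k.+1; exact. Qed.

Lemma Cinfty_coord n (i : 'I_n) : Cinfty (fun v : 'rV[R]_n => v ord0 i).
Proof. move=> k; exact: Ck_coord. Qed.

Lemma Cinfty_comp n m (F : 'rV[R]_n -> R) (G : 'I_n -> 'rV[R]_m -> R) :
  Cinfty F -> (forall i, Cinfty (G i)) -> Cinfty (fun x => F (\row_i G i x)).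
Proof. by move=> CF CG k; apply: Ck_comp => // i; exact: CG. Qed.

Lemma derive_coord n (i j : 'I_n) x :
  'D_(delta_mx ord0 j) (fun v : 'rV[R]_n => v ord0 i) x = (i == j)%:R.
Proof.
rewrite deriveE; last exact: differentiable_coord.
have @f : {linear 'rV[R]_n -> R}.
  by exists (fun N : 'rV[R]_n => N ord0 i); do 2![eexists]; do ?[constructor];
     rewrite ?mxE// => ? *; rewrite ?mxE//; move=> ?; rewrite !mxE.
rewrite (_ : (fun _ => _) = f) // diff_lin //; last exact: coord_continuous.
by rewrite /f /= mxE eqxx.
Qed.

(* [flat 1 x = exp (- 1 / x)] for [x > 0]; the polynomial factor makes the
   family stable under differentiation. *)
Definition flat (p : {poly R}) (x : R) : R :=
  if 0 < x then p.[x^-1] * expR (- x^-1) else 0.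

Lemma expR_ge_pow n (y : R) : 0 <= y -> y ^+ n / n`!%:R <= expR y.
Proof.
case: n => [|n] y0; first by rewrite expr0 fact0 divr1 -expR0 ler_expR.
by apply: le_trans (expR_ge1Dxn n y0); rewrite lerDr.
Qed.

(** Each monomial is controlled by the Taylor term one degree higher: [y ^ (i+1) / (i+1)! <= exp y]
    gives [y ^ i * exp (- y) <= (i+1)! / y], whence the factorials in the constant. *)
Lemma poly_expR_decay (p : {poly R}) :
  exists C, forall y : R, 0 < y -> `|p.[y]| * expR (- y) <= C / y.
Proof.
exists (\sum_(i < size p) `|p`_i| * (i.+1)`!%:R) => y y0.
rewrite horner_coef.
apply: (@le_trans _ _ ((\sum_(i < size p) `|p`_i| * y ^+ i) * expR (- y))).
  apply: ler_wpM2r; first exact: expR_ge0.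
  apply: le_trans (ler_norm_sum _ _ _) _; apply: ler_sum => i _.
  by rewrite normrM [`|y ^+ i|]ger0_norm // exprn_ge0 // ltW.
rewrite !mulr_suml; apply: ler_sum => i _; rewrite -!mulrA.
apply: ler_wpM2l => //.
rewrite expRN ler_pdivrMr ?expR_gt0 // mulrAC ler_pdivlMr // -exprSr mulrC.
have := expR_ge_pow i.+1 (ltW y0).
by rewrite ler_pdivrMr // ltr0n fact_gt0.
Qed.

Lemma flat_gt0 x : 0 < x -> 0 < flat 1 x.
Proof. by move=> x0; rewrite /flat x0 hornerC mul1r expR_gt0. Qed.

Lemma flat_le0 p x : x <= 0 -> flat p x = 0.
Proof. by move=> x0; rewrite /flat ltNge x0. Qed.

Lemma flat_ge0 x : 0 <= flat 1 x.
Proof.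
by have [x0|x0] := ltP 0 x; [rewrite ltW // flat_gt0|rewrite flat_le0].
Qed.

Lemma flat_mono x y : x <= y -> flat 1 x <= flat 1 y.
Proof.
move=> xy; have [x0|x0] := ltP 0 x; last by rewrite flat_le0 // flat_ge0.
have y0 := lt_le_trans x0 xy.
rewrite /flat x0 y0 !hornerC !mul1r ler_expR lerN2.
by rewrite lef_pV2.
Qed.

Lemma flat_bound p : exists C, forall x, `|flat p x| <= C * `|x|.
Proof.
have [C HC] := poly_expR_decay p.
have C0 : 0 <= C.
  have := HC 1 ltr01; rewrite divr1; apply: le_trans.
  by rewrite mulr_ge0 // expR_ge0.
exists C => x; have [x0|x0] := ltP 0 x; last first.
  by rewrite flat_le0 // normr0 mulr_ge0.
rewrite /flat x0 normrM [`|expR _|]ger0_norm ?expR_ge0 //.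
by rewrite (gtr0_norm x0) -[X in _ <= C * X]invrK HC // invr_gt0.
Qed.

(** For [x > 0] the chain rule produces the factor [x^-2], that is ['X^2] in the variable [x^-1]. At
    0 the criterion of Caratheodory is applied. *)
Lemma is_derive_flat p (x : R) :
  is_derive x (1 : R) (flat p) (flat ((p - p^`()) * 'X^2) x).
Proof.
have [x0|x0|<-] := ltrgtP 0 x.
- rewrite {2}/flat x0.
  apply: (@near_eq_is_derive R R^o R^o
      (fun x => p.[x^-1] * expR (- x^-1))).
    near=> y; rewrite /flat ifT //; near: y; exact: lt_nbhsr.
  have xN0 : x != 0 by rewrite gt_eqF.
  have dV : is_derive x (1 : R) (fun y : R => y^-1) (- x ^- 2).
    have := is_deriveV xN0 (is_derive_id x (1 : R)).
    by rewrite -[_ *: _]/(_ * _) mulr1.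
  have dp : is_derive x (1 : R) (fun y => p.[y^-1]) (p^`().[x^-1] * - x ^- 2).
    apply: (@is_derive1_comp _ (horner p)).
  have de : is_derive x (1 : R) (fun y => expR (- y^-1))
      (expR (- x^-1) * - (- x ^- 2)).
    by apply: (@is_derive1_comp _ expR (fun y => - y^-1)).
  apply: is_derive_eq.
  rewrite -![_ *: _]/(_ * _) -exprVn !(hornerM, hornerD, hornerN, hornerX).
  by ring.
- rewrite (flat_le0 _ (ltW x0)).
  apply: (@near_eq_is_derive R R^o R^o (cst 0)).
    near=> y; rewrite flat_le0 //; apply: ltW; near: y; exact: lt_nbhsl.
- rewrite flat_le0 //; apply/is_derive1_caratheodory.
  (* The difference quotient at 0 stays in the family: dividing by [z] multiplies the polynomial in
     [z^-1] by ['X]. It tends to 0 by the linear bound. *)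
  exists (flat (p * 'X)); split; last by rewrite flat_le0.
  + move=> z; rewrite (flat_le0 p (lexx _)) !subr0 /flat.
    case: ifP => [z0|]; last by rewrite mul0r.
    by rewrite hornerMX mulrAC mulfVK // gt_eqF.
  + have [C HC] := flat_bound (p * 'X).
    suff : flat (p * 'X) z @[z --> (0 : R)] --> (0 : R).
      by rewrite /prop_for /continuous_at flat_le0.
    apply/cvgr0Pnorm_le => e e0; near=> z.
    apply: le_trans (HC z) _.
    apply: (@le_trans _ _ ((`|C| + 1) * `|z|)).
      by apply: ler_wpM2r => //; apply: (le_trans (ler_norm C)); rewrite lerDl.
    rewrite mulrC -ler_pdivlMr ?ltr_wpDl //; near: z.
    exists (e / (`|C| + 1)); first by rewrite /= divr_gt0 // ltr_wpDl.
    by move=> z; rewrite /= sub0r normrN => /ltW.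
Unshelve. all: by end_near. Qed.

Lemma Ck_flat k p : Ck k (fun v : 'rV[R]_1 => flat p (v ord0 ord0)).
Proof.
elim: k p => [|k IH] p.
  move=> /= x; apply: (@continuous_comp _ _ _ (fun v : 'rV[R]_1 => v ord0 ord0)).
    exact: coord_continuous.
  apply: differentiable_continuous; apply/derivable1_diffP.
  by have [] := is_derive_flat p (x ord0 ord0).
have df x : differentiable (flat p) x.
  by apply/derivable1_diffP; have [] := is_derive_flat p x.
have dc (x : 'rV[R]_1) : differentiable (fun v : 'rV[R]_1 => v ord0 ord0) x.
  exact: differentiable_coord.
rewrite CkSE; split=> [x|v].
  exact: (@differentiable_comp _ _ _ _ (fun v : 'rV[R]_1 => v ord0 ord0)).
rewrite (_ : 'D_v _ = (fun x => 'D_v (fun v : 'rV[R]_1 => v ord0 ord0) x) *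
  (fun x : 'rV[R]_1 => flat ((p - p^`()) * 'X^2) (x ord0 ord0))); last first.
  apply/funext => x.
  rewrite deriveE; last first.
    exact: (@differentiable_comp _ _ _ _ (fun v : 'rV[R]_1 => v ord0 ord0)).
  rewrite (@diff_comp _ _ _ _ (fun v : 'rV[R]_1 => v ord0 ord0)) //=.
  rewrite diff1E // -deriveE // fctE; congr (_ * _).
  by rewrite derive1E; have /@derive_val := is_derive_flat p (x ord0 ord0).
apply: Ck_mul; last exact: IH.
by have := @Ck_coord 1 k.+1 ord0; rewrite CkSE => -[_].
Qed.

Lemma Cinfty_cst n (c : R) : @Cinfty R n (cst c).
Proof. move=> k; exact: Ck_cst. Qed.

Lemma Cinfty_add n (F G : 'rV[R]_n -> R) :
  Cinfty F -> Cinfty G -> Cinfty (fun x => F x + G x).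
Proof. by move=> CF CG k; exact: (Ck_add (CF k) (CG k)). Qed.

Lemma Cinfty_mul n (F G : 'rV[R]_n -> R) :
  Cinfty F -> Cinfty G -> Cinfty (fun x => F x * G x).
Proof. by move=> CF CG k; exact: (Ck_mul (CF k) (CG k)). Qed.

Lemma Cinfty_inv n (F : 'rV[R]_n -> R) : (forall x, 0 < F x) -> Cinfty F ->
  Cinfty (fun x => (F x)^-1).
Proof. by move=> F0 CF k; apply: Ck_inv => //; exact: CF. Qed.

Lemma Cinfty_flat n (F : 'rV[R]_n -> R) : Cinfty F ->
  Cinfty (fun x => flat 1 (F x)).
Proof.
move=> CF k; have := Ck_comp (Ck_flat k 1) (fun _ : 'I_1 => CF k).
by congr (Ck k _); apply/funext => x; rewrite mxE.
Qed.

(* Agrees with [t^-1] where [t ^ 2 >= c], but is smooth everywhere. *)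
Definition smooth_inv (c t : R) : R := t / (t ^+ 2 + flat 1 (c - t ^+ 2)).

Lemma smooth_invE c t : 0 < c -> c <= t ^+ 2 -> smooth_inv c t = t^-1.
Proof.
move=> c0 ct; rewrite /smooth_inv flat_le0 ?subr_le0 // addr0.
have t0 : t != 0.
  by apply/eqP => t0; move: ct; rewrite t0 expr0n /= leNgt c0.
by rewrite expr2 invfM mulrA divff // mul1r.
Qed.

Lemma Cinfty_smooth_inv n (F : 'rV[R]_n -> R) c : 0 < c -> Cinfty F ->
  Cinfty (fun x => smooth_inv c (F x)).
Proof.
move=> c0 CF; rewrite /smooth_inv.
have C2 : Cinfty (fun x => F x ^+ 2) by exact: Cinfty_mul.
apply: (Cinfty_mul CF); apply: Cinfty_inv => [x|].
  have [->|x0] := eqVneq (F x) 0.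
    by rewrite expr0n /= add0r subr0 flat_gt0.
  by rewrite ltr_pwDl ?exprn_even_gt0 // flat_ge0.
apply: (Cinfty_add C2); apply: Cinfty_flat.
apply: (@Cinfty_add _ (cst c) (fun x => - F x ^+ 2)); first exact: Cinfty_cst.
have := Cinfty_mul (@Cinfty_cst n (-1)) C2.
by congr (Cinfty _); apply/funext => x; rewrite mulN1r.
Qed.

(** The inner [flat] vanishes for [t <= a], where the quotient is 1; for [t >= b] the argument of
    the outer [flat] is nonpositive. Nesting keeps the denominator constant, so no division of
    functions occurs. *)
Definition plateau (a b t : R) : R :=
  flat 1 (flat 1 (b - a) - flat 1 (t - a)) / flat 1 (flat 1 (b - a)).

Lemma plateau1 a b t : a < b -> t <= a -> plateau a b t = 1.
Proof.
move=> ab ta; rewrite /plateau (flat_le0 _ (_ : t - a <= 0)) ?subr_le0 //.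
by rewrite subr0 divff // gt_eqF // !flat_gt0 // subr_gt0.
Qed.

Lemma plateau0 a b t : b <= t -> plateau a b t = 0.
Proof.
move=> bt; rewrite /plateau (flat_le0 _ (_ : flat 1 _ - _ <= 0)) ?mul0r //.
by rewrite subr_le0 flat_mono // lerD2r.
Qed.

Lemma Cinfty_plateau n (F : 'rV[R]_n -> R) a b : Cinfty F ->
  Cinfty (fun x => plateau a b (F x)).
Proof.
move=> CF; apply: (@Cinfty_mul _ _ (cst _)); last exact: Cinfty_cst.
apply: Cinfty_flat; apply: (@Cinfty_add _ (cst _)); first exact: Cinfty_cst.
have := Cinfty_mul (@Cinfty_cst n (-1))
  (Cinfty_flat (Cinfty_add CF (@Cinfty_cst n (- a)))).
by congr (Cinfty _); apply/funext => x; rewrite mulN1r.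
Qed.

End Calculus.

(** * Differential spaces *)

Section SmoothFunctions.
Context {R : realType}.

(** The condition that [open_in] imposes at one point; it expresses whatever is only asked near [x],
    such as agreement of two functions. *)
Definition nbh {T} (X : space R T) (x : T) (O : set T) : Prop :=
  exists (n : nat) (a : 'I_n -> T -> R) (e : R),
    [/\ forall i, gens X (a i), 0 < e & near_pt X a e x `<=` O].

Lemma nbh_self {T} (X : space R T) x O : pts X x -> nbh X x O -> O x.
Proof.
move=> Xx [n [a [e [_ e0 aO]]]]; apply: aO; split=> // i.
by rewrite subrr normr0.
Qed.

Lemma nbhS {T} (X : space R T) x (O O' : set T) :
  (forall y, pts X y -> O y -> O' y) -> nbh X x O -> nbh X x O'.
Proof.
move=> OO' [n [a [e [ga e0 aO]]]]; exists n, a, e; split=> // y ay.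
by apply: OO'; [case: ay|exact: aO].
Qed.

Lemma nbh_near {T} (X : space R T) x n (a : 'I_n -> T -> R) e :
  (forall i, gens X (a i)) -> 0 < e -> nbh X x (near_pt X a e x).
Proof. by move=> ga e0; exists n, a, e; split. Qed.

Lemma nbh_all {T} (X : space R T) x (O : set T) :
  (forall y, pts X y -> O y) -> nbh X x O.
Proof.
move=> XO; exists 0, (fun _ _ => 0), 1; split=> //; first by case.
by move=> y [Xy _]; exact: XO.
Qed.

Lemma nbhI {T} (X : space R T) x (O O' : set T) :
  nbh X x O -> nbh X x O' -> nbh X x (O `&` O').
Proof.
move=> [n [a [e [ga e0 aO]]]] [m [b [d [gb d0 bO]]]].
exists (n + m)%N, (fun i => match fintype.split i with inl j => a j | inr j => b j end).
exists (Num.min e d); split.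
- by move=> i; case: (fintype.split i).
- by rewrite lt_min e0.
- move=> y [Xy Hy]; split.
  + apply: aO; split=> // i; have := Hy (lshift m i).
    by rewrite (unsplitK (inl i)) lt_min => /andP[].
  + apply: bO; split=> // i; have := Hy (rshift n i).
    by rewrite (unsplitK (inr i)) lt_min => /andP[].
Qed.

Lemma nbh_forall {T} (X : space R T) x n (O : 'I_n -> set T) :
  (forall i, nbh X x (O i)) -> nbh X x [set y | forall i, O i y].
Proof.
elim: n O => [|n IH] O HO; first by apply: nbh_all => y _ [].
have := nbhI (HO ord0) (IH _ (fun i => HO (lift ord0 i))).
apply: nbhS => y _ [H0 HS] i.
by case: (unliftP ord0 i) => [j ->|->//]; exact: HS.
Qed.

Lemma open_inI {T} (X : space R T) O O' :
  open_in X O -> open_in X O' -> open_in X (O `&` O').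
Proof. by move=> oO oO' x Xx [Ox Ox']; apply: nbhI; [exact: oO|exact: oO']. Qed.

Lemma nbh_restrict {T} (X : space R T) O x A :
  open_in X O -> pts X x -> O x -> nbh (restrict X O) x A -> nbh X x A.
Proof.
move=> oO Xx Ox [n [a [e [ga e0 aA]]]].
have gX : forall i, gens X (a i) := ga.
have := nbh_near x gX e0.
move=> /(nbhI (oO _ Xx Ox)); apply: nbhS => y Xy [Oy [_ Hy]].
by apply: aA.
Qed.

Lemma restrict_nbh {T} (X : space R T) O x A :
  nbh X x A -> nbh (restrict X O) x A.
Proof.
move=> [n [a [e [ga e0 aA]]]]; exists n, a, e; split=> // y [[Xy Oy] Hy].
exact: aA.
Qed.

Lemma smooth_gen {T} (X : space R T) f : gens X f -> smooth_fun X f.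
Proof.
move=> gf x Xx; exists 1%N, (fun _ => f), (fun v => v ord0 ord0), 1.
by split=> // [|y _]; [exact: Cinfty_coord|rewrite mxE].
Qed.

Lemma smooth_cst {T} (X : space R T) (c : R) : smooth_fun X (fun _ => c).
Proof.
move=> x Xx; exists 0, (fun _ _ => 0), (fun _ => c), 1.
by split=> //; [case|exact: Cinfty_cst].
Qed.

Lemma rV_continuousP n (F : 'rV[R]_n -> R) (u : 'rV[R]_n) (e : R) : continuous F -> 0 < e ->
  exists2 d : R, 0 < d & forall v : 'rV[R]_n, (forall i, `|v ord0 i - u ord0 i| < d) ->
    `|F v - F u| < e.
Proof.
move=> cF e0; have /cvgrPdist_lt /(_ e e0) := cF u.
move=> /nbhs_ballP[d /= d0 Hd]; exists d => // v Hv.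
rewrite distrC; apply: Hd; split=> // i j; rewrite ord1 /ball /= distrC.
exact: Hv.
Qed.

Lemma smooth_continuous {T} (X : space R T) f x e :
  smooth_fun X f -> pts X x -> 0 < e -> nbh X x [set y | `|f y - f x| < e].
Proof.
move=> sf Xx e0; have [n [a [F [d [ga CF d0 HF]]]]] := sf x Xx.
have [d' d'0 Hd'] := rV_continuousP (\row_i a i x) (Cinfty_continuous CF) e0.
have N1 := nbh_near x ga d0.
have N2 := nbh_near x ga d'0.
have := nbhI N1 N2; apply: nbhS => y Xy [Hy [_ Hy']] /=.
rewrite HF // (HF x); last by apply: nbh_self N1.
by apply: Hd' => i; rewrite !mxE.
Qed.

(** The generators representing the single [f i] near [x] are indexed by the dependent pairs [S] and
    enumerated into one family. The further generators [b] only cut out a neighbourhood on which all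
    the representations hold. *)
Lemma smooth_comp {T} (X : space R T) n (f : 'I_n -> T -> R)
    (F : 'rV[R]_n -> R) :
  (forall i, smooth_fun X (f i)) -> Cinfty F ->
  smooth_fun X (fun x => F (\row_i f i x)).
Proof.
move=> sf CF x Xx.
have /choice[r Hr] : forall i, exists r : {m : nat & (('I_m -> T -> R) * ('rV[R]_m -> R))%type},
    [/\ forall j, gens X ((projT2 r).1 j), Cinfty (projT2 r).2 &
      nbh X x [set y | f i y = (projT2 r).2 (\row_j (projT2 r).1 j y)]].
  move=> i; have [m [a [G [d [ga CG d0 HG]]]]] := sf i x Xx.
  by exists (existT _ m (a, G)); split=> //=; exists m, a, d.
pose m i := projT1 (r i); pose a i : 'I_(m i) -> T -> R := (projT2 (r i)).1.
pose G i : 'rV[R]_(m i) -> R := (projT2 (r i)).2.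
pose S := {i : 'I_n & 'I_(m i)}.
have [N [b [e [gb e0 bO]]]] : nbh X x [set y | forall i, f i y = G i (\row_j a i j y)].
  by apply: nbh_forall => i; case: (Hr i).
pose A (k : 'I_#|{: S}|) := a (tag (enum_val k)) (tagged (enum_val k)).
pose H (v : 'rV[R]_#|{: S}|) := F (\row_i G i (\row_j v ord0 (enum_rank (Tagged _ j : S)))).
have CH : Cinfty H.
  apply: (Cinfty_comp CF) => i; apply: Cinfty_comp; first by case: (Hr i).
  by move=> j; exact: Cinfty_coord.
exists (N + #|{: S}|)%N.
exists (fun k => match fintype.split k with inl j => b j | inr j => A j end).
exists (fun v => H (\row_k v ord0 (rshift N k))), e; split=> //.
- move=> k; case: (fintype.split k) => // j; rewrite /A; case: (enum_val j) => i l /=.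
  have [gi _ _] := Hr i; exact: gi.
- by apply: (Cinfty_comp CH) => k; exact: Cinfty_coord.
- move=> y [Xy Hy]; congr F; apply/rowP => i; rewrite !mxE.
  rewrite (bO y); last first.
    split=> // j; have := Hy (lshift _ j).
    by rewrite (unsplitK (inl j)).
  congr (G i _); apply/rowP => j; rewrite !mxE (unsplitK (inr _)).
  by rewrite /A enum_rankK.
Qed.

Lemma smooth_local {T} (X : space R T) f :
  (forall x, pts X x ->
    exists2 g, smooth_fun X g & nbh X x [set y | f y = g y]) ->
  smooth_fun X f.
Proof.
move=> Hf x Xx; have [g sg Ng] := Hf x Xx.
have [n [a [F [e [ga CF e0 HF]]]]] := sg x Xx.
have [N [b [d [gb d0 bO]]]] := nbhI Ng
  (ex_intro _ n (ex_intro _ a (ex_intro _ e (And3 ga e0 (fun y h => h))))).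
exists (N + n)%N.
exists (fun k => match fintype.split k with inl j => b j | inr j => a j end).
exists (fun v => F (\row_k v ord0 (rshift N k))), d; split=> //.
- by move=> k; case: (fintype.split k).
- by apply: (Cinfty_comp CF) => k; exact: Cinfty_coord.
- move=> y [Xy Hy].
  have /bO[/= -> ny] : near_pt X b d x y.
    split=> // j; have := Hy (lshift _ j).
    by rewrite (unsplitK (inl j)).
  rewrite HF //; congr F; apply/rowP => j.
  by rewrite !mxE (unsplitK (inr _)).
Qed.

Lemma eq_smooth {T} (X : space R T) f g :
  (forall x, pts X x -> f x = g x) -> smooth_fun X f -> smooth_fun X g.
Proof.
move=> fg sf; apply: smooth_local => x Xx; exists f => //.
by apply: nbh_all => y Xy /=; rewrite fg.
Qed.

Lemma smooth_add {T} (X : space R T) f g : smooth_fun X f -> smooth_fun X g ->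
  smooth_fun X (fun x => f x + g x).
Proof.
move=> sf sg.
have := @smooth_comp T X 2 (fun i => if i == ord0 then f else g)
  (fun v => v ord0 ord0 + v ord0 (lift ord0 ord0)).
move=> /(_ _ _)/(@eq_smooth _ _ _ _); apply.
- by move=> x _; rewrite !mxE /=.
- by move=> i; case: ifP.
- by apply: Cinfty_add; exact: Cinfty_coord.
Qed.

Lemma smooth_mul {T} (X : space R T) f g : smooth_fun X f -> smooth_fun X g ->
  smooth_fun X (fun x => f x * g x).
Proof.
move=> sf sg.
have := @smooth_comp T X 2 (fun i => if i == ord0 then f else g)
  (fun v => v ord0 ord0 * v ord0 (lift ord0 ord0)).
move=> /(_ _ _)/(@eq_smooth _ _ _ _); apply.
- by move=> x _; rewrite !mxE /=.
- by move=> i; case: ifP.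
- by apply: Cinfty_mul; exact: Cinfty_coord.
Qed.

Lemma smooth_sum {T} (X : space R T) (I : Type) (r : seq I) (P : pred I)
    (f : I -> T -> R) : (forall i, smooth_fun X (f i)) ->
  smooth_fun X (fun x => \sum_(i <- r | P i) f i x).
Proof.
move=> sf; elim: r => [|i r IH].
  rewrite (_ : (fun _ => _) = fun _ => 0); first exact: smooth_cst.
  by apply/funext => x; rewrite big_nil.
case Pi : (P i); last first.
  move: IH; congr (smooth_fun X _); apply/funext => x.
  by rewrite big_cons Pi.
have := smooth_add (sf i) IH; congr (smooth_fun X _); apply/funext => x.
by rewrite big_cons Pi.
Qed.

Lemma smooth_prod {T} (X : space R T) (I : Type) (r : seq I) (P : pred I)
    (f : I -> T -> R) : (forall i, smooth_fun X (f i)) ->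
  smooth_fun X (fun x => \prod_(i <- r | P i) f i x).
Proof.
move=> sf; elim: r => [|i r IH].
  rewrite (_ : (fun _ => _) = fun _ => 1); first exact: smooth_cst.
  by apply/funext => x; rewrite big_nil.
case Pi : (P i); last first.
  move: IH; congr (smooth_fun X _); apply/funext => x.
  by rewrite big_cons Pi.
have := smooth_mul (sf i) IH; congr (smooth_fun X _); apply/funext => x.
by rewrite big_cons Pi.
Qed.

Lemma smooth_det {T} (X : space R T) n (M : T -> 'M[R]_n) :
  (forall i j, smooth_fun X (fun x => M x i j)) ->
  smooth_fun X (fun x => \det (M x)).
Proof.
move=> sM; rewrite /determinant; apply: smooth_sum => s.
apply: smooth_mul; first exact: smooth_cst.
by apply: smooth_prod => i; exact: sM.
Qed.

Lemma smooth_inv_local {T} (X : space R T) f x : smooth_fun X f -> pts X x ->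
  (* With [c] half of [f x ^+ 2], the square of [f] stays above [c] near [x], where [smooth_inv c]
     is the true inverse. *)
  f x != 0 -> exists2 g, smooth_fun X g & nbh X x [set y | g y = (f y)^-1].
Proof.
move=> sf Xx fx0; pose c := f x ^+ 2 / 2.
have c0 : 0 < c by rewrite divr_gt0 // exprn_even_gt0.
exists (fun y => smooth_inv c (f y)).
  have := @smooth_comp T X 1 (fun _ => f) _ (fun _ => sf)
    (Cinfty_smooth_inv c0 (@Cinfty_coord R 1 ord0)).
  by apply: eq_smooth => y _; rewrite mxE.
have := smooth_continuous (smooth_mul sf sf) Xx c0.
apply: nbhS => y Xy /= Hy; rewrite smooth_invE //.
move: Hy; rewrite -!expr2 ltr_norml => /andP[+ _].
by rewrite /c; lra.
Qed.

(** A plateau applied to the sum [s] of squared differences of generators: [s >= e ^+ 2] off [O],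
    while the plateau ends at [e ^+ 2 / 2]. Vanishing is asserted near every point off [O], not just
    at it, so that products with the bump extend smoothly by 0 without reference to supports. *)
Lemma bump {T} (X : space R T) x O : pts X x -> nbh X x O ->
  exists chi, [/\ smooth_fun X chi, nbh X x [set y | chi y = 1] &
    forall y, pts X y -> ~ O y -> nbh X y [set z | chi z = 0]].
Proof.
move=> Xx [n [a [e [ga e0 aO]]]].
pose s y := \sum_i (a i y - a i x) ^+ 2.
have ss : smooth_fun X s.
  apply: smooth_sum => i.
  have sd : smooth_fun X (fun y => a i y - a i x).
    by apply: smooth_add; [exact: smooth_gen|exact: smooth_cst].
  by apply: eq_smooth (smooth_mul sd sd) => y _; rewrite expr2.
have e20 : 0 < e ^+ 2 by rewrite exprn_gt0.
have e80 : 0 < e ^+ 2 / 4 by rewrite divr_gt0.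
pose p t := plateau (e ^+ 2 / 4) (e ^+ 2 / 2) t.
exists (fun y => p (s y)); split.
- have := @smooth_comp T X 1 (fun _ => s) _ (fun _ => ss)
    (Cinfty_plateau (e ^+ 2 / 4) (e ^+ 2 / 2) (@Cinfty_coord R 1 ord0)).
  by apply: eq_smooth => y _; rewrite mxE.
- have := smooth_continuous ss Xx e80; apply: nbhS => y Xy /=.
  have -> : s x = 0.
    by rewrite /s big1 // => i _; rewrite subrr expr0n.
  rewrite subr0 ltr_norml => /andP[_ sy].
  by rewrite /p plateau1 ?(ltW sy) //; lra.
- move=> y Xy Oy; have sy : e ^+ 2 <= s y.
    rewrite leNgt; apply/negP => sy; apply: Oy; apply: aO; split=> // i.
    rewrite -ltr_sqr ?nnegrE ?(ltW e0) // real_normK ?num_real //.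
    apply: le_lt_trans sy; rewrite /s (bigD1 i) //= lerDl.
    by apply: sumr_ge0 => j _; exact: sqr_ge0.
  have := smooth_continuous ss Xy e80; apply: nbhS => z Xz /=.
  rewrite ltr_norml => /andP[sz _]; rewrite /p plateau0 //.
  by move: sz sy; lra.
Qed.

Lemma smooth_cutoff {T} (X : space R T) O f chi : open_in X O ->
  smooth_fun X chi ->
  (forall y, pts X y -> ~ O y -> nbh X y [set z | chi z = 0]) ->
  smooth_fun (restrict X O) f ->
  smooth_fun X (fun y => if `[< O y >] then chi y * f y else 0).
Proof.
move=> oO schi chi0 sf.
apply: smooth_local => y Xy; have [Oy|Oy] := pselect (O y); last first.
  exists (fun _ => 0); first exact: smooth_cst.
  have := chi0 y Xy Oy; apply: nbhS => z _ /= ->.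
  by rewrite mul0r if_same.
have [n [a [F [e [ga CF e0 HF]]]]] := sf y (conj Xy Oy).
have gX : forall i, gens X (a i) := ga.
exists (fun z => chi z * F (\row_i a i z)).
  apply: (smooth_mul schi); apply: smooth_comp => // i; exact: smooth_gen.
have := nbh_near y gX e0.
move=> /(nbhI (oO y Xy Oy)); apply: nbhS => z Xz [Oz [_ Hz]] /=.
by rewrite asboolT // HF.
Qed.

Lemma smooth_extend {T} (X : space R T) x O f : open_in X O -> pts X x -> O x ->
  smooth_fun (restrict X O) f ->
  exists2 g, smooth_fun X g & nbh X x [set y | g y = f y].
Proof.
move=> oO Xx Ox sf; have [chi [schi chi1 chi0]] := bump Xx (oO x Xx Ox).
exists (fun y => if `[< O y >] then chi y * f y else 0); first exact: smooth_cutoff.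
have := nbhI chi1 (oO x Xx Ox); apply: nbhS => y Xy [/= -> Oy].
by rewrite asboolT // mul1r.
Qed.

Lemma smooth_restrict {T} (X : space R T) O f :
  smooth_fun X f -> smooth_fun (restrict X O) f.
Proof.
move=> sf x [Xx Ox]; have [n [a [F [e [ga CF e0 HF]]]]] := sf x Xx.
exists n, a, F, e; split=> // y [[Xy Oy] Hy]; exact: HF.
Qed.

Lemma smooth_of_local {T} (X : space R T) f :
  (forall x, pts X x -> exists O, [/\ open_in X O, O x &
     smooth_fun (restrict X O) f]) -> smooth_fun X f.
Proof.
move=> Hf; apply: smooth_local => x Xx; have [U [oU Ux sf]] := Hf x Xx.
have [g sg gf] := smooth_extend oU Xx Ux sf; exists g => //.
by apply: nbhS gf => y _ /= ->.
Qed.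

Lemma smooth_map_gens {T T'} (X : space R T) (Y : space R T') f :
  (forall x, pts X x -> pts Y (f x)) ->
  (forall g, gens Y g -> smooth_fun X (g \o f)) -> smooth_map X Y f.
Proof.
move=> fXY fg; split=> // h sh; apply: smooth_local => x Xx.
have [n [a [F [e [ga CF e0 HF]]]]] := sh (f x) (fXY x Xx).
exists (fun y => F (\row_i (a i \o f) y)).
  by apply: smooth_comp => // i; exact: fg.
have : nbh X x [set y | forall i, `|(a i \o f) y - (a i \o f) x| < e].
  by apply: nbh_forall => i; apply: smooth_continuous => //; exact: fg.
apply: nbhS => y Xy /= Hy; apply: HF; split=> //; exact: fXY.
Qed.

Lemma smooth_map_id {T} (X : space R T) : smooth_map X X id.
Proof. by []. Qed.

Lemma smooth_map_comp {T1 T2 T3} (X : space R T1) (Y : space R T2)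
    (Z : space R T3) f g :
  smooth_map X Y f -> smooth_map Y Z g -> smooth_map X Z (g \o f).
Proof.
move=> [fXY sf] [gYZ sg]; split=> [x Xx|h sh]; first exact/gYZ/fXY.
exact: (sf _ (sg _ sh)).
Qed.

Lemma eq_smooth_map {T1 T2} (X : space R T1) (Y : space R T2) f g :
  (forall x, pts X x -> f x = g x) -> smooth_map X Y f -> smooth_map X Y g.
Proof.
move=> fg [fXY sf]; split=> [x Xx|h sh]; first by rewrite -fg //; exact: fXY.
by apply: eq_smooth (sf h sh) => x Xx /=; rewrite fg.
Qed.

Lemma smooth_map_cst {T1 T2} (X : space R T1) (Y : space R T2) y :
  pts Y y -> smooth_map X Y (fun _ => y).
Proof. by move=> Yy; split=> // h sh; exact: smooth_cst. Qed.

Lemma smooth_map_incl {T} (X : space R T) O : smooth_map (restrict X O) X id.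
Proof. by split=> [x []//|h sh]; exact: smooth_restrict. Qed.

Lemma smooth_map_restrict {T T'} (X : space R T) (Y : space R T') O f :
  smooth_map X Y f -> (forall x, pts X x -> O (f x)) ->
  smooth_map X (restrict Y O) f.
Proof.
move=> [fXY sf] fO; apply: smooth_map_gens => [x Xx|g gg].
  by split; [exact: fXY|exact: fO].
by apply: sf; exact: smooth_gen.
Qed.

Lemma smooth_map_restrict2 {T T'} (X : space R T) (Y : space R T') O O' f :
  smooth_map X Y f -> (forall x, pts X x -> O x -> O' (f x)) ->
  smooth_map (restrict X O) (restrict Y O') f.
Proof.
move=> sf fO; apply: smooth_map_restrict => [|x [Xx Ox]]; last exact: fO.
exact: (smooth_map_comp (@smooth_map_incl _ X O) sf).
Qed.

Lemma smooth_map_of_local {T T'} (X : space R T) (Y : space R T') f :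
  (forall x, pts X x -> exists O, [/\ open_in X O, O x &
     smooth_map (restrict X O) Y f]) -> smooth_map X Y f.
Proof.
move=> Hf; split=> [x Xx|h sh].
  by have [U [_ Ux [+ _]]] := Hf x Xx; apply.
apply: smooth_of_local => x Xx; have [U [oU Ux [_ sf]]] := Hf x Xx.
by exists U; split=> //; exact: sf.
Qed.

Lemma open_preimage {T T'} (X : space R T) (Y : space R T') f O :
  smooth_map X Y f -> open_in Y O -> open_in X (f @^-1` O).
Proof.
move=> [fXY sf] oO x Xx Ofx.
have [n [a [e [ga e0 aO]]]] := oO (f x) (fXY x Xx) Ofx.
have : nbh X x [set y | forall i, `|(a i \o f) y - (a i \o f) x| < e].
  apply: nbh_forall => i; apply: smooth_continuous => //.
  by apply: sf; exact: smooth_gen.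
apply: nbhS => y Xy Hy; apply: aO; split=> //; exact: fXY.
Qed.

Lemma nbh_preimage {T T'} (X : space R T) (Y : space R T') f x A :
  smooth_map X Y f -> pts X x -> nbh Y (f x) A -> nbh X x (f @^-1` A).
Proof.
move=> [fXY sf] Xx [n [a [e [ga e0 aO]]]].
have : nbh X x [set y | forall i, `|(a i \o f) y - (a i \o f) x| < e].
  apply: nbh_forall => i; apply: smooth_continuous => //.
  by apply: sf; exact: smooth_gen.
apply: nbhS => y Xy Hy; apply: aO; split=> //; exact: fXY.
Qed.

Lemma smooth_map_fst {T T'} (X : space R T) (Y : space R T') :
  smooth_map (prod_space X Y) X fst.
Proof.
apply: smooth_map_gens => [x []//|g gg]; apply: smooth_gen; left.
by exists g.
Qed.

Lemma smooth_map_snd {T T'} (X : space R T) (Y : space R T') :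
  smooth_map (prod_space X Y) Y snd.
Proof.
apply: smooth_map_gens => [x []//|g gg]; apply: smooth_gen; right.
by exists g.
Qed.

Lemma smooth_map_pair {T T1 T2} (X : space R T) (Y : space R T1)
    (Z : space R T2) f g :
  smooth_map X Y f -> smooth_map X Z g ->
  smooth_map X (prod_space Y Z) (fun x => (f x, g x)).
Proof.
move=> [fXY sf] [gXZ sg]; apply: smooth_map_gens => [x Xx|h].
  by split; [exact: fXY|exact: gXZ].
case=> -[k gk ->].
  by apply: sf; exact: smooth_gen.
by apply: sg; exact: smooth_gen.
Qed.

Lemma diffeo_smooth {T T'} (X : space R T) (Y : space R T') f :
  diffeomorphism X Y f -> smooth_map X Y f.
Proof. by case. Qed.

End SmoothFunctions.

(** * Tangent vectors, differentials and curves *)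

Section Tangents.
Context {R : realType}.

Lemma near_pt_nbh {T} (X : space R T) n (a : 'I_n -> T -> R) e x y :
  (forall i, gens X (a i)) -> near_pt X a e x y ->
  nbh X y (near_pt X a e x).
Proof.
move=> ga [Xy Hy].
have : nbh X y [set z | forall i, `|a i z - a i y| < e - `|a i y - a i x|].
  apply: nbh_forall => i; apply: smooth_continuous => //.
    exact: smooth_gen.
  by rewrite subr_gt0.
apply: nbhS => z Xz /= Hz; split=> // i.
rewrite -(subrKA (a i y)); apply: le_lt_trans (ler_normD _ _) _.
by rewrite -ltrBrDr; exact: Hz.
Qed.

(** The chain rule axiom with [F] the identity of the line compares [D f] and [D g], since it only
    asks for equality at the points. *)
Lemma tangent_ext {T} (X : space R T) x D (f g : T -> R) : tangent X x D ->
  (forall y, pts X y -> f y = g y) -> D f = D g.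
Proof.
move=> [Xx D0 Dc] fg.
have [sf|nsf] := pselect (smooth_fun X f); last first.
  rewrite !D0 // => sg; apply: nsf; apply: eq_smooth sg => y Xy.
  by rewrite fg.
rewrite (Dc 1%N (fun _ => f) (fun v => v ord0 ord0) g) //.
- by rewrite big_ord_recl big_ord0 addr0 derive_coord mul1r.
- exact: Cinfty_coord.
- by move=> y Xy; rewrite mxE fg.
Qed.

Lemma tangent_cst {T} (X : space R T) x D (c : R) : tangent X x D ->
  D (fun _ => c) = 0.
Proof.
move=> [Xx D0 Dc].
rewrite (Dc 0 (fun _ _ => 0) (fun _ => c)) ?big_ord0 //; first by case.
exact: Cinfty_cst.
Qed.

Lemma tangent_mul {T} (X : space R T) x D (f g : T -> R) : tangent X x D ->
  smooth_fun X f -> smooth_fun X g ->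
  D (fun y => f y * g y) = f x * D g + g x * D f.
Proof.
move=> [Xx D0 Dc] sf sg.
pose a (i : 'I_2) := if i == ord0 then f else g.
rewrite (Dc 2 a (fun v => v ord0 ord0 * v ord0 (lift ord0 ord0))).
- rewrite big_ord_recl big_ord_recl big_ord0 addr0 /a /=.
  have dc i v : differentiable (fun v : 'rV[R]_2 => v ord0 i) v.
    exact: differentiable_coord.
  have E v w : 'D_v (fun u : 'rV[R]_2 => u ord0 ord0 * u ord0 (lift ord0 ord0)) w =
      w ord0 ord0 * 'D_v (fun u : 'rV[R]_2 => u ord0 (lift ord0 ord0)) w +
      w ord0 (lift ord0 ord0) * 'D_v (fun u : 'rV[R]_2 => u ord0 ord0) w.
    by apply: (@deriveM _ _ (fun u : 'rV[R]_2 => u ord0 ord0));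
      exact: diff_derivable.
  rewrite !E !derive_coord !mxE /=.
  by rewrite !mulr0 !mulr1 add0r addr0 addrC.
- by rewrite /a => i; case: ifP.
- by apply: Cinfty_mul; exact: Cinfty_coord.
- by move=> y _; rewrite !mxE.
Qed.

Lemma tangent_add {T} (X : space R T) x D (f g : T -> R) : tangent X x D ->
  smooth_fun X f -> smooth_fun X g -> D (fun y => f y + g y) = D f + D g.
Proof.
move=> [Xx D0 Dc] sf sg.
pose a (i : 'I_2) := if i == ord0 then f else g.
rewrite (Dc 2 a (fun v => v ord0 ord0 + v ord0 (lift ord0 ord0))).
- rewrite big_ord_recl big_ord_recl big_ord0 addr0 /a /=.
  have dc i v : differentiable (fun v : 'rV[R]_2 => v ord0 i) v.
    exact: differentiable_coord.
  have E v w : 'D_v (fun u : 'rV[R]_2 => u ord0 ord0 + u ord0 (lift ord0 ord0)) w =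
      'D_v (fun u : 'rV[R]_2 => u ord0 ord0) w +
      'D_v (fun u : 'rV[R]_2 => u ord0 (lift ord0 ord0)) w.
    by apply: (@deriveD _ _ _ (fun u : 'rV[R]_2 => u ord0 ord0));
      exact: diff_derivable.
  by rewrite !E !derive_coord /= !addr0 !add0r !mul1r.
- by rewrite /a => i; case: ifP.
- by apply: Cinfty_add; exact: Cinfty_coord.
- by move=> y _; rewrite !mxE.
Qed.

Lemma tangent_scale {T} (X : space R T) x D (c : R) (f : T -> R) :
  tangent X x D -> smooth_fun X f -> D (fun y => c * f y) = c * D f.
Proof.
move=> TD sf; rewrite (tangent_mul TD (@smooth_cst _ _ X c) sf).
by rewrite (tangent_cst c TD) mulr0 addr0.
Qed.

(* Multiplying [f - g] by a bump function supported where [f = g] gives 0. *)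
Lemma tangent_local {T} (X : space R T) x D (f g : T -> R) : tangent X x D ->
  smooth_fun X f -> smooth_fun X g -> nbh X x [set y | f y = g y] ->
  D f = D g.
Proof.
move=> TD sf sg fg; have [Xx _ _] := TD.
have [chi [schi chi1 chi0]] := bump Xx fg.
have sh : smooth_fun X (fun y => f y + -1 * g y).
  by apply: smooth_add => //; apply: smooth_mul => //; exact: smooth_cst.
have : D (fun y => chi y * (f y + -1 * g y)) = 0.
  rewrite -(tangent_cst 0 TD); apply: (tangent_ext TD) => y Xy.
  have [/= fgy|nfgy] := pselect ([set y | f y = g y] y).
    by rewrite fgy mulN1r subrr mulr0.
  by rewrite (nbh_self Xy (chi0 y Xy nfgy)) mul0r.
rewrite (tangent_mul TD schi sh) (nbh_self Xx chi1) mul1r.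
rewrite (_ : f x + _ = 0); last by rewrite mulN1r (nbh_self Xx fg) subrr.
rewrite mul0r addr0 (tangent_add TD sf); last first.
  by apply: smooth_mul => //; exact: smooth_cst.
by rewrite (tangent_scale _ TD sg) mulN1r => /subr0_eq.
Qed.

Lemma tangent_chain {T} (X : space R T) x D n (a : 'I_n -> T -> R) F f :
  tangent X x D -> smooth_fun X f -> (forall i, smooth_fun X (a i)) ->
  Cinfty F -> nbh X x [set y | f y = F (\row_i a i y)] ->
  D f = \sum_i 'D_(delta_mx ord0 i) F (\row_j a j x) * D (a i).
Proof.
move=> TD sf sa CF fF; rewrite (tangent_local TD sf _ fF).
  by have [_ _ Dc] := TD; exact: Dc.
exact: smooth_comp.
Qed.

Lemma tangent_gens {T} (X : space R T) x D D' :
  tangent X x D -> tangent X x D' -> (forall g, gens X g -> D g = D' g) ->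
  D = D'.
Proof.
move=> TD TD' DD'; apply/funext => f.
have [Xx D0 _] := TD; have [_ D'0 _] := TD'.
have [sf|nsf] := pselect (smooth_fun X f); last by rewrite D0 // D'0.
have [n [a [F [e [ga CF e0 HF]]]]] := sf x Xx.
have sa i : smooth_fun X (a i) by exact: smooth_gen.
have fF : nbh X x [set y | f y = F (\row_i a i y)].
  by apply: nbhS (nbh_near x ga e0) => y _; exact: HF.
rewrite (tangent_chain TD sf sa CF fF) (tangent_chain TD' sf sa CF fF).
by apply: eq_bigr => i _; rewrite DD'.
Qed.

Lemma tangent_lin {T} (X : space R T) x (c : R) D D' :
  tangent X x D -> tangent X x D' -> tangent X x (c *: D + D').
Proof.
move=> [Xx D0 Dc] [_ D0' Dc']; split=> // [f nsf|n a F f sa CF fF].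
  by rewrite -[LHS]/(c * D f + D' f) D0 // D0' // mulr0 addr0.
rewrite -[LHS]/(c * D f + D' f) (Dc _ _ _ _ sa CF fF) (Dc' _ _ _ _ sa CF fF).
rewrite mulr_sumr -big_split; apply: eq_bigr => i _ /=.
by rewrite -[X in _ = _ * X]/(c * D (a i) + D' (a i)) mulrDr mulrCA.
Qed.

Lemma tangent0 {T} (X : space R T) x : pts X x -> tangent X x 0.
Proof.
move=> Xx; split=> // n a F f _ _ _.
by rewrite big1 // => i _; exact: mulr0.
Qed.

Lemma pushE {T T'} (Y : space R T') (f : T -> T') D h :
  smooth_fun Y h -> push Y f D h = D (h \o f).
Proof. by move=> sh; rewrite /push asboolT. Qed.

Lemma push_tangent {T T'} (X : space R T) (Y : space R T') f x D :
  smooth_map X Y f -> tangent X x D -> tangent Y (f x) (push Y f D).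
Proof.
move=> [fXY sf] [Xx D0 Dc]; split; first exact: fXY.
  by move=> h nsh; rewrite /push asboolF.
move=> n a F h sa CF hF; rewrite pushE; last first.
  by apply: eq_smooth (smooth_comp sa CF) => y Yy; rewrite hF.
rewrite (Dc n (fun i => a i \o f) F).
- by apply: eq_bigr => i _; rewrite pushE.
- by move=> i; exact: sf.
- by [].
- by move=> y Xy /=; rewrite hF //; exact: fXY.
Qed.

Lemma push_comp {T1 T2 T3} (Y : space R T2) (Z : space R T3)
    (f : T1 -> T2) (g : T2 -> T3) D :
  smooth_map Y Z g -> push Z g (push Y f D) = push Z (g \o f) D.
Proof.
move=> [_ sg]; apply/funext => h; rewrite {1 3}/push.
by case: asboolP => // sh; rewrite pushE //; exact: sg.
Qed.

Lemma push_linear {T T'} (Y : space R T') (f : T -> T') :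
  linear (push Y f : functional (R := R) T -> functional (R := R) T').
Proof.
move=> c D D'; apply/funext => h; rewrite /push.
by rewrite -[RHS]/(c * (if _ then _ else _) + (if _ then _ else _));
  case: asboolP => // _; rewrite mulr0 addr0.
Qed.

Lemma push0 {T T'} (Y : space R T') (f : T -> T') :
  push Y f (0 : functional (R := R) T) = 0.
Proof. by apply/funext => h; rewrite /push; case: ifP. Qed.

Lemma push_ext {T T'} (X : space R T) (Y : space R T') f g x D :
  tangent X x D -> (forall y, pts X y -> f y = g y) ->
  push Y f D = push Y g D.
Proof.
move=> TD fg; apply/funext => h; rewrite /push; case: asboolP => // _.
by apply: (tangent_ext TD) => y Xy /=; rewrite fg.
Qed.

Lemma push_id {T} (X : space R T) x D : tangent X x D -> push X id D = D.
Proof.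
move=> [Xx D0 _]; apply/funext => h; rewrite /push.
by case: asboolP => // nsh; rewrite D0.
Qed.

Lemma push_cst {T T'} (X : space R T) (Y : space R T') x D (y : T') :
  tangent X x D -> push Y (fun _ => y) D = 0.
Proof.
move=> TD; apply/funext => h; rewrite /push; case: asboolP => // _.
exact: (tangent_cst _ TD).
Qed.

Lemma diffeo_push_inj {T T'} (X : space R T) (Y : space R T') f x x' D D' :
  diffeomorphism X Y f -> tangent X x D -> tangent X x' D' ->
  push Y f D = push Y f D' -> D = D'.
Proof.
move=> [sf [g [sg gf fg]]] TD TD' /(congr1 (push X g)).
rewrite !push_comp // (push_ext X TD gf) (push_ext X TD' gf).
by rewrite (push_id TD) (push_id TD').
Qed.

Lemma diffeo_push_onto {T T'} (X : space R T) (Y : space R T') f x D' :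
  diffeomorphism X Y f -> pts X x -> tangent Y (f x) D' ->
  exists2 D, tangent X x D & push Y f D = D'.
Proof.
move=> [sf [g [sg gf fg]]] Xx TD'; exists (push X g D').
  by have := push_tangent sg TD'; rewrite gf.
by rewrite push_comp // (push_ext Y TD' fg) (push_id TD').
Qed.

Lemma restrict_tangent_inj {T} (X : space R T) O x D D' :
  tangent (restrict X O) x D -> tangent (restrict X O) x D' ->
  push X id D = push X id D' -> D = D'.
Proof.
move=> TD TD' DD'; apply: (tangent_gens TD TD') => g gg.
have sg : smooth_fun X g by exact: smooth_gen.
by have := congr1 (fun E => E g) DD'; rewrite !pushE.
Qed.

(** A function smooth on [O] agrees near [x] with one smooth on [X], and [D'] evaluates [D] on a
    chosen extension of this kind. By locality of [D] the choice is immaterial. *)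
Lemma restrict_tangent_onto {T} (X : space R T) O x D :
  open_in X O -> O x -> tangent X x D ->
  exists2 D', tangent (restrict X O) x D' & push X id D' = D.
Proof.
move=> oO Ox TD; have [Xx D0 Dc] := TD.
have /choice[ext Hext] : forall f, exists g, smooth_fun (restrict X O) f ->
    smooth_fun X g /\ nbh X x [set y | g y = f y].
  move=> f; have [sf|nsf] := pselect (smooth_fun (restrict X O) f).
    by have [g sg gf] := smooth_extend oO Xx Ox sf; exists g.
  by exists f.
pose D' : functional T :=
  fun f => if `[< smooth_fun (restrict X O) f >] then D (ext f) else 0.
have D'E f : smooth_fun (restrict X O) f -> D' f = D (ext f).
  by move=> sf; rewrite /D' asboolT.
have D'0 f : ~ smooth_fun (restrict X O) f -> D' f = 0.
  by move=> nsf; rewrite /D' asboolF.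
move: D' D'E D'0 => D' D'E D'0; exists D'; last first.
  apply/funext => f; have [sf|nsf] := pselect (smooth_fun X f); last first.
    by rewrite /push asboolF // D0.
  have sfO := smooth_restrict (O := O) sf; have [sg gf] := Hext f sfO.
  by rewrite pushE // D'E //; exact: (tangent_local TD).
split=> // n a F f sa CF fF.
have sf : smooth_fun (restrict X O) f.
  by apply: eq_smooth (smooth_comp sa CF) => y Xy; rewrite fF.
have [sg gf] := Hext f sf.
rewrite D'E //.
have sea i : smooth_fun X (ext (a i)) by have [] := Hext _ (sa i).
have ea i : nbh X x [set y | ext (a i) y = a i y] by have [] := Hext _ (sa i).
rewrite (@tangent_chain _ X x D n (fun i => ext (a i)) F) //; last first.
  have := nbhI (oO x Xx Ox) (nbhI gf (nbh_forall ea)); apply: nbhS => y Xy.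
  move=> [Oy [/= -> ay]]; rewrite fF //; congr F; apply/rowP => i.
  by rewrite !mxE ay.
have -> : \row_j ext (a j) x = \row_j a j x.
  by apply/rowP => j; rewrite !mxE (nbh_self Xx (ea j)).
by apply: eq_bigr => i _; rewrite D'E.
Qed.

(** An open subspace has more smooth functions, so its tangent vectors are different functionals;
    this is the inverse of the differential of the inclusion. The default 0 only occurs when [D] is
    not a tangent vector at a point of [O]. *)
Definition loc {T} (X : space R T) (O : set T) (x : T) (D : functional T) :
    functional (R := R) T :=
  xget 0 [set D' | tangent (restrict X O) x D' /\ push X id D' = D].

Lemma locP {T} (X : space R T) O x D : open_in X O -> O x -> tangent X x D ->
  tangent (restrict X O) x (loc X O x D) /\ push X id (loc X O x D) = D.
Proof.
move=> oO Ox TD; have [D' TD' D'D] := restrict_tangent_onto oO Ox TD.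
by rewrite /loc; case: xgetP => [//|/(_ D')]; elim.
Qed.

Lemma loc_smooth {T} (X : space R T) O x D f : open_in X O -> O x ->
  tangent X x D -> smooth_fun X f -> loc X O x D f = D f.
Proof.
move=> oO Ox TD sf; have [_ {2}<-] := locP oO Ox TD.
by rewrite pushE.
Qed.

Lemma loc_lin {T} (X : space R T) O x c D D' : open_in X O -> O x ->
  tangent X x D -> tangent X x D' ->
  loc X O x (c *: D + D') = c *: loc X O x D + loc X O x D'.
Proof.
move=> oO Ox TD TD'.
have [T1 E1] := locP oO Ox TD; have [T2 E2] := locP oO Ox TD'.
have [T3 E3] := locP oO Ox (tangent_lin c TD TD').
apply: (restrict_tangent_inj T3 (tangent_lin c T1 T2)).
by rewrite E3 push_linear E1 E2.
Qed.

Lemma push_prod_snd {T T'} (X : space R T) (Y : space R T') p D :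
  tangent (prod_space X Y) p D -> push X fst D = 0 ->
  D = push (prod_space X Y) (fun y => (p.1, y)) (push Y snd D).
Proof.
move=> TD D1; have [[Xp Yp] _ _] := TD.
have sp : smooth_map Y (prod_space X Y) (fun y => (p.1, y)).
  by apply: smooth_map_pair => //; exact: smooth_map_cst.
have TD2 := push_tangent (@smooth_map_snd _ _ _ X Y) TD.
have := push_tangent sp TD2; rewrite /= -surjective_pairing => TD'.
apply: (tangent_gens TD TD') => h gh; rewrite pushE; last exact: smooth_gen.
case: gh => -[g gg ->].
  have sg : smooth_fun X g by exact: smooth_gen.
  have := congr1 (fun E => E g) D1; rewrite pushE // => ->.
  by rewrite -[_ \o _]/(fun _ : T' => g p.1) (tangent_cst _ TD2).
have sg : smooth_fun Y g by exact: smooth_gen.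
by rewrite pushE.
Qed.

(** In a local representation of [h] by generators, the partial derivative becomes a sum of
    derivatives of [F] times values of [D z] on generators. Those coming from [Y] are constant in
    the differentiated variable and contribute 0, so smoothness of [D] on the generators of [X] is
    all that is required. *)
Lemma smooth_partial {T T' S} (X : space R T) (Y : space R T') (Z : space R S)
    (p : S -> T) (q : S -> T') (D : S -> functional (R := R) T)
    (h : T * T' -> R) :
  smooth_map Z X p -> smooth_map Z Y q ->
  (forall z, pts Z z -> tangent X (p z) (D z)) ->
  (forall g, gens X g -> smooth_fun Z (fun z => D z g)) ->
  smooth_fun (prod_space X Y) h ->
  smooth_fun Z (fun z => D z (fun x => h (x, q z))).
Proof.
move=> sp sq TD sD sh; have [pZX _] := sp; have [qZY _] := sq.
have sl y : pts Y y -> smooth_map X (prod_space X Y) (fun x => (x, y)).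
  by move=> Yy; apply: smooth_map_pair => //; exact: smooth_map_cst.
have spq := smooth_map_pair sp sq.
apply: smooth_local => z0 Zz0.
have [n [a [F [e [ga CF e0 HF]]]]] := sh (p z0, q z0) (conj (pZX _ Zz0) (qZY _ Zz0)).
exists (fun z => \sum_i 'D_(delta_mx ord0 i) F (\row_j a j (p z, q z)) *
   D z (fun x => a i (x, q z))).
  apply: smooth_sum => i; apply: smooth_mul.
    apply: (@smooth_comp _ _ Z n (fun j z => a j (p z, q z)) ('D_(delta_mx ord0 i) F)).
      by move=> j; have [_] := spq; apply; exact: smooth_gen.
    exact: Cinfty_derive.
  case: (ga i) => -[g gg ->]; first exact: (sD g gg).
  apply: (eq_smooth _ (@smooth_cst _ _ Z 0)) => z Zz /=.
  by rewrite (tangent_cst _ (TD z Zz)).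
have := nbh_preimage spq Zz0 (nbh_near (X := prod_space X Y) _ ga e0).
apply: nbhS => z Zz /= Hz; apply: (tangent_chain (a := fun i x => a i (x, q z)) (TD z Zz)) => //.
- by have [_] := sl (q z) (qZY z Zz); apply.
- by move=> i; have [_] := sl (q z) (qZY z Zz); apply; exact: smooth_gen.
- have := nbh_preimage (x := p z) (sl (q z) (qZY z Zz)) (pZX z Zz) (near_pt_nbh ga Hz).
  by apply: nbhS => x Xx /= Hx; exact: HF.
Qed.

(** Curves are total functions on the line; near the time [t] they must stay among the points, and
    generators need only be differentiable at [t] itself. *)
Definition curve_at {T} (X : space R T) (gamma : R -> T) (t : R) : Prop :=
  (\forall s \near t, pts X (gamma s)) /\
  forall g, gens X g -> derivable (g \o gamma : R -> R) t 1.

Definition velocity {T} (X : space R T) (gamma : R -> T) (t : R) :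
    functional (R := R) T :=
  fun f => if `[< smooth_fun X f >] then 'D_1 (f \o gamma : R -> R) t else 0.

Lemma curve_derivable {T} (X : space R T) gamma t f :
  curve_at X gamma t -> smooth_fun X f -> derivable (f \o gamma : R -> R) t 1.
Proof.
move=> [Xg dg] sf; have Xt := nbhs_singleton Xg.
have [n [a [F [e [ga CF e0 HF]]]]] := sf _ Xt.
have da i : differentiable (a i \o gamma : R -> R) t.
  by apply/derivable1_diffP; exact: dg.
apply: (@near_eq_derivable R R^o R^o (fun s => F (\row_i (a i \o gamma) s))).
  have : \forall s \near t, forall i, `|a i (gamma s) - a i (gamma t)| < e.
    apply: (@filter_forall R 'I_n (fun i s => `|a i (gamma s) - a i (gamma t)| < e) (nbhs t) _) => i.
    have /cvgrPdist_lt /(_ e e0) := differentiable_continuous (da i).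
    by apply: filterS => s /=; rewrite distrC.
  by move: Xg; apply: filterS2 => s Xs Hs; rewrite /= HF.
apply/derivable1_diffP.
apply: (@differentiable_comp _ _ _ _ (fun s => \row_i (a i \o gamma) s) F).
  exact: differentiable_row.
exact: Cinfty_differentiable.
Qed.

Lemma velocity_tangent {T} (X : space R T) gamma t :
  curve_at X gamma t -> tangent X (gamma t) (velocity X gamma t).
Proof.
move=> cg; have [Xg dg] := cg; split; first exact: (nbhs_singleton Xg).
  by move=> f nsf; rewrite /velocity asboolF.
move=> n a F f sa CF fF.
have sf : smooth_fun X f.
  by apply: eq_smooth (smooth_comp sa CF) => y Xy; rewrite fF.
have da i : differentiable (a i \o gamma : R -> R) t.
  by apply/derivable1_diffP; exact: curve_derivable (sa i).
rewrite {1}/velocity asboolT //.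
rewrite (@near_eq_derive R R^o R^o _ (fun s => F (\row_i (a i \o gamma) s))).
  rewrite derive_comp_row //; last exact: Cinfty_differentiable.
  by apply: eq_bigr => i _; rewrite /velocity asboolT.
by move: Xg; apply: filterS => s Xs; rewrite /= fF.
Qed.

Lemma curve_map {T T'} (X : space R T) (Y : space R T') f gamma t :
  smooth_map X Y f -> curve_at X gamma t -> curve_at Y (f \o gamma) t.
Proof.
move=> [fXY sf] cg; have [Xg dg] := cg; split.
  by move: Xg; apply: filterS => s; exact: fXY.
move=> g gg; apply: (curve_derivable cg (f := g \o f)).
by apply: sf; exact: smooth_gen.
Qed.

End Tangents.

(** * Linear algebra and smooth coordinates with respect to frames *)

Section LinearAlgebra.
Context {R : realType}.
Implicit Types (V W : vectType R).

Lemma linfunE V W (f : V -> W) : linear f -> linfun f =1 f.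
Proof.
move=> hf; pose fM := GRing.isLinear.Build _ _ _ _ _ hf.
pose fL : {linear V -> W} := HB.pack f fM.
exact: (lfunE fL).
Qed.

Lemma linear_fun0 (V W : lmodType R) (f : V -> W) : linear f -> f 0 = 0.
Proof.
move=> hf; have := hf (-1) 0 0.
by rewrite scaler0 addr0 scaleN1r addNr.
Qed.

Lemma linear_funD (V W : lmodType R) (f : V -> W) u v : linear f ->
  f (u + v) = f u + f v.
Proof. by move=> hf; have := hf 1 u v; rewrite !scale1r. Qed.

Lemma linear_funZ (V W : lmodType R) (f : V -> W) c u : linear f ->
  f (c *: u) = c *: f u.
Proof. by move=> hf; have := hf c u 0; rewrite (linear_fun0 hf) !addr0. Qed.

Lemma linear_funB (V W : lmodType R) (f : V -> W) u v : linear f ->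
  f (u - v) = f u - f v.
Proof.
by move=> hf; rewrite -scaleN1r addrC hf scaleN1r addrC.
Qed.

Lemma linear_fun_sum (V W : lmodType R) (f : V -> W) (I : Type) (r : seq I)
    (P : pred I) (F : I -> V) : linear f ->
  f (\sum_(i <- r | P i) F i) = \sum_(i <- r | P i) f (F i).
Proof.
move=> hf; elim/big_rec2: _ => [|i y x _ <-]; first exact: linear_fun0.
exact: linear_funD.
Qed.

Lemma linear_comp (U V W : lmodType R) (f : V -> W) (g : U -> V) :
  linear f -> linear g -> linear (f \o g).
Proof. by move=> hf hg c u v /=; rewrite hg hf. Qed.

Lemma linear_inj (V W : lmodType R) (f : V -> W) : linear f ->
  (forall v, f v = 0 -> v = 0) -> injective f.
Proof.
move=> hf h u v uv; apply: subr0_eq; apply: h.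
by rewrite linear_funB // uv subrr.
Qed.

Lemma linear_cancel (V W : lmodType R) (f : V -> W) (g : W -> V) :
  linear f -> cancel f g -> cancel g f -> linear g.
Proof.
move=> hf fg gf c u v; apply: (can_inj fg).
by rewrite hf !gf.
Qed.

Lemma linear_inj_bij V (f : V -> V) : linear f -> injective f -> bijective f.
Proof.
move=> hf fi; have fE := linfunE hf.
have k0 : lker (linfun f) == 0%VS.
  by apply/lker0P => u v; rewrite !fE; exact: fi.
exists (linfun f)^-1%VF => x.
  by have := lker0_lfunK k0 x; rewrite fE.
by have := lker0_lfunVK k0 x; rewrite fE.
Qed.

Definition subspace V (S : V -> Prop) : Prop :=
  S 0 /\ forall (c : R) u v, S u -> S v -> S (c *: u + v).

(** A subspace of maximal dimension inside [S] exhausts [S], as a further vector of [S] would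
    enlarge it. *)
Lemma subspaceP V (S : V -> Prop) : subspace S ->
  exists U : {vspace V}, forall v, S v <-> v \in U.
Proof.
move=> [S0 Sl].
pose P d := `[< exists U : {vspace V}, (forall v, v \in U -> S v) /\ \dim U = d >].
have exP : exists d, P d.
  exists 0%N; apply/asboolP; exists 0%VS; split; last exact: dimv0.
  by move=> v; rewrite memv0 => /eqP ->.
have leP d : P d -> (d <= \dim {: V})%N.
  by move=> /asboolP[U [_ <-]]; apply: dimvS; exact: subvf.
case: (ex_maxnP exP leP) => d /asboolP[U [US dU]] dmax.
exists U => v; split; last exact: US.
move=> Sv; apply/negPn/negP => vU.
have : P (\dim (U + <[v]>)).
  apply/asboolP; exists (U + <[v]>)%VS; split=> //.
  move=> w /memv_addP[u uU [x /vlineP[c ->] ->]].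
  by rewrite addrC; apply: Sl => //; exact: US.
move=> /dmax; rewrite leqNgt => /negP; apply.
rewrite -dU ltn_neqAle dimvS ?addvSl // andbT.
apply/negP => /eqP eqd.
have /eqP UE : U == (U + <[v]>)%VS by rewrite -dimv_leqif_eq ?addvSl // eqd.
by move/negP: vU; apply; rewrite UE (subvP (addvSr U _)) // memv_line.
Qed.

(** An injective endomorphism that maps a finite-dimensional subspace into itself maps it onto
    itself. *)
Lemma subspace_reflect V (S : V -> Prop) (m : V -> V) : subspace S ->
  linear m -> injective m -> (forall v, S v -> S (m v)) ->
  forall v, S (m v) -> S v.
Proof.
move=> sS hm mi mS v Smv; have [U HU] := subspaceP sS.
have mE := linfunE hm.
have k0 : lker (linfun m) == 0%VS.
  by apply/lker0P => x y; rewrite !mE; exact: mi.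
have sUU : (linfun m @: U <= U)%VS.
  apply/subvP => w /memv_imgP[u uU ->]; rewrite mE.
  by apply/HU/mS/HU.
have dU : \dim (linfun m @: U) = \dim U.
  by apply: limg_dim_eq; apply/eqP; rewrite (eqP k0) capv0.
have /eqP UE : (linfun m @: U)%VS == U by rewrite -dimv_leqif_eq // dU.
have : m v \in (linfun m @: U)%VS by rewrite UE; apply/HU.
move=> /memv_imgP[u uU]; rewrite mE => /mi ->.
exact/HU.
Qed.

Lemma subspace_projection V (S : V -> Prop) : subspace S ->
  exists P : 'End(V), (forall v, S (v - P v)) /\ (forall v, S v -> P v = 0).
Proof.
move=> sS; have [U HU] := subspaceP sS; pose W := (U^C)%VS.
have UW : (W :&: U)%VS = 0%VS by rewrite capvC; exact: capv_compl.
have WU : (U :&: W)%VS = 0%VS by exact: capv_compl.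
have addE v : daddv_pi W U v + daddv_pi U W v = v.
  by apply: daddv_pi_add => //; rewrite addvC addv_complf memvf.
exists (daddv_pi W U); split=> v.
  rewrite -{1}(addE v) addrC addKr; apply/HU; exact: memv_pi.
move=> /HU vU; have := addE v; rewrite (daddv_pi_id WU vU) => /eqP.
by rewrite -subr_eq0 addrK => /eqP.
Qed.

Definition vb V (i : 'I_(\dim {: V})) : V := (vbasis {: V})`_i.
Definition vc V (i : 'I_(\dim {: V})) (v : V) : R := coord (vbasis {: V}) i v.

Lemma vcE V (v : V) : v = \sum_i vc i v *: vb i.
Proof. by apply: coord_vbasis; exact: memvf. Qed.

Lemma vc_linear V (i : 'I_(\dim {: V})) :
  linear (vc i : V -> R^o).
Proof. by move=> c u v; rewrite /vc linearP. Qed.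

Lemma vc_vb V (i j : 'I_(\dim {: V})) : vc i (vb j) = (i == j)%:R.
Proof.
by rewrite /vc /vb (coord_free j i (basis_free (vbasisP _))) eq_sym.
Qed.

Definition vsmooth {T} (X : space R T) V (f : T -> V) : Prop :=
  forall l : V -> R^o, linear l -> smooth_fun X (fun x => l (f x)).

Lemma vsmooth_coord {T} (X : space R T) V (f : T -> V) :
  (forall i, smooth_fun X (fun x => vc i (f x))) -> vsmooth X f.
Proof.
move=> sf l hl.
apply: (@eq_smooth _ _ X (fun x => \sum_i vc i (f x) * l (vb i))).
  move=> x _; rewrite {2}(vcE (f x)) linear_fun_sum //.
  by apply: eq_bigr => i _; rewrite linear_funZ.
by apply: smooth_sum => i; apply: smooth_mul => //; exact: smooth_cst.
Qed.

Lemma vsmooth_linear {T} (X : space R T) V W (g : V -> W) (f : T -> V) :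
  linear g -> vsmooth X f -> vsmooth X (fun x => g (f x)).
Proof. by move=> hg sf l hl; apply: (sf (l \o g)); exact: linear_comp. Qed.

Lemma vsmooth_eq {T} (X : space R T) V (f g : T -> V) :
  (forall x, pts X x -> f x = g x) -> vsmooth X f -> vsmooth X g.
Proof.
by move=> fg sf l hl; apply: eq_smooth (sf l hl) => x Xx /=; rewrite fg.
Qed.

Lemma vsmooth_cst {T} (X : space R T) V (v : V) : vsmooth X (fun _ => v).
Proof. by move=> l hl; exact: smooth_cst. Qed.

Lemma vsmooth_comp {T S} (X : space R T) (Y : space R S) V (f : T -> V)
    (p : S -> T) : smooth_map Y X p -> vsmooth X f ->
  vsmooth Y (fun y => f (p y)).
Proof. by move=> [_ sp] sf l hl; apply: (sp (fun x => l (f x))); exact: sf. Qed.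

(* The evaluations [A |-> l (A e)] span the dual of ['Hom(V, W)]. *)
Lemma vsmooth_hom {T} (X : space R T) V W (a : T -> 'Hom(V, W)) :
  (forall e, vsmooth X (fun x => a x e)) -> vsmooth X a.
Proof.
move=> sa l hl.
pose E i j : 'Hom(V, W) := linfun (fun v : V => vc j v *: (vb i : W)).
have hE i j : linear (fun v : V => vc j v *: (vb i : W)).
  move=> c u v; rewrite [vc _ _]vc_linear scalerDl.
  by rewrite -[c *: (_ : R^o)]/(c * _) scalerA.
have aE x : a x = \sum_j \sum_i vc i (a x (vb j)) *: E i j.
  apply/lfunP => v; rewrite sum_lfunE {1}(vcE v) linear_sum.
  apply: eq_bigr => j _; rewrite linearZ /= [in LHS](vcE (a x (vb j))).
  rewrite scaler_sumr sum_lfunE; apply: eq_bigr => i _.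
  by rewrite scale_lfunE linfunE // !scalerA mulrC.
apply: (@eq_smooth _ _ X (fun x => \sum_j \sum_i vc i (a x (vb j)) * l (E i j))).
  move=> x _; rewrite [in RHS]aE linear_fun_sum //; apply: eq_bigr => j _.
  rewrite linear_fun_sum //; apply: eq_bigr => i _.
  by rewrite linear_funZ.
apply: smooth_sum => j; apply: smooth_sum => i; apply: smooth_mul.
  exact: (sa _ _ (@vc_linear _ i)).
exact: smooth_cst.
Qed.

(** The value vectors [(zeta (vb i) f)], for [f] smooth, form a subspace [S] of the row vectors. A
    linear functional [l] vanishing on [S] yields a combination of the [vb i] whose image under
    [zeta] kills all smooth functions, so [l = 0] by injectivity. Applied to the coordinates of a
    projection with kernel [S], this shows that [S] is everything. *)
Lemma dual_functions {T} (X : space R T) x V (zeta : V -> functional T) :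
  linear_iso X x zeta ->
  exists f : 'I_(\dim {: V}) -> T -> R, (forall j, smooth_fun X (f j)) /\
    forall i j, zeta (vb i) (f j) = (i == j)%:R.
Proof.
move=> [hz zi zr]; pose d := \dim {: V}.
have Tz v : tangent X x (zeta v) by rewrite -zr; exists v.
pose S (r : 'rV[R]_d) := exists2 f, smooth_fun X f &
  forall i, r ord0 i = zeta (vb i) f.
have sS : subspace S.
  split.
    exists (fun _ => 0); first exact: smooth_cst.
    by move=> i; rewrite mxE (tangent_cst _ (Tz _)).
  move=> c u v [f sf uf] [g sg vg]; exists (fun y => c * f y + g y).
    by apply: smooth_add => //; apply: smooth_mul => //; exact: smooth_cst.
  move=> i; rewrite !mxE uf vg (tangent_add (Tz _)) //; last first.
    by apply: smooth_mul => //; exact: smooth_cst.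
  by rewrite (tangent_scale _ (Tz _)).
have [P [P1 P2]] := subspace_projection sS.
have P0 w : P w = 0.
  apply/rowP => j; rewrite mxE.
  pose l (v : 'rV[R]_d) : R^o := (P v) ord0 j.
  have hl : linear l by move=> c u v; rewrite /l linearP !mxE.
  suff l0 : \sum_i l (delta_mx ord0 i) *: vb i = 0 :> V.
    have : l w = 0; last by [].
    rewrite (row_sum_delta w) linear_fun_sum //; apply: big1 => i _.
    rewrite linear_funZ //.
    have -> : l (delta_mx ord0 i) = vc i (\sum_i l (delta_mx ord0 i) *: vb i).
      rewrite linear_fun_sum; last exact: vc_linear.
      rewrite (bigD1 i) //= big1 ?addr0 => [|k ki].
        by rewrite linear_funZ; [rewrite vc_vb eqxx scaler1|exact: vc_linear].
      rewrite linear_funZ; last exact: vc_linear.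
      by rewrite vc_vb eq_sym (negPf ki) scaler0.
    rewrite l0 (linear_fun0 (@vc_linear _ i)); exact: scaler0.
  apply: zi; rewrite (linear_fun0 hz); apply/funext => f.
  have [sf|nsf] := pselect (smooth_fun X f); last first.
    by have [_ D0 _] := Tz (\sum_i l (delta_mx ord0 i) *: vb i); rewrite D0.
  have : l (\row_i zeta (vb i) f) = 0.
    rewrite /l P2 ?mxE //; exists f => // i; exact: mxE.
  rewrite (row_sum_delta (\row_i _)) linear_fun_sum // => l0.
  rewrite linear_fun_sum // -[RHS]l0.
  have -> : (\sum_i zeta (l (delta_mx ord0 i) *: vb i)) f =
     \sum_i (zeta (l (delta_mx ord0 i) *: vb i)) f :> R^o.
    by elim/big_rec2: _ => // i y1 y2 _ <-.
  apply: eq_bigr => i _; rewrite !linear_funZ // mxE.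
  by rewrite -[LHS]/(_ * _) -[RHS]/(_ * _) mulrC.
have allS w : S w by have := P1 w; rewrite P0 subr0.
have /choice[f Hf] : forall j, exists f, smooth_fun X f /\
   forall i, (delta_mx ord0 j : 'rV[R]_d) ord0 i = zeta (vb i) f.
  by move=> j; have [f sf Hf] := allS (delta_mx ord0 j); exists f.
exists f; split=> [j|i j]; first by have [] := Hf j.
by have [_ <-] := Hf j; rewrite mxE eqxx.
Qed.

(** Cramer's rule: paired with functions dual to the frame at [z0], the frame at [z] gives a matrix
    [M z] that is the identity at [z0] and hence invertible nearby. The coordinates of [v z] are the
    values [D z (f j)] times the inverse of [M z]. *)
Lemma frame_coordinates {T S} (X : space R T) (Y : space R S) V (p : S -> T)
    (tau : S -> V -> functional T) (D : S -> functional T) (v : S -> V) :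
  (forall z, pts Y z -> linear_iso X (p z) (tau z)) ->
  (forall e f, smooth_fun X f -> smooth_fun Y (fun z => tau z e f)) ->
  (forall f, smooth_fun X f -> smooth_fun Y (fun z => D z f)) ->
  (forall z, pts Y z -> tau z (v z) = D z) ->
  vsmooth Y v.
Proof.
move=> tau_iso stau sD tauv; apply: vsmooth_coord => i.
apply: smooth_local => z0 Yz0.
have [f [sf fE]] := dual_functions (tau_iso z0 Yz0).
pose M z : 'M[R]_(\dim {: V}) := \matrix_(k, j) tau z (vb k) (f j).
have sM k j : smooth_fun Y (fun z => M z k j).
  by apply: eq_smooth (stau (vb k) _ (sf j)) => z _; rewrite mxE.
have sdet := smooth_det sM.
have M0 : M z0 = 1%:M by apply/matrixP => k j; rewrite !mxE fE.
have [g sg gdet] : exists2 g, smooth_fun Y g &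
    nbh Y z0 [set z | g z = (\det (M z))^-1].
  by apply: smooth_inv_local => //; rewrite M0 det1 oner_eq0.
have ndet : nbh Y z0 [set z | \det (M z) != 0].
  have := smooth_continuous sdet Yz0 ltr01; apply: nbhS => z _ /=.
  by apply: contraTneq => ->; rewrite M0 det1 sub0r normrN normr1 ltxx.
exists (fun z => \sum_j D z (f j) * (g z * (\adj (M z)) j i)).
  apply: smooth_sum => j; apply: smooth_mul; first exact: sD.
  apply: (smooth_mul sg).
  have : smooth_fun Y (fun z => cofactor (M z) i j).
    rewrite /cofactor; apply: smooth_mul; first exact: smooth_cst.
    apply: smooth_det => k l.
    by apply: eq_smooth (sM (lift i k) (lift j l)) => z _; rewrite !mxE.
  by apply: eq_smooth => z _; rewrite !mxE.
have := nbhI gdet ndet; apply: nbhS => z Yz [/= -> dz].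
pose r : 'rV[R]_(\dim {: V}) := \row_k vc k (v z).
have rM : r *m M z = \row_j D z (f j).
  apply/rowP => j; rewrite !mxE -(tauv z Yz) [in RHS](vcE (v z)).
  have [ht _ _] := tau_iso z Yz.
  rewrite linear_fun_sum //.
  have -> : (\sum_k tau z (vc k (v z) *: vb k)) (f j) =
     \sum_k (tau z (vc k (v z) *: vb k)) (f j) :> R^o.
    by elim/big_rec2: _ => // k y1 y2 _ <-.
  by apply: eq_bigr => k _; rewrite linear_funZ // !mxE.
have uM : M z \in unitmx by rewrite unitmxE unitfE.
have -> : vc i (v z) = r ord0 i by rewrite mxE.
rewrite -[r](mulmxK uM) rM !mxE.
by apply: eq_bigr => j _; rewrite /invmx uM !mxE.
Qed.

End LinearAlgebra.

(** * The graded model *)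

Section ModelSpaces.
Context {R : realType} {tau : struct_type R}.
Local Notation E := (Espace tau).
Local Notation depth := (ndepth (gneg tau)).

Lemma Esplit n (v : E n.+1) : v = (v.1, 0) + (0, v.2).
Proof. by case: v => a b; congr pair; rewrite ?addr0 ?add0r. Qed.

Lemma fst_linear n : linear (fst : E n.+1 -> E n).
Proof. by []. Qed.

Lemma inl_linear n : linear ((fun e => (e, 0)) : E n -> E n.+1).
Proof. by move=> c u v; congr pair; rewrite /= scaler0 addr0. Qed.

Lemma Efilt_subspace n (p : int) : subspace (Efilt (tau := tau) (n := n) p).
Proof.
elim: n => [|n [IH0 IH]]; first by split=> [|c u v /= hu hv];
  [exact: mem0v|exact: memvD (memvZ c hu) hv].
split=> [|c u v [u1 u2] [v1 v2]]; first by split=> //=; right.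
split; first exact: IH.
by case: u2 => [?|u2]; [left|case: v2 => [?|v2]; [left|right]];
  rewrite //= u2 v2 scaler0 addr0.
Qed.

Lemma Efilt0 n p : Efilt p (0 : E n).
Proof. by have [] := Efilt_subspace n p. Qed.

Lemma EfiltD n p (u v : E n) : Efilt p u -> Efilt p v -> Efilt p (u + v).
Proof. by have [_ h] := Efilt_subspace n p => hu /(h 1 _ _ hu); rewrite scale1r. Qed.

Lemma EfiltZ n p c (u : E n) : Efilt p u -> Efilt p (c *: u).
Proof.
have [h0 h] := Efilt_subspace n p => hu.
by have := h c _ _ hu h0; rewrite addr0.
Qed.

Lemma EfiltN n p (u : E n) : Efilt p u -> Efilt p (- u).
Proof. by rewrite -scaleN1r; exact: EfiltZ. Qed.

Lemma Efilt_dec n (p q : int) (e : E n) : q <= p -> Efilt p e -> Efilt q e.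
Proof.
move=> qp; elim: n e => [|n IH] e /=.
  move: e; apply/subvP; apply/subv_sumP => i pi.
  by apply: (sumv_sup i) => //; exact: le_trans qp pi.
by move=> [/IH h1 h2]; split=> //; case: h2 => [h|]; [left; lia|right].
Qed.

Lemma Efilt_top n (p : int) (e : E n) : n%:Z <= p -> Efilt p e -> e = 0.
Proof.
elim: n e => [|n IH] e /= np.
  rewrite big1 ?memv0 => [/eqP //|i]; lia.
case: e => e b [/IH /= -> //]; last by lia.
by case=> [|-> //]; lia.
Qed.

Lemma Efilt_full n (p : int) (e : E n) : p <= - depth%:Z -> Efilt p e.
Proof.
move=> pd; elim: n e => [|n IH] e /=.
  rewrite (eq_bigl xpredT) ?ncomp_full ?memvf // => i.
  by have := ltn_ord i; lia.
by split=> //; left; lia.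
Qed.

Lemma Efilt_ncomp (p : int) (a : E 0) : a \in ncomp (gneg tau) p -> Efilt p a.
Proof.
have [p0|p0] := boolP ((0 <= p) || (p < - depth%:Z)).
  by rewrite (ncomp_out p0) memv0 => /eqP ->; exact: Efilt0.
move=> ap /=; move: ap.
have ip : (`|p|.-1 < depth)%N by lia.
have {1}-> : p = - (Ordinal ip).+1%:Z by rewrite /=; lia.
move: a; apply/subvP; apply: (sumv_sup (Ordinal ip)) => //=; lia.
Qed.

Definition raises n (p : int) (a : E n -> E n) : Prop :=
  forall q e, Efilt q e -> Efilt (p + q) (a e).

(** A vector [e] of the kernel equals [- (u e - e)], so its degree can be raised again and again;
    after [depth + n] steps from the bottom it exceeds all degrees of [E n]. *)
Lemma unipotent_inj n (p : int) (u : E n -> E n) : 1 <= p -> linear u ->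
  raises p (fun e => u e - e) -> injective u.
Proof.
move=> p1 hu ru; apply: linear_inj => // e ue0.
suff H (k : nat) : Efilt (- depth%:Z + k%:Z) e.
  by apply: (Efilt_top (p := - depth%:Z + (depth + n)%N%:Z)) => //; lia.
elim: k => [|k IH]; first by apply: Efilt_full; lia.
have := ru _ _ IH; rewrite ue0 sub0r => /EfiltN; rewrite opprK.
by apply: Efilt_dec; lia.
Qed.

Lemma unipotent_FGL n (p : int) (u : E n -> E n) : 1 <= p -> linear u ->
  raises p (fun e => u e - e) -> FGL p u.
Proof.
move=> p1 hu ru; split=> //; split=> //; apply: linear_inj_bij => //.
exact: unipotent_inj ru.
Qed.

Lemma FGL_linear n (p : int) (a : E n -> E n) : FGL p a -> linear a.
Proof. by case=> -[]. Qed.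

Lemma FGL_bij n (p : int) (a : E n -> E n) : FGL p a -> bijective a.
Proof. by case=> -[]. Qed.

Lemma FGL_mono n (p q : int) (a : E n -> E n) : q <= p -> FGL p a -> FGL q a.
Proof.
move=> qp [la ra]; split=> // r e /ra; apply: Efilt_dec; lia.
Qed.

Lemma FGL_filt n (p q : int) (a : E n -> E n) e : 0 <= p -> FGL p a ->
  Efilt q e -> Efilt q (a e).
Proof.
move=> p0 [la ra] he; rewrite -(subrK e (a e)); apply: EfiltD => //.
by apply: Efilt_dec (ra _ _ he); lia.
Qed.

Lemma FGL_id n (p : int) : FGL p (id : E n -> E n).
Proof.
split; first by split=> //; exists id.
by move=> q e _; rewrite subrr; exact: Efilt0.
Qed.

Lemma FGL_comp n (p : int) (a b : E n -> E n) : 0 <= p -> FGL p a -> FGL p b ->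
  FGL p (a \o b).
Proof.
move=> p0 ha hb; have [[la ba] ra] := ha; have [[lb bb] rb] := hb.
split; first by split; [exact: linear_comp|exact: bij_comp].
move=> q e he /=; rewrite -(subrKA (b e)); apply: EfiltD; last exact: rb.
by apply: ra; exact: FGL_filt hb he.
Qed.

Lemma filt_reflect n (a : E n -> E n) : linear a -> injective a ->
  (forall q e, Efilt q e -> Efilt q (a e)) ->
  forall q e, Efilt q (a e) -> Efilt q e.
Proof. by move=> la ia fa q; exact: (subspace_reflect (Efilt_subspace n q) la ia (fa q)). Qed.

Lemma FGL_inv n (p : int) (a b : E n -> E n) : 0 <= p -> FGL p a ->
  cancel a b -> cancel b a -> FGL p b.
Proof.
move=> p0 ha ab ba; have [[la bja] ra] := ha.
have lb : linear b by exact: (linear_cancel la).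
split; first by split=> //; exists a.
move=> q e he; have hbe : Efilt q (b e).
  apply: (filt_reflect la (can_inj ab)); last by rewrite ba.
  by move=> r f; exact: (FGL_filt p0 ha).
by have := ra _ _ hbe; rewrite ba => /EfiltN; rewrite opprB.
Qed.

Lemma unit_cls_id n : unit_cls (id : E n -> E n).
Proof. exact: FGL_id. Qed.

Lemma cls_self n (B : Type) (f : E n -> B) : cls f f.
Proof. by exists id => //; exact: unit_cls_id. Qed.

Lemma cls_comp n (B : Type) (f : E n -> B) u : unit_cls u ->
  cls (f \o u) = cls f.
Proof.
move=> hu; apply/seteqP; split=> h [a ha ->].
  by exists (u \o a) => //; exact: FGL_comp.
have [v uv vu] := FGL_bij hu.
exists (v \o a); first by apply: FGL_comp => //; exact: FGL_inv hu uv vu.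
by apply/funext => e /=; rewrite vu.
Qed.

Lemma cls_mem n (B : Type) (f g : E n -> B) : cls f g -> cls g = cls f.
Proof. by move=> [a ha ->]; exact: cls_comp. Qed.

Lemma comp_set_cls n (B : Type) (f : E n -> B) :
  comp_set (cls f) (unit_cls (n := n)) = cls f.
Proof.
apply/seteqP; split=> h.
  by move=> [_ [a ha ->] [b hb ->]]; exists (a \o b) => //; exact: FGL_comp.
by move=> [a ha ->]; exists f; [exact: cls_self|exists a].
Qed.

Lemma comp_setA (A B C D : Type) (S1 : set (C -> D)) (S2 : set (B -> C))
    (S3 : set (A -> B)) :
  comp_set (comp_set S1 S2) S3 = comp_set S1 (comp_set S2 S3).
Proof.
apply/seteqP; split=> h.
  move=> [_ [a ha [b hb ->]] [c hc ->]].
  by exists a => //; exists (b \o c) => //; exists b => //; exists c.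
move=> [a ha [_ [b hb [c hc ->]] ->]].
by exists (a \o b); [exists a => //; exists b|exists c].
Qed.

(* The map induced on [E n = E n.+1 / g_n]. *)
Definition ebar n (a : E n.+1 -> E n.+1) : E n -> E n := fun e => (a (e, 0)).1.

Lemma ebar_linear n (a : E n.+1 -> E n.+1) : linear a -> linear (ebar a).
Proof.
by move=> la; apply: linear_comp (@fst_linear n) _; apply: linear_comp la _;
  exact: inl_linear.
Qed.

Lemma FGL_ebar n (p : int) (a : E n.+1 -> E n.+1) : 1 <= p -> FGL p a ->
  FGL p (ebar a).
Proof.
move=> p1 [[la ba] ra]; apply: unipotent_FGL => //; first exact: ebar_linear.
move=> q e he; have [qn|nq] := lerP q n%:Z; last first.
  have -> : e = 0 by apply: Efilt_top he; lia.
  by rewrite (linear_fun0 (ebar_linear la)) subrr; exact: Efilt0.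
have : Efilt q ((e, 0) : E n.+1) by split=> //; left.
by move=> /ra[].
Qed.

(** The summand [gpos tau n] sits in degree [n], the highest of [E n.+1], so whatever raises degrees
    kills it. *)
Lemma FGL_vert n (p : int) (a : E n.+1 -> E n.+1) (b : gpos tau n) : 1 <= p ->
  FGL p a -> a (0, b) = (0, b).
Proof.
move=> p1 [la ra]; apply: subr0_eq.
apply: (Efilt_top (p := p + n%:Z)); first lia.
by apply: ra; split; [exact: Efilt0|left].
Qed.

(* The elements of the structure group of the universal linear frame bundle
   over [E n.+1]. *)
Definition Hgrp n (a : E n.+1 -> E n.+1) : Prop :=
  [/\ linear a, forall b, a (0, b) = (0, b) & unit_cls (ebar a)].

Lemma Hgrp_fst n (a : E n.+1 -> E n.+1) e : Hgrp a -> (a e).1 = ebar a e.1.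
Proof.
move=> [la va _]; rewrite {1}(Esplit e) linear_funD // va /ebar.
by case: (a _) => x y /=; rewrite addr0.
Qed.

Lemma Hgrp_filt n (a : E n.+1 -> E n.+1) q e : Hgrp a ->
  Efilt q e -> Efilt q (a e).
Proof.
move=> Ha [e1 e2]; split.
  by rewrite (Hgrp_fst _ Ha); have [_ _ ua] := Ha; exact: FGL_filt ua e1.
case: e2 => [|e2]; first by left.
have [|nq] := lerP q n%:Z; [by left|right].
have e10 : e.1 = 0 by apply: Efilt_top e1; lia.
have -> : e = 0 by case: e e10 e2 {e1} => x y /= -> ->.
by have [la _ _] := Ha; rewrite linear_fun0.
Qed.

Lemma Hgrp_inj n (a : E n.+1 -> E n.+1) : Hgrp a -> injective a.
Proof.
move=> Ha; have [la va ua] := Ha; apply: linear_inj => // e ae0.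
have e10 : e.1 = 0.
  have := Hgrp_fst e Ha; rewrite ae0 => /esym.
  move=> h0; apply: (bij_inj (FGL_bij ua)).
  by rewrite (linear_fun0 (FGL_linear ua)); exact: h0.
move: ae0; rewrite (Esplit e) e10.
by case: e {e10} => x y; rewrite -[(0, 0)]/(0 : E n.+1) add0r va.
Qed.

Lemma Hgrp_bij n (a : E n.+1 -> E n.+1) : Hgrp a -> bijective a.
Proof.
move=> Ha; apply: linear_inj_bij; last exact: Hgrp_inj.
by case: Ha.
Qed.

Lemma Hgrp_inv n (a b : E n.+1 -> E n.+1) : Hgrp a -> cancel a b ->
  cancel b a -> Hgrp b.
Proof.
move=> Ha ab ba; have [la va ua] := Ha.
have lb : linear b by exact: (linear_cancel la).
split=> // [v|]; first by rewrite -{1}(va v) ab.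
have [c ac ca] := FGL_bij ua.
suff -> : ebar b = c by exact: FGL_inv ac ca.
apply/funext => e; apply: (can_inj ac); rewrite ca.
by rewrite {2}/ebar -(Hgrp_fst _ Ha) ba.
Qed.

Lemma Hgrp_comp n (a b : E n.+1 -> E n.+1) : Hgrp a -> Hgrp b -> Hgrp (a \o b).
Proof.
move=> Ha Hb; have [la va ua] := Ha; have [lb vb ub] := Hb.
split; [exact: linear_comp|by move=> v /=; rewrite vb|].
suff -> : ebar (a \o b) = ebar a \o ebar b by exact: FGL_comp.
by apply/funext => e; rewrite {1}/ebar /= (Hgrp_fst _ Ha).
Qed.

(** All conditions are affine except invertibility, which is automatic: on [E n] the combination is
    the identity plus a map raising degrees. This provides the straight lines in the fibres. *)
Lemma Hgrp_affine n (a b : E n.+1 -> E n.+1) (t : R) : Hgrp a -> Hgrp b ->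
  Hgrp (fun e => (1 - t) *: a e + t *: b e).
Proof.
move=> [la va ua] [lb vb ub].
have lc : linear (fun e => (1 - t) *: a e + t *: b e).
  move=> c u v; rewrite la lb !scalerDr !scalerA ![_ * c]mulrC -!scalerA.
  by rewrite addrACA.
split=> // [v|].
  by rewrite va vb -scalerDl subrK scale1r.
apply: unipotent_FGL => //; first exact: ebar_linear.
move=> q e he; have [_ ra] := ua; have [_ rb] := ub.
have -> : ebar (fun e => (1 - t) *: a e + t *: b e) e - e =
    (1 - t) *: (ebar a e - e) + t *: (ebar b e - e).
  rewrite !scalerBr addrACA -opprD -scalerDl subrK scale1r.
  by rewrite /ebar.
by apply: EfiltD; apply: EfiltZ; [exact: ra|exact: rb].
Qed.

Lemma unit_cls_Hgrp n (a : E n.+1 -> E n.+1) : unit_cls a -> Hgrp a.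
Proof.
move=> ua; split; first exact: FGL_linear ua.
  by move=> b; exact: FGL_vert ua.
by apply: (FGL_mono _ (FGL_ebar _ ua)) => //; lia.
Qed.

End ModelSpaces.

(** * Frames and local triviality *)

Section Frames.
Context {R : realType} {tau : struct_type R} (Q : tower tau).
Local Notation E := (Espace tau).
Local Notation A n := (Amb tau (base Q) n).
Local Notation U n := (functional (R := R) (A n)).

(** The consequences of the geometric hypotheses that pointwise arguments with frames use. They make
    no distinction between the levels below and above [k]. *)
Definition regular : Prop :=
  [/\ forall n, smooth_map (lev Q n.+1) (lev Q n) (@descend R tau Q n),
      forall n, smooth_map (lev Q n.+1) (univ_frame Q n) id &
      forall n, linear_iso (grp tau n) (unit_cls (n := n)) (@liealg R tau n)].

Hypothesis reg : regular.

Lemma linear_iso_comp (E0 : lmodType R) T (X : space R T) x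
    (zeta : E0 -> functional T) (a : E0 -> E0) :
  linear_iso X x zeta -> linear a -> bijective a ->
  linear_iso X x (zeta \o a).
Proof.
move=> [lz iz rz] la [b ab ba]; split.
- exact: linear_comp.
- by apply: inj_comp => //; exact: can_inj ab.
- rewrite -rz; apply/seteqP; split=> D [e _ <-]; first by exists (a e).
  by exists (b e) => //=; rewrite ba.
Qed.

Lemma linear_iso_tangent (E0 : lmodType R) T (X : space R T) x
    (zeta : E0 -> functional T) e :
  linear_iso X x zeta -> tangent X x (zeta e).
Proof. by move=> [_ _ <-]; exists e. Qed.

Lemma linear_iso_onto (E0 : lmodType R) T (X : space R T) x
    (zeta : E0 -> functional T) D :
  linear_iso X x zeta -> tangent X x D -> exists e, zeta e = D.
Proof. by move=> [_ _ <-] [e _ <-]; exists e. Qed.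

Lemma hatS_filtered n (z : A n) zeta : hatS_fibre z zeta -> filtered_iso z zeta.
Proof. by case: n z zeta => [|n] z zeta; case. Qed.

Lemma hatS_iso n (z : A n) zeta : hatS_fibre z zeta -> linear_iso (lev Q n) z zeta.
Proof. by move=> /hatS_filtered[]. Qed.

Lemma hatS_tangent n (z : A n) zeta e : hatS_fibre z zeta ->
  tangent (lev Q n) z (zeta e).
Proof. by move=> /hatS_iso hz; exact: linear_iso_tangent. Qed.

Definition fbar n (zeta : E n.+1 -> U n.+1) : E n -> U n :=
  fun e => push (lev Q n) (@descend R tau Q n) (zeta (e, 0)).

Lemma hatS_fbar n (z : A n.+1) zeta : hatS_fibre z zeta ->
  hatS_fibre z.1 (fbar zeta) /\ cls (fbar zeta) = z.2.
Proof. by case. Qed.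

Lemma liealg_tangent n (b : gpos tau n) :
  tangent (grp tau n) (unit_cls (n := n)) (@liealg R tau n b).
Proof. by have [_ _ h] := reg; exact: (linear_iso_tangent b (h n)). Qed.

Lemma descend_act n (z : A n.+1) c D :
  tangent (grp tau n) c D ->
  push (lev Q n) (@descend R tau Q n) (push (lev Q n.+1) (@act R tau Q n z) D) = 0.
Proof.
move=> TD; have [sd _ _] := reg; rewrite push_comp //.
exact: (push_cst _ z.1 TD).
Qed.

Lemma descend_frame n (z : A n.+1) zeta e : hatS_fibre z zeta ->
  push (lev Q n) (@descend R tau Q n) (zeta e) = fbar zeta e.1.
Proof.
move=> hz; have [lz _ _] := hatS_iso hz; have [_ fz _ _] := hz.
rewrite {1}(Esplit e) linear_funD // linear_funD; last exact: push_linear.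
by rewrite fz (descend_act _ (liealg_tangent _)) addr0.
Qed.

Lemma lev_point n (z : A n.+1) : pts (lev Q n.+1) z ->
  pts (lev Q n) z.1 /\ exists2 zeta, hatS_fibre z.1 zeta & z.2 = cls zeta.
Proof.
move=> Pz; have [_ su _] := reg; have [/(_ z Pz)] := su n.
by move=> -[[w zeta] /= [Pw hz] <-] _ /=; split=> //; exists zeta.
Qed.

Lemma filt_decr_nat (x : A 0) (p q : int) v : pts (lev Q 0) x -> p <= q ->
  bfilt Q q x v -> bfilt Q p x v.
Proof.
move=> Px pq; have [k ->] : exists k : nat, q = p + k%:Z by exists `|q - p|%N; lia.
elim: k => [|k IH]; first by rewrite addr0.
rewrite -addn1 PoszD addrA => /(filt_decr Px); exact: IH.
Qed.

Lemma filt_lin (x : A 0) (p : int) c v w : pts (lev Q 0) x ->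
  bfilt Q p x v -> bfilt Q p x w -> bfilt Q p x (c *: v + w).
Proof. by move=> Px; have [_ _ h _] := filt_subbundle (bfilt Q) p Px; exact: h. Qed.

Lemma filtD (x : A 0) (p : int) v w : pts (lev Q 0) x ->
  bfilt Q p x v -> bfilt Q p x w -> bfilt Q p x (v + w).
Proof. by move=> Px hv hw; rewrite -[v]scale1r; exact: filt_lin. Qed.

Lemma filtN (x : A 0) (p : int) v : pts (lev Q 0) x ->
  bfilt Q p x v -> bfilt Q p x (- v).
Proof.
move=> Px hv; have [_ h0 _ _] := filt_subbundle (bfilt Q) p Px.
by have := filt_lin (-1) Px hv h0; rewrite scaleN1r addr0.
Qed.

(** Induction downwards from [F^0 = 0]: a vector of [F^p] is matched by an element of degree [p] up
    to a remainder in [F^(p+1)]. *)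
Lemma gr_iso_onto (x : A 0) zeta : pts (lev Q 0) x -> gr_iso x zeta ->
  forall p v, bfilt Q p x v -> exists2 e, Efilt (n := 0) p e & v = zeta e.
Proof.
move=> Px [lz _ gz _ _].
have H (k : nat) : forall p : int, - k%:Z <= p -> forall v, bfilt Q p x v ->
    exists2 e, Efilt (tau := tau) (n := 0) p e & v = zeta e.
  elim: k => [|k IH] p kp v Fv.
    exists 0; first exact: Efilt0.
    rewrite (linear_fun0 lz); apply: (filt_zero (f := bfilt Q) Px).
    by apply: (filt_decr_nat Px _ Fv); lia.
  have [a ap Fa] := gz p v Fv.
  have [|e he Ee] := IH (p + 1) _ _ Fa; first lia.
  exists (a + e); last by rewrite linear_funD // -Ee addrC subrK.
  by apply: EfiltD; [exact: Efilt_ncomp|apply: Efilt_dec he; lia].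
by move=> p v; apply: (H `|p|%N); lia.
Qed.

Lemma gr_iso_filt (x : A 0) zeta : pts (lev Q 0) x -> gr_iso x zeta ->
  forall p e, Efilt (n := 0) p e -> bfilt Q p x (zeta e).
Proof.
move=> Px [lz gz _ _ _] p e /memv_sumP[v hv ->].
rewrite linear_fun_sum //; elim/big_ind: _.
- by have [_ h0 _ _] := filt_subbundle (bfilt Q) p Px.
- by move=> u w; exact: filtD.
- move=> i pi; apply: (filt_decr_nat Px pi); apply: gz; exact: hv.
Qed.

(** The lowest component of a kernel vector, say of degree [p], is sent into [F^(p+1)] because the
    sum of all components is sent to 0; hence it vanishes, and the degree of the vector goes up. *)
Lemma gr_iso_inj (x : A 0) zeta : pts (lev Q 0) x -> gr_iso x zeta ->
  injective zeta.
Proof.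
move=> Px gx; have [lz gz _ g0 _] := gx; apply: linear_inj => // e ze0.
have F0 p : bfilt Q p x 0 by have [_ h0 _ _] := filt_subbundle (bfilt Q) p Px.
suff H (k : nat) : Efilt (tau := tau) (n := 0) (- (ndepth (gneg tau))%:Z + k%:Z) e.
  by apply: (Efilt_top _ (H (ndepth (gneg tau)))); lia.
elim: k => [|k IH]; first by apply: Efilt_full; lia.
set p := _ + k%:Z in IH.
have [pn|pn] := boolP (0 <= p).
  by have -> : e = 0 by [apply: Efilt_top IH; lia]; exact: Efilt0.
have ip : (`|p|.-1 < ndepth (gneg tau))%N by rewrite /p in pn *; lia.
have [io pE] : exists io : 'I_(ndepth (gneg tau)), p = - io.+1%:Z.
  by exists (Ordinal ip); rewrite /=; lia.
move: IH => /memv_sumP[v hv eE].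
have ev : e - v io = \sum_(i < ndepth (gneg tau) | (p + 1 <= - i.+1%:Z)%R) v i.
  rewrite eE (bigD1 io) /=; last by rewrite -pE.
  rewrite addrAC subrr add0r; apply: eq_bigl => i; rewrite -val_eqE /=; lia.
have er : Efilt (tau := tau) (n := 0) (p + 1) (e - v io).
  by rewrite ev /=; apply: memv_sumr => i pi; apply: hv; lia.
have v0 : v io = 0.
  apply: (g0 p); first by rewrite pE; apply: hv; rewrite -pE.
  have -> : zeta (v io) = - zeta (e - v io).
    by rewrite linear_funB // ze0 sub0r opprK.
  by apply: (filtN Px); exact: (gr_iso_filt Px gx).
move: er; rewrite v0 subr0 /p.
by apply: Efilt_dec; lia.
Qed.

Lemma gr_iso_iso (x : A 0) zeta : pts (lev Q 0) x -> gr_iso x zeta ->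
  linear_iso (lev Q 0) x zeta.
Proof.
move=> Px gx; have [lz _ _ _ _] := gx; split=> //; first exact: gr_iso_inj gx.
apply/seteqP; split=> [D [e _ <-]|D TD].
  have [h _ _ _] := filt_subbundle (bfilt Q) (- (ndepth (gneg tau))%:Z) Px.
  by apply: h; apply: (gr_iso_filt Px gx); exact: Efilt_full.
have [p FD] := filt_exhaust (bfilt Q) TD.
by have [e _ ->] := gr_iso_onto Px gx FD; exists e.
Qed.

(** The definition of a frame asks for one inclusion only. At level 0 the reverse one holds because
    the frame is an isomorphism on the associated graded spaces; above, it is inherited through the
    projected frame. *)
Lemma hatS_strict n (z : A n) zeta : pts (lev Q n) z -> hatS_fibre z zeta ->
  forall p e, Tfilt p z (zeta e) <-> Efilt p e.
Proof.
elim: n z zeta => [|n IH] z zeta Pz hz p e.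
  have [[[_ iz _] fz] gz] := hz; split; last exact: fz.
  by move=> /(gr_iso_onto Pz gz)[f hf /iz ->].
split; last by have [_] := hatS_filtered hz; apply.
have [Pz1 _] := lev_point Pz; have [hb _] := hatS_fbar hz.
move=> /= [_]; rewrite (descend_frame _ hz); case: lerP => pn.
  by move=> /(IH _ _ Pz1 hb) he; split=> //; left.
have [lz iz _] := hatS_iso hz.
move=> ze0; have -> : e = 0 by apply: iz; rewrite ze0 (linear_fun0 lz).
by split; [exact: Efilt0|right].
Qed.

(** On an element of degree [p] the map [u] adds terms of degree at least [p + 1], which the
    conditions of [gr_iso] ignore. *)
Lemma gr_iso_unit (x : A 0) zeta (u : E 0 -> E 0) : pts (lev Q 0) x ->
  gr_iso x zeta -> unit_cls u -> gr_iso x (zeta \o u).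
Proof.
move=> Px gx hu; have [lz gz gs g0 gb] := gx; have [[lu _] ru] := hu.
have close p a : a \in ncomp (gneg tau) p ->
    bfilt Q (p + 1) x (zeta (u a) - zeta a).
  move=> /Efilt_ncomp/ru; rewrite addrC => h.
  by rewrite -linear_funB //; exact: (gr_iso_filt Px gx).
have swap p (a : E 0) v : a \in ncomp (gneg tau) p ->
    bfilt Q (p + 1) x (v - zeta (u a)) <-> bfilt Q (p + 1) x (v - zeta a).
  move=> ap; split=> h.
    by rewrite -(subrKA (zeta (u a))); apply: filtD => //; exact: close.
  rewrite -(subrKA (zeta a)); apply: filtD => //.
  by rewrite -opprB; apply: filtN => //; exact: close.
split.
- exact: linear_comp.
- move=> p a ap; apply: (gr_iso_filt Px gx); apply: (FGL_filt _ hu) => //.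
  exact: Efilt_ncomp.
- by move=> p v /gs[a ap h]; exists a => //; apply/swap.
- move=> p a ap h; apply: (g0 p) => //.
  rewrite -[zeta a]opprK -[- zeta a]add0r; apply: filtN => //.
  apply/(swap p) => //; rewrite sub0r; exact: filtN.
- move=> p q a b V W ap bq sV sW /(swap p _ _ ap) hV /(swap q _ _ bq) hW.
  apply/(swap (p + q)); first exact: nbr_graded.
  exact: gb.
Qed.

Lemma hatS_unit n (z : A n) zeta (u : E n -> E n) : pts (lev Q n) z ->
  hatS_fibre z zeta -> unit_cls u -> hatS_fibre z (zeta \o u).
Proof.
elim: n z zeta u => [|n IH] z zeta u Pz hz hu.
  have [[iz fz] gz] := hz; have [[lu bu] _] := hu.
  split; last exact: gr_iso_unit.
  split; first exact: linear_iso_comp.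
  by move=> p e he; apply: fz; exact: FGL_filt hu he.
have [Pz1 _] := lev_point Pz; have [hb cb] := hatS_fbar hz.
have [[iz fz] vz _ _] := hz; have [[lu bu] _] := hu.
have bE : fbar (zeta \o u) = fbar zeta \o ebar u.
  by apply/funext => e; rewrite /fbar /= -/(fbar zeta _) (descend_frame _ hz).
have ub : unit_cls (ebar u) by have [] := unit_cls_Hgrp hu.
split.
- split; first exact: linear_iso_comp.
  by move=> p e he; apply: fz; exact: FGL_filt hu he.
- by move=> a /=; rewrite (FGL_vert _ _ hu).
- by rewrite -/(fbar (zeta \o u)) bE; exact: IH.
- by rewrite -/(fbar (zeta \o u)) bE cls_comp.
Qed.

Lemma lev_class n (z : A n.+1) zeta : pts (lev Q n.+1) z -> z.2 zeta ->
  hatS_fibre z.1 zeta /\ cls zeta = z.2.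
Proof.
move=> /lev_point[Pz1 [zeta0 h0 zE]]; rewrite zE => hz.
have := cls_mem hz; move: hz => [u hu ->] cE; split=> //; exact: hatS_unit.
Qed.

Lemma hatS_Hgrp n (z : A n.+1) zeta (a : E n.+1 -> E n.+1) :
  pts (lev Q n.+1) z -> hatS_fibre z zeta -> Hgrp a ->
  hatS_fibre z (zeta \o a).
Proof.
move=> Pz hz Ha; have [la va ua] := Ha; have ba := Hgrp_bij Ha.
have [Pz1 _] := lev_point Pz; have [hb cb] := hatS_fbar hz.
have [[iz fz] vz _ _] := hz.
have bE : fbar (zeta \o a) = fbar zeta \o ebar a.
  by apply/funext => e; rewrite /fbar /= -/(fbar zeta _) (descend_frame _ hz).
split.
- split; first exact: linear_iso_comp.
  by move=> p e he; apply: fz; exact: Hgrp_filt.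
- by move=> b /=; rewrite va.
- by rewrite -/(fbar (zeta \o a)) bE; exact: hatS_unit.
- by rewrite -/(fbar (zeta \o a)) bE cls_comp.
Qed.

Lemma frame_quotient n (z : A n) (zeta zeta' : E n -> U n) :
  linear_iso (lev Q n) z zeta -> linear_iso (lev Q n) z zeta' ->
  exists a, [/\ linear a, bijective a & zeta' = zeta \o a].
Proof.
move=> hz hz'; have [lz iz _] := hz; have [lz' iz' _] := hz'.
have /choice[a ha] : forall e, exists e', zeta e' = zeta' e.
  by move=> e; apply: (linear_iso_onto hz); exact: linear_iso_tangent.
have la : linear a by move=> c u v; apply: iz; rewrite ha lz' lz !ha.
exists a; split=> //.
  apply: linear_inj_bij => // u v uv; apply: iz'.
  by rewrite -!ha uv.
by apply/funext => e /=; rewrite ha.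
Qed.

(** The conditions in [Hgrp] match those on a frame at [z]: the vertical part is prescribed, and the
    class of the projected frame is the second component of [z]. Together with [hatS_Hgrp], the
    frames at [z] form a torsor. *)
Lemma hatS_torsor n (z : A n.+1) zeta zeta' : pts (lev Q n.+1) z ->
  hatS_fibre z zeta -> hatS_fibre z zeta' ->
  exists2 a, Hgrp a & zeta' = zeta \o a.
Proof.
move=> Pz hz hz'; have [a [la ba zE]] := frame_quotient (hatS_iso hz) (hatS_iso hz').
exists a => //; have [_ iz _] := hatS_iso hz.
have [hb cb] := hatS_fbar hz; have [hb' cb'] := hatS_fbar hz'.
have [_ ib _] := hatS_iso hb.
split=> // [b|].
  have [_ vz _ _] := hz; have [_ vz' _ _] := hz'.
  by apply: iz; rewrite -[zeta (a _)]/((zeta \o a) _) -zE vz vz'.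
have : cls (fbar zeta) (fbar zeta') by rewrite cb -cb'; exact: cls_self.
move=> [u hu uE]; suff -> : ebar a = u by [].
apply/funext => e; apply: ib; rewrite -[RHS]/((fbar zeta \o u) e) -uE.
by rewrite /fbar zE /= -/(fbar zeta _) (descend_frame _ hz).
Qed.

Lemma Hgrp_hat_group n (a : E n.+1 -> E n.+1) : Hgrp a ->
  pts (hat_group Q n.+1) a.
Proof.
move=> Ha; split; first by split; [case: Ha|exact: Hgrp_bij].
move=> z zeta Pz; split; first by move=> hz; exact: hatS_Hgrp.
have [b ab ba] := Hgrp_bij Ha.
move=> /hatS_Hgrp - /(_ b Pz (Hgrp_inv Ha ab ba)).
by congr hatS_fibre; apply/funext => e /=; rewrite ba.
Qed.

(** A frame at some point has to be at hand: over a level without frames [hat_group] would contain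
    all linear automorphisms. Hence the point and the frame carried along whenever the universal
    group is analysed. *)
Lemma hat_group_Hgrp n (z : A n.+1) zeta (a : E n.+1 -> E n.+1) :
  pts (lev Q n.+1) z -> hatS_fibre z zeta -> pts (hat_group Q n.+1) a ->
  Hgrp a.
Proof.
move=> Pz hz [[la ba] /(_ z zeta Pz)[/(_ hz) ha _]].
have [b Hb zE] := hatS_torsor Pz hz ha; have [_ iz _] := hatS_iso hz.
suff -> : a = b by [].
by apply/funext => e; apply: iz; exact: (congr1 (fun f => f e) zE).
Qed.

End Frames.

(** * Smooth frames and the linear normal form of classes *)

Section FrameFields.
Context {R : realType}.

Lemma functional_sumE (T I : Type) (r : seq I) (P : pred I)
    (D : I -> functional (R := R) T) f :
  (\sum_(i <- r | P i) D i) f = \sum_(i <- r | P i) (D i f : R).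
Proof. by elim/big_rec2: _ => // i y1 y2 _ <-. Qed.

Lemma frame_apply {T S} (X : space R T) (Y : space R S) (V : vectType R)
    (t : S -> V -> functional (R := R) T) (v : S -> V) f :
  (forall z, pts Y z -> linear (t z)) ->
  (forall e, smooth_fun Y (fun z => t z e f)) -> vsmooth Y v ->
  smooth_fun Y (fun z => t z (v z) f).
Proof.
move=> lt st sv.
apply: (@eq_smooth _ _ Y (fun z => \sum_i vc i (v z) * t z (vb i) f)).
  move=> z Yz; rewrite {2}(vcE (v z)) linear_fun_sum; last exact: lt.
  rewrite functional_sumE; apply: eq_bigr => i _.
  by rewrite linear_funZ //; exact: lt.
apply: smooth_sum => i; apply: smooth_mul => //.
exact: (sv _ (@vc_linear _ _ i)).
Qed.

Lemma hom_apply {S} (Y : space R S) (V W : vectType R) (a : S -> 'Hom(V, W))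
    (v : S -> V) :
  vsmooth Y a -> vsmooth Y v -> vsmooth Y (fun z => a z (v z)).
Proof.
move=> sa sv l hl.
apply: (@eq_smooth _ _ Y (fun z => \sum_i vc i (v z) * l (a z (vb i)))).
  move=> z _; rewrite {2}(vcE (v z)) linear_sum linear_fun_sum //.
  by apply: eq_bigr => i _; rewrite linearZ /= linear_funZ.
apply: smooth_sum => i; apply: smooth_mul; first exact: (sv _ (@vc_linear _ _ i)).
apply: (sa (fun A : 'Hom(V, W) => l (A (vb i)))) => c A B.
by rewrite add_lfunE scale_lfunE hl.
Qed.

Context {tau : struct_type R}.
Local Notation E := (Espace tau).

Lemma raises_subspace n p :
  subspace (fun A : 'End(E n) => raises p (A : E n -> E n)).
Proof.
split=> [q e _|c A B rA rB q e he]; first by rewrite lfunE; exact: Efilt0.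
rewrite add_lfunE scale_lfunE; apply: EfiltD; last exact: rB.
by apply: EfiltZ; exact: rA.
Qed.

(* The class of a filtered automorphism [a] modulo [unit_cls] is the affine
   space of the [a + N] with [N] raising the degree by [n.+1]. *)
Lemma normal_form n : exists P : 'End(E n) -> 'End(E n), [/\ linear P,
    forall a, linear a -> bijective a -> (forall q e, Efilt q e -> Efilt q (a e)) ->
      exists2 u, unit_cls u & (P (linfun a) : E n -> E n) = a \o u &
    forall a u, linear a -> (forall q e, Efilt q e -> Efilt q (a e)) ->
      unit_cls u -> P (linfun (a \o u)) = P (linfun a)].
Proof.
have [P [P1 P2]] := subspace_projection (raises_subspace n n.+1%:Z).
exists P; split; first by move=> c A B; exact: linearP.
- move=> a la ba fa; have [b ab ba'] := ba.
  have lb := linear_cancel la ab ba'.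
  pose N := linfun a - P (linfun a).
  have fb q e : Efilt q e -> Efilt q (b e).
    by move=> he; apply: (filt_reflect la (can_inj ab) fa); rewrite ba'.
  exists (fun e => e - b (N e)).
    apply: unipotent_FGL => //.
      by move=> c u v; rewrite linearP lb opprD scalerBr addrACA.
    move=> q e he; rewrite addrAC subrr sub0r; apply: EfiltN; apply: fb.
    exact: P1.
  apply/funext => e /=; rewrite linear_funB // ba' /N add_lfunE opp_lfunE linfunE //.
  by rewrite opprB addrC subrK.
- move=> a u la fa hu; have lu := FGL_linear hu.
  apply: subr0_eq; rewrite -linearB; apply: P2 => q e he.
  rewrite add_lfunE opp_lfunE !linfunE //=; last exact: linear_comp.
  by rewrite -linear_funB //; apply: fa; case: hu => _; exact.
Qed.

(** Conjugation by a filtered automorphism does not change by how much degrees are raised. This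
    normality lets classes be multiplied through representatives. *)
Lemma unit_normal n (b u : E n -> E n) : linear b -> bijective b ->
  (forall q e, Efilt q e -> Efilt q (b e)) -> unit_cls u ->
  exists2 v, unit_cls v & u \o b = b \o v.
Proof.
move=> lb [c bc cb] fb hu; have lc := linear_cancel lb bc cb.
have lu := FGL_linear hu; have ub := FGL_bij hu.
have fc q e : Efilt q e -> Efilt q (c e).
  by move=> he; apply: (filt_reflect lb (can_inj bc) fb); rewrite cb.
exists (c \o u \o b); last by apply/funext => e /=; rewrite cb.
apply: unipotent_FGL => //.
  by apply: linear_comp => //; exact: linear_comp.
move=> q e he /=; rewrite -{2}(bc e) -linear_funB //; apply: fc.
by case: hu => _; apply; exact: fb.
Qed.

Lemma comp_set_cls2 n (B : Type) (f : E n -> B) (b : E n -> E n) : linear b ->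
  bijective b -> (forall q e, Efilt q e -> Efilt q (b e)) ->
  comp_set (cls f) (cls b) = cls (f \o b).
Proof.
move=> lb bb fb; apply/seteqP; split=> h.
  move=> [_ [u hu ->] [_ [v hv ->] ->]].
  have [w hw E1] := unit_normal lb bb fb hu.
  exists (w \o v); first exact: FGL_comp.
  by apply/funext => e /=; have /= -> := congr1 (fun g => g (v e)) E1.
move=> [u hu ->]; exists f; first exact: cls_self.
by exists (b \o u) => //; exists u.
Qed.

End FrameFields.

(** * Smooth selection of a frame in each class *)

Section UniversalFrames.
Context {R : realType} {tau : struct_type R} (Q : tower tau).
Local Notation E := (Espace tau).
Local Notation A n := (Amb tau (base Q) n).
Local Notation U n := (functional (R := R) (A n)).
Local Notation descend := (@descend R tau Q _).
Local Notation act := (@act R tau Q _).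

Definition uproj n (u : A n * (E n -> U n)) : A n.+1 := (u.1, cls u.2).

Lemma hatS_fst n : smooth_map (hatS Q n) (lev Q n) fst.
Proof.
apply: smooth_map_gens => [u []//|g gg]; apply: smooth_gen; left.
by exists g => //; exact: smooth_gen.
Qed.

Lemma hatS_eval n e f : smooth_fun (lev Q n) f ->
  smooth_fun (hatS Q n) (fun u => u.2 e f).
Proof. by move=> sf; apply: smooth_gen; right; exists e, f. Qed.

Lemma smooth_to_hatS {S} (Y : space R S) n (p : S -> A n)
    (zeta : S -> E n -> U n) :
  smooth_map Y (lev Q n) p ->
  (forall z, pts Y z -> hatS_fibre (p z) (zeta z)) ->
  (forall e f, smooth_fun (lev Q n) f -> smooth_fun Y (fun z => zeta z e f)) ->
  smooth_map Y (hatS Q n) (fun z => (p z, zeta z)).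
Proof.
move=> sp hz sz; have [pY sp'] := sp; apply: smooth_map_gens => [z Yz|g].
  by split; [exact: pY|exact: hz].
by move=> [[f sf ->]|[e [f sf ->]]]; [exact: sp'|exact: sz].
Qed.

Lemma uproj_smooth n : smooth_map (hatS Q n) (univ_frame Q n) (@uproj n).
Proof. by apply: smooth_map_gens => // u Pu; exists u. Qed.

Lemma univ_frame_descend n : smooth_map (univ_frame Q n) (lev Q n) descend.
Proof.
apply: smooth_map_gens => [z [u [Pu _] <-]//|g gg].
apply: smooth_gen; have [_] := hatS_fst n; apply; exact: smooth_gen.
Qed.

(** The generators of [univ_frame] are global functions with smooth pull-back to [hatS]. A local
    function is made global by a bump function of the base, which is constant on classes and thus
    compatible with the quotient. *)
Lemma univ_frame_local n (O : set (A n)) (h : A n.+1 -> R) :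
  open_in (lev Q n) O ->
  smooth_fun (restrict (hatS Q n) (fst @^-1` O)) (h \o @uproj n) ->
  smooth_fun (restrict (univ_frame Q n) (descend @^-1` O)) h.
Proof.
move=> oO sh; apply: smooth_local => z0 [Pz0 Oz0].
have [dP _] := univ_frame_descend n; have Pz1 := dP _ Pz0.
have [chi [schi chi1 chi0]] := bump Pz1 (oO _ Pz1 Oz0).
have sfst : smooth_fun (hatS Q n) (chi \o fst) by have [_] := hatS_fst n; apply.
exists (fun z => chi z.1 * (if `[< O z.1 >] then h z else 0)).
  apply: smooth_restrict; apply: smooth_gen.
  apply: smooth_local => u Pu; have [Ou|nOu] := pselect (O u.1); last first.
    exists (fun _ => 0); first exact: smooth_cst.
    have := nbh_preimage (hatS_fst n) Pu (chi0 _ (proj1 Pu) nOu).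
    by apply: nbhS => w _ /= ->; rewrite mul0r.
  have oO' := open_preimage (hatS_fst n) oO.
  have [g sg gh] := smooth_extend oO' Pu Ou sh.
  exists (fun w => chi w.1 * g w); first exact: smooth_mul.
  have := nbhI (oO' u Pu Ou) gh; apply: nbhS => w _ [/= Ow ->].
  by rewrite asboolT.
apply: restrict_nbh.
have := nbhI (nbh_preimage (univ_frame_descend n) Pz0 (oO _ Pz1 Oz0))
  (nbh_preimage (univ_frame_descend n) Pz0 chi1).
apply: nbhS => z _ [/= Oz Hz]; move: Oz Hz; rewrite /Defs.descend => Oz ->.
by rewrite asboolT // mul1r.
Qed.

(** Weaker than being a point of the universal bundle: the frame need neither respect brackets nor
    have the prescribed vertical part. Two such frames differ by a filtered automorphism, which is
    what the normal form requires. *)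
Definition strict_frame n (y : A n) (t : E n -> U n) : Prop :=
  linear_iso (lev Q n) y t /\ forall p e, Tfilt p y (t e) <-> Efilt p e.

Definition frame_field n (O : set (A n)) (t : A n -> E n -> U n) : Prop :=
  [/\ open_in (lev Q n) O, forall y, pts (lev Q n) y -> O y -> strict_frame y (t y) &
      forall e f, smooth_fun (lev Q n) f ->
        smooth_fun (restrict (lev Q n) O) (fun y => t y e f)].

Definition hatS_field n (O : set (A n)) (s : A n -> E n -> U n) : Prop :=
  [/\ open_in (lev Q n) O, forall y, pts (lev Q n) y -> O y -> hatS_fibre y (s y) &
      forall e f, smooth_fun (lev Q n) f ->
        smooth_fun (restrict (lev Q n) O) (fun y => s y e f)].

Hypothesis reg : regular Q.

Lemma hatS_field_frame n O s : hatS_field (n := n) O s -> frame_field O s.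
Proof.
move=> [oO hs ss]; split=> // y Py Oy; split; first exact/hatS_iso/hs.
by apply: hatS_strict => //; exact: hs.
Qed.

Lemma strict_quotient n (y : A n) (t t' : E n -> U n) : strict_frame y t ->
  strict_frame y t' -> exists a, [/\ linear a, bijective a,
    forall q e, Efilt q e -> Efilt q (a e) & t' = t \o a].
Proof.
move=> [it ft] [it' ft']; have [a [la ba tE]] := frame_quotient it it'.
exists a; split=> // q e; rewrite -ft' -ft.
by rewrite tE.
Qed.

(** A frame in the class of [z] is [t z.1 \o a], and the normal form of [a] depends on the class
    only. Thus it is a function of [z], smooth because on [hatS] the coefficients of a frame with
    respect to [t] are smooth. *)
Lemma class_selection n (O : set (A n)) t : frame_field O t ->
  exists N : A n.+1 -> 'End(E n),
    (forall z, pts (univ_frame Q n) z -> O z.1 -> z.2 (t z.1 \o N z)) /\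
    vsmooth (restrict (univ_frame Q n) (descend @^-1` O)) N.
Proof.
move=> [oO ft st]; have [P [lP P1 P2]] := normal_form (tau := tau) n.
have hs y zeta : pts (lev Q n) y -> hatS_fibre y zeta -> strict_frame y zeta.
  by move=> Py hz; split; [exact: hatS_iso|exact: hatS_strict].
have /choice[a Ha] : forall u : A n * (E n -> U n), exists a : E n -> E n,
    pts (hatS Q n) u -> O u.1 ->
    [/\ linear a, bijective a, forall q e, Efilt q e -> Efilt q (a e) &
        u.2 = t u.1 \o a].
  move=> u; have [[[Pu hu] Ou]|nu] := pselect (pts (hatS Q n) u /\ O u.1).
    have [a aP] := strict_quotient (ft _ Pu Ou) (hs _ _ Pu hu).
    by exists a.
  by exists id => Pu Ou; elim: nu.
have /choice[z2 Hz2] : forall z : A n.+1, exists zeta : E n -> U n,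
    pts (univ_frame Q n) z -> hatS_fibre z.1 zeta /\ z.2 = cls zeta.
  move=> z; have [[u [Pu hu] <-]|nz] := pselect (pts (univ_frame Q n) z).
    by exists u.2.
  by exists (fun _ => 0).
pose M u : 'End(E n) := P (linfun (a u)).
pose N z : 'End(E n) := M (z.1, z2 z).
exists N; split.
  move=> z Pz Oz; have [hz zE] := Hz2 z Pz.
  have Pz1 : pts (lev Q n) z.1 by case: Pz => u [Pu _] <-.
  have [la ba fa aE] := Ha (z.1, z2 z) (conj Pz1 hz) Oz.
  have [u hu uE] := P1 _ la ba fa.
  rewrite zE; exists u => //; rewrite /N /M uE.
  by apply/funext => e; exact: esym (congr1 (fun g => g (u e)) aE).
have sM : vsmooth (restrict (hatS Q n) (fst @^-1` O)) M.
  apply: vsmooth_linear lP _; apply: vsmooth_hom => e.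
  apply: (@vsmooth_eq _ _ _ _ (fun u => a u e)).
    by move=> u [Pu Ou]; have [la _ _ _] := Ha u Pu Ou; rewrite linfunE.
  apply: (@frame_coordinates _ _ _ (lev Q n) _ _ fst
    (fun u => t u.1) (fun u => u.2 e)).
  - by move=> u [[Pu _] Ou]; have [] := ft _ Pu Ou.
  - move=> e' f sf.
    have [_] := smooth_map_restrict2 (O := fst @^-1` O) (hatS_fst n)
      (fun x _ Ox => Ox : O x.1).
    by move=> /(_ _ (st e' f sf)).
  - by move=> f sf; apply: smooth_restrict; exact: hatS_eval.
  - by move=> u [Pu Ou]; have [_ _ _ ->] := Ha u Pu Ou.
move=> l hl; apply: univ_frame_local => //.
apply: eq_smooth (sM l hl) => u [Pu Ou] /=; congr l.
have [Pu1 hu] := Pu.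
have Pv : pts (univ_frame Q n) (uproj u) by exists u.
have [hv vE] := Hz2 _ Pv.
have [la ba fa aE] := Ha u Pu Ou.
have [lb bb fb bE] := Ha ((uproj u).1, z2 (uproj u)) (conj Pu1 hv) Ou.
(* The representative chosen over [uproj u] differs from [u.2] by an element of [unit_cls], which
   the normal form does not see. *)
have [v hv' vE'] : cls u.2 (z2 (uproj u)).
  by move: vE => /= ->; exact: cls_self.
rewrite /N /M; set b := a (_, _) in lb bb fb bE *.
have -> : b = a u \o v.
  have [[_ it _] _] := ft _ Pu1 Ou.
  apply/funext => e; apply: it; move: bE vE' => /= bE vE'.
  have := congr1 (fun g => g e) bE; rewrite vE' aE => /=.
  by move=> <-.
exact/esym/P2.
Qed.

End UniversalFrames.

(** * Local trivialisations, vertical vectors and horizontal lifts *)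

Section Trivializations.
Context {R : realType} {tau : struct_type R} (Q : tower tau).
Local Notation E := (Espace tau).
Local Notation A n := (Amb tau (base Q) n).
Local Notation U n := (functional (R := R) (A n)).
Local Notation descend n := (@descend R tau Q n).
Local Notation act n := (@act R tau Q n).
Local Notation unit n := (unit_cls (tau := tau) (n := n)).

(** Common ground of the Lie groups up to order [k] and of the universal groups above, which are
    given as quotients of linear groups: just what identifies the vertical vectors with the tangent
    space at the unit. *)
Definition good_group n : Prop :=
  [/\ smooth_map (prod_space (lev Q n.+1) (grp tau n)) (lev Q n.+1)
        (fun u => act n u.1 u.2),
      pts (grp tau n) (unit n),
      forall c, pts (grp tau n) c -> comp_set c (unit n) = c &
      forall c, pts (grp tau n) c ->
        diffeomorphism (grp tau n) (grp tau n) (comp_set c)].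

Definition triv n (O : set (A n)) (s : A n -> A n.+1) : Prop :=
  [/\ open_in (lev Q n) O, forall y, pts (lev Q n) y -> O y -> (s y).1 = y &
      diffeomorphism (prod_space (restrict (lev Q n) O) (grp tau n))
        (restrict (lev Q n.+1) (descend n @^-1` O)) (fun u => act n (s u.1) u.2)].

Lemma act_act n (z : A n.+1) c c' : act n (act n z c) c' = act n z (comp_set c c').
Proof. by rewrite /Defs.act /= comp_setA. Qed.

Lemma smooth_map_prod_incl {T T'} (X : space R T) (Y : space R T')
    (O O' : set T) : O' `<=` O ->
  smooth_map (prod_space (restrict X O') Y) (prod_space (restrict X O) Y) id.
Proof.
move=> OO'; apply: smooth_map_gens => [u [[Xu Ou] Yu]|h gh].
  by split=> //; split=> //; exact: OO'.
exact: (smooth_gen (X := prod_space (restrict X O') Y)).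
Qed.

Lemma smooth_map_restrict_incl {T} (X : space R T) (O O' : set T) : O' `<=` O ->
  smooth_map (restrict X O') (restrict X O) id.
Proof.
by move=> OO'; apply: smooth_map_restrict2 => [|x _ /OO'].
Qed.

Lemma triv_restrict n (O O' : set (A n)) s :
  triv O s -> open_in (lev Q n) O' -> triv (O `&` O') s.
Proof.
move=> [oO sO [sf [g [sg gf fg]]]] oO'; split; first exact: open_inI.
  by move=> y Py [Oy _]; exact: sO.
have O1 : O `&` O' `<=` O by move=> x [].
split; last (exists g; split).
- apply: smooth_map_restrict.
    have := smooth_map_comp (smooth_map_prod_incl (lev Q n) (grp tau n) O1) sf.
    by move=> h; exact: (smooth_map_comp h (@smooth_map_incl _ _ _ _)).
  by move=> [y c] [[Py [Oy Oy']] Gc] /=; rewrite /Defs.descend /= sO.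
- have sg' := smooth_map_comp (smooth_map_restrict_incl (lev Q n.+1)
    (O := descend n @^-1` O) (O' := descend n @^-1` (O `&` O')) (fun x h => h.1)) sg.
  apply: smooth_map_gens => [z Pz|h gh]; last first.
    by have [_] := sg'; apply; exact: smooth_gen.
  have [/(_ z Pz) [[Pgz Ogz] Ggz] _] := sg'.
  split=> //; split=> //; split=> //.
  have [Pz1 [Oz Oz']] := Pz.
  have := fg z (conj Pz1 Oz) => /(congr1 fst) /=; rewrite sO // => ->.
  exact: Oz'.
- by move=> [y c] [[Py [Oy _]] Gc]; exact: gf.
- by move=> z [Pz [Oz _]]; exact: fg.
Qed.

Hypothesis reg : regular Q.

Section Exactness.
Variables (n : nat) (O : set (A n)) (s : A n -> A n.+1).
Hypotheses (gG : good_group n) (tO : triv O s).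

Lemma act_smooth z : pts (lev Q n.+1) z ->
  smooth_map (grp tau n) (lev Q n.+1) (act n z).
Proof.
move=> Pz; have [sa _ _ _] := gG.
have sp : smooth_map (grp tau n) (prod_space (lev Q n.+1) (grp tau n)) (fun c => (z, c)).
  by apply: smooth_map_pair => //; exact: smooth_map_cst.
exact: (smooth_map_comp sp sa).
Qed.

Lemma act_unit z : pts (lev Q n.+1) z -> act n z (unit n) = z.
Proof.
move=> /(lev_point reg)[_ [zeta _ zE]]; case: z zE => y c /= ->.
by rewrite /Defs.act /= comp_set_cls.
Qed.

Lemma triv_inv : exists c : A n.+1 -> set (E n -> E n),
  [/\ smooth_map (restrict (lev Q n.+1) (descend n @^-1` O)) (grp tau n) c,
      forall z, pts (lev Q n.+1) z -> O z.1 -> act n (s z.1) (c z) = z &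
      forall y c', pts (lev Q n) y -> O y -> pts (grp tau n) c' ->
        c (act n (s y) c') = c'].
Proof.
have [oO sO [sf [g [sg gf fg]]]] := tO.
exists (fun z => (g z).2); split.
- exact: (smooth_map_comp sg (@smooth_map_snd _ _ _ _ _)).
- move=> z Pz Oz; have := fg z (conj Pz Oz) => /= zE.
  have [/(_ z (conj Pz Oz)) [[P1 O1] _] _] := sg.
  have z1E : (g z).1 = z.1 by have := congr1 fst zE; rewrite /= sO.
  by rewrite -z1E.
- by move=> y c' Py Oy Gc; rewrite (gf (y, c')).
Qed.

(** Read in the trivialisation, the orbit map of [z] is left translation by [c z], a diffeomorphism
    of the group. *)
Lemma fundamental_inj z D : pts (lev Q n.+1) z -> O z.1 ->
  tangent (grp tau n) (unit n) D -> push (lev Q n.+1) (act n z) D = 0 -> D = 0.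
Proof.
move=> Pz Oz TD D0; have [c [sc cE cK]] := triv_inv.
have [_ Gu cu dG] := gG.
have sz : smooth_map (grp tau n) (restrict (lev Q n.+1) (descend n @^-1` O)) (act n z).
  by apply: smooth_map_restrict => //; exact: act_smooth.
have [cP _] := sc; have Gc := cP z (conj Pz Oz).
have T1 := push_tangent sz TD; rewrite act_unit // in T1.
have E1 : push (restrict (lev Q n.+1) (descend n @^-1` O)) (act n z) D = 0.
  apply: (restrict_tangent_inj T1); first exact: tangent0.
  by rewrite push0 push_comp //; exact: smooth_map_incl.
have := congr1 (push (grp tau n) c) E1; rewrite push0 push_comp //.
have Pz1 : pts (lev Q n) z.1 by have [] := lev_point reg Pz.
have [dcP _] := diffeo_smooth (dG _ Gc).
rewrite (push_ext (grp tau n) (g := comp_set (c z)) TD); last first.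
  move=> c' Gc' /=.
  have -> : act n z c' = act n (s z.1) (comp_set (c z) c').
    by rewrite -act_act cE.
  by rewrite cK //; exact: dcP.
move=> h0; apply: (diffeo_push_inj (dG _ Gc) TD (tangent0 Gu)).
by rewrite push0; exact: h0.
Qed.

(** In the trivialisation a vertical vector is tangent to the group factor, and left translation by
    [c z] carries it back to the unit. *)
Lemma fundamental_onto z X : pts (lev Q n.+1) z -> O z.1 ->
  tangent (lev Q n.+1) z X -> push (lev Q n) (descend n) X = 0 ->
  exists2 D, tangent (grp tau n) (unit n) D & push (lev Q n.+1) (act n z) D = X.
Proof.
move=> Pz Oz TX X0; have [c [sc cE cK]] := triv_inv.
have [_ Gu cu dG] := gG; have [oO sO [sf _]] := tO; have [sd _ _] := reg.
have oO' := open_preimage (sd n) oO.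
pose Y := restrict (lev Q n.+1) (descend n @^-1` O).
pose Z := prod_space (restrict (lev Q n) O) (grp tau n).
have [cP _] := sc; have Gc := cP z (conj Pz Oz).
have [T1 E1] := locP oO' (Oz : (descend n @^-1` O) z) TX.
set X1 := loc _ _ _ _ in T1 E1.
have sdO : smooth_map Y (restrict (lev Q n) O) (descend n).
  exact: smooth_map_restrict2.
have sg : smooth_map Y Z (fun w => (w.1, c w)).
  by apply: smooth_map_pair => //; exact: sdO.
have T2 := push_tangent sg T1.
have F2 : push (restrict (lev Q n) O) fst (push Z (fun w => (w.1, c w)) X1) = 0.
  rewrite push_comp; last exact: smooth_map_fst.
  have T3 := push_tangent sdO T1.
  apply: (restrict_tangent_inj T3).
    by apply: tangent0; have [] := T3.
  rewrite push0 push_comp; last exact: smooth_map_incl.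
  by rewrite -[RHS]X0 -E1 push_comp.
have X2E := push_prod_snd T2 F2; rewrite /= in X2E.
have T3 := push_tangent (@smooth_map_snd _ _ _ _ _) T2; rewrite /= in T3.
have [D TD DE] : exists2 D, tangent (grp tau n) (unit n) D &
    push (grp tau n) (comp_set (c z)) D = push (grp tau n) snd (push Z (fun w => (w.1, c w)) X1).
  by apply: (diffeo_push_onto (dG _ Gc)) => //; rewrite cu.
exists D => //.
have Pz1 : pts (lev Q n) z.1 by have [] := lev_point reg Pz.
have sf' : smooth_map Z (lev Q n.+1) (fun u => act n (s u.1) u.2).
  exact: (smooth_map_comp sf (@smooth_map_incl _ _ _ _)).
rewrite -[RHS]E1.
transitivity (push (lev Q n.+1) (fun u => act n (s u.1) u.2)
   (push Z (fun w => (w.1, c w)) X1)); last first.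
  rewrite push_comp //; apply: (push_ext _ T1) => w [Pw Ow] /=.
  exact: cE.
have sdz : smooth_map (grp tau n) Z (fun y => (z.1, y)).
  by apply: smooth_map_pair => //; exact: smooth_map_cst.
rewrite X2E -DE [in RHS]push_comp // push_comp; last first.
  exact: sf'.
congr (push _ _ D); apply/funext => c' /=.
by rewrite -{1}(cE z Pz Oz) act_act.
Qed.

End Exactness.

Lemma liealg_iso n : linear_iso (grp tau n) (unit n) (@liealg R tau n).
Proof. by have [_ _] := reg; apply. Qed.

(** A point [z] contains a class of frames at [z.1]; [zeta z] selects one of them smoothly. Its
    vectors are lifted to [z] along the trivialisation, and the fundamental vectors are added on the
    new summand. The projected frame is [zeta z], so its class is [z.2] as required. *)
Lemma frame_step n (O : set (A n)) s t : good_group n -> triv O s ->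
  frame_field O t -> exists sigma, hatS_field (n := n.+1) (descend n @^-1` O) sigma.
Proof.
move=> gG tO ft; have [sact Gu cu dG] := gG; have [oO sO [sf _]] := tO.
have [c [sc cE cK]] := triv_inv tO; have [cP _] := sc.
have [N [zN sN]] := class_selection reg ft.
have [sd su _] := reg; have [_ ftO st] := ft.
have oO' := open_preimage (sd n) oO.
pose Y := restrict (lev Q n.+1) (descend n @^-1` O).
have sNY : vsmooth Y N.
  apply: (vsmooth_comp (Y := Y) (p := id) _ sN).
  by apply: smooth_map_restrict2 => //; exact: su.
pose zeta z := t z.1 \o N z.
have zetaP z : pts (lev Q n.+1) z -> O z.1 ->
    hatS_fibre z.1 (zeta z) /\ cls (zeta z) = z.2.
  move=> Pz Oz; apply: (lev_class reg Pz); apply: zN => //.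
  by have [h _] := su n; exact: h.
have szeta e g : smooth_fun (lev Q n) g -> smooth_fun Y (fun z => zeta z e g).
  move=> sg; apply: (@frame_apply _ _ _ (lev Q n) Y _ (fun z => t z.1) (fun z => N z e)).
  - move=> z [Pz Oz]; have [Pz1 _] := lev_point reg Pz.
    by have [[]] := ftO _ Pz1 Oz.
  - move=> e'; have sdO : smooth_map Y (restrict (lev Q n) O) (descend n).
      exact: smooth_map_restrict2.
    by have [_] := sdO; move=> /(_ _ (st e' g sg)).
  - by apply: hom_apply => //; exact: vsmooth_cst.
(* The group component is frozen at [c z]: the resulting local section passes through [z], and its
   differential is a right inverse of the projection. *)
pose H z e : U n.+1 := push (lev Q n.+1) (fun y => act n (s y) (c z))
  (loc (lev Q n) O z.1 (zeta z e)).
pose xi z (e : E n.+1) : U n.+1 :=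
  H z e.1 + push (lev Q n.+1) (act n z) (@liealg R tau n e.2).
have sprod : smooth_map (prod_space (restrict (lev Q n) O) (grp tau n)) (lev Q n.+1)
    (fun u => act n (s u.1) u.2).
  exact: (smooth_map_comp sf (@smooth_map_incl _ _ _ _)).
have slift z : pts (lev Q n.+1) z -> O z.1 ->
    smooth_map (restrict (lev Q n) O) (lev Q n.+1) (fun y => act n (s y) (c z)).
  move=> Pz Oz; have sp : smooth_map (restrict (lev Q n) O)
      (prod_space (restrict (lev Q n) O) (grp tau n)) (fun y => (y, c z)).
    by apply: smooth_map_pair => //; apply: smooth_map_cst; exact: cP.
  exact: (smooth_map_comp sp sprod).
have Hlin z : pts (lev Q n.+1) z -> O z.1 -> linear (H z).
  move=> Pz Oz a u v; have [hz _] := zetaP z Pz Oz.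
  have [lz _ _] := hatS_iso hz.
  rewrite /H lz loc_lin //; first exact: push_linear.
    exact: hatS_tangent.
  exact: hatS_tangent.
have Tloc z e : pts (lev Q n.+1) z -> O z.1 ->
    tangent (restrict (lev Q n) O) z.1 (loc (lev Q n) O z.1 (zeta z e)) /\
    push (lev Q n) id (loc (lev Q n) O z.1 (zeta z e)) = zeta z e.
  move=> Pz Oz; have [hz _] := zetaP z Pz Oz.
  by apply: locP => //; exact: hatS_tangent.
have TH z e : pts (lev Q n.+1) z -> O z.1 -> tangent (lev Q n.+1) z (H z e).
  move=> Pz Oz; have [T1 _] := Tloc z e Pz Oz.
  by have := push_tangent (slift z Pz Oz) T1; rewrite /= cE.
have HD z e : pts (lev Q n.+1) z -> O z.1 ->
    push (lev Q n) (descend n) (H z e) = zeta z e.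
  move=> Pz Oz; have [T1 E1] := Tloc z e Pz Oz.
  rewrite /H push_comp // -[RHS]E1; apply: (push_ext _ T1) => y [Py Oy].
  by rewrite /= /Defs.descend /= sO.
have TV z b : pts (lev Q n.+1) z ->
    tangent (lev Q n.+1) z (push (lev Q n.+1) (act n z) (@liealg R tau n b)).
  move=> Pz; have := push_tangent (act_smooth gG Pz) (liealg_tangent reg b).
  by rewrite act_unit.
have xiD z e : pts (lev Q n.+1) z -> O z.1 ->
    push (lev Q n) (descend n) (xi z e) = zeta z e.1.
  move=> Pz Oz; rewrite /xi linear_funD; last exact: push_linear.
  by rewrite HD // (descend_act reg _ (liealg_tangent reg _)) addr0.
have [ll il rl] := liealg_iso n.
have lxi z : pts (lev Q n.+1) z -> O z.1 -> linear (xi z).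
  move=> Pz Oz a u v; rewrite /xi /= (Hlin z Pz Oz) ll push_linear.
  by rewrite scalerDr addrACA.
have Txi z e : pts (lev Q n.+1) z -> O z.1 -> tangent (lev Q n.+1) z (xi z e).
  move=> Pz Oz; rewrite /xi -[H z e.1]scale1r; apply: tangent_lin; first exact: TH.
  exact: TV.
have xi_iso z : pts (lev Q n.+1) z -> O z.1 -> linear_iso (lev Q n.+1) z (xi z).
  move=> Pz Oz; have [hz _] := zetaP z Pz Oz; have [lz iz rz] := hatS_iso hz.
  split; first exact: lxi.
    apply: linear_inj; first exact: lxi.
    move=> e xe0; have e10 : e.1 = 0.
      apply: iz; rewrite (linear_fun0 lz) -(xiD z e Pz Oz) xe0 linear_fun0 //.
      exact: push_linear.
    have e20 : e.2 = 0.
      apply: il; rewrite (linear_fun0 ll).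
      apply: (fundamental_inj gG tO Pz Oz (liealg_tangent reg _)).
      by move: xe0; rewrite /xi e10 (linear_fun0 (Hlin z Pz Oz)) add0r.
    by case: e e10 e20 {xe0} => x y /= -> ->.
  apply/seteqP; split=> [D [e _ <-]|X TX]; first exact: Txi.
  have TX1 := push_tangent (sd n) TX.
  have [e eE] := linear_iso_onto (hatS_iso hz) TX1.
  have TX2 : tangent (lev Q n.+1) z (- 1 *: H z e + X).
    by apply: tangent_lin => //; exact: TH.
  have [D TD DE] : exists2 D, tangent (grp tau n) (unit n) D &
      push (lev Q n.+1) (act n z) D = - 1 *: H z e + X.
    apply: (fundamental_onto gG tO) => //.
    by rewrite push_linear HD // -eE scaleN1r addNr.
  have [b bE] := linear_iso_onto (liealg_iso n) TD.
  exists (e, b) => //; rewrite /xi /= bE DE scaleN1r addrC addrAC.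
  by rewrite addNr add0r.
exists xi; split=> // [z Pz Oz|e f sf0].
- have [hz cz] := zetaP z Pz Oz.
  have fb : fbar (xi z) = zeta z.
    by apply/funext => e; rewrite /fbar xiD.
  split.
  + split; first exact: xi_iso.
    move=> p e he; split; first exact: Txi.
    case: ifP => pn.
      rewrite xiD //; have [_] := hatS_filtered hz; apply.
      by case: he.
    have -> : e = 0 by apply: (Efilt_top _ he); lia.
    by rewrite (linear_fun0 (lxi z Pz Oz)).
  + by move=> a; rewrite /xi /= (linear_fun0 (Hlin z Pz Oz)) add0r.
  + by rewrite -/(fbar (xi z)) fb.
  + by rewrite -/(fbar (xi z)) fb.
- apply: (@eq_smooth _ _ _ (fun z => H z e.1 f +
    push (lev Q n.+1) (act n z) (@liealg R tau n e.2) f)) => //.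
  (* Both summands are derivatives in one variable of a smooth map of two: of the trivialisation
     along the base with the group element as parameter, and of the action along the group with the
     point as parameter. *)
  apply: smooth_add.
    apply: (@eq_smooth _ _ _ (fun z =>
       loc (lev Q n) O z.1 (zeta z e.1) (fun y => f (act n (s y) (c z))))).
      by move=> z [Pz Oz]; rewrite /H pushE.
    apply: (@smooth_partial _ _ _ _ (restrict (lev Q n) O) (grp tau n) Y
      (descend n) c (fun z => loc (lev Q n) O z.1 (zeta z e.1))
      (fun u => f (act n (s u.1) u.2))) => //.
    + exact: smooth_map_restrict2.
    + by move=> z [Pz Oz]; have [] := Tloc z e.1 Pz Oz.
    + move=> g gg; have sg : smooth_fun (lev Q n) g by exact: smooth_gen.
      apply: eq_smooth (szeta e.1 g sg) => z [Pz Oz].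
      rewrite loc_smooth //.
      by have [hz _] := zetaP z Pz Oz; exact: hatS_tangent.
    + by have [_] := sprod; apply.
  apply: (@eq_smooth _ _ _ (fun z => @liealg R tau n e.2 (fun c' => f (act n z c')))).
    by move=> z [Pz Oz]; rewrite pushE.
  apply: (@smooth_partial _ _ _ _ (grp tau n) (lev Q n.+1) Y
    (fun _ => unit n) id (fun _ => @liealg R tau n e.2)
    (fun u => f (act n u.2 u.1))) => //.
  + exact: smooth_map_cst.
  + exact: smooth_map_incl.
  + by move=> z _; exact: (liealg_tangent reg).
  + by move=> g gg; exact: smooth_cst.
  + have sw : smooth_map (prod_space (grp tau n) (lev Q n.+1))
       (prod_space (lev Q n.+1) (grp tau n)) (fun u => (u.2, u.1)).
      by apply: smooth_map_pair; [exact: smooth_map_snd|exact: smooth_map_fst].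
    by have [_] := smooth_map_comp sw sact; apply.
Qed.

End Trivializations.

(** * Group and bundle structure of the universal frame bundles *)

Section UniversalLevels.
Context {R : realType} {tau : struct_type R} (Q : tower tau).
Local Notation E := (Espace tau).
Local Notation A n := (Amb tau (base Q) n).
Local Notation U n := (functional (R := R) (A n)).
Local Notation descend n := (@descend R tau Q n).
Local Notation act n := (@act R tau Q n).
Local Notation unit n := (unit_cls (tau := tau) (n := n)).
Hypothesis reg : regular Q.

Lemma hatS_comp_Hgrp n (z : A n.+1) zeta f : pts (lev Q n.+1) z ->
  hatS_fibre z zeta -> hatS_fibre z (zeta \o f) -> Hgrp f.
Proof.
move=> Pz hz hf; have [a Ha aE] := hatS_torsor reg Pz hz hf.
have [_ iz _] := hatS_iso hz; suff -> : f = a by [].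
by apply/funext => e; apply: iz; exact: (congr1 (fun g => g e) aE).
Qed.

Lemma hat_eval n e : vsmooth (hat_group Q n) (fun a => a e).
Proof.
move=> l hl; pose lM := GRing.isLinear.Build _ _ _ _ _ hl.
pose lL : {linear E n -> R^o} := HB.pack l lM.
by apply: smooth_gen; exists lL, e.
Qed.

Lemma smooth_to_hat_group {S} (Y : space R S) n (a : S -> E n.+1 -> E n.+1) :
  (forall z, pts Y z -> Hgrp (a z)) -> (forall e, vsmooth Y (fun z => a z e)) ->
  smooth_map Y (hat_group Q n.+1) a.
Proof.
move=> Ha sa; apply: smooth_map_gens => [z Yz|g [l [e ->]]].
  exact/(Hgrp_hat_group reg)/Ha.
by apply: (sa e l) => c u v; exact: linearP.
Qed.

Lemma class_smooth n :
  smooth_map (hat_group Q n) (univ_group Q n) (@cls R tau n (E n)).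
Proof. by apply: smooth_map_gens => // a Pa; exists a. Qed.

Section Group.
Variables (n : nat) (z0 : A n.+1) (zeta0 : E n.+1 -> U n.+1).
Hypotheses (Pz0 : pts (lev Q n.+1) z0) (hz0 : hatS_fibre z0 zeta0).

Lemma univ_groupP c : pts (univ_group Q n.+1) c <->
  exists2 a, Hgrp a & c = cls a.
Proof.
split=> [[a Pa <-]|[a Ha ->]].
  by exists a => //; exact: (hat_group_Hgrp reg Pz0 hz0).
by exists a => //; exact: (Hgrp_hat_group reg).
Qed.

Lemma cls_Hgrp2 (B : Type) (f : E n.+1 -> B) (b : E n.+1 -> E n.+1) : Hgrp b ->
  comp_set (cls f) (cls b) = cls (f \o b).
Proof.
move=> Hb; apply: comp_set_cls2; [by case: Hb|exact: Hgrp_bij|].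
by move=> q e; exact: Hgrp_filt.
Qed.

(** The normal form is constant on classes, hence a function on the quotient group; it is linear in
    the matrix, hence smooth. This replaces charts of the universal group. *)
Lemma group_section : exists r : set (E n.+1 -> E n.+1) -> 'End(E n.+1),
  vsmooth (univ_group Q n.+1) r /\
  forall c, pts (univ_group Q n.+1) c -> Hgrp (r c) /\ cls (r c) = c.
Proof.
have [P [lP P1 P2]] := normal_form (tau := tau) n.+1.
have /choice[a Ha] : forall c : set (E n.+1 -> E n.+1), exists a,
    pts (univ_group Q n.+1) c -> Hgrp a /\ c = cls a.
  move=> c; have [/univ_groupP[a Ha aE]|nc] := pselect (pts (univ_group Q n.+1) c).
    by exists a.
  by exists id.
pose r c := P (linfun (a c)); exists r; split.
  move=> l hl; apply: smooth_gen => /=.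
  have : vsmooth (hat_group Q n.+1) (fun b => P (linfun b)).
    apply: vsmooth_linear lP _; apply: vsmooth_hom => e.
    apply: (vsmooth_eq _ (@hat_eval n.+1 e)) => b [[lb _] _].
    by rewrite linfunE.
  move=> /(_ l hl); apply: eq_smooth => b Pb /=; congr l.
  have Hb := hat_group_Hgrp reg Pz0 hz0 Pb.
  have Pc : pts (univ_group Q n.+1) (cls b) by exists b.
  have [Hab abE] := Ha _ Pc; rewrite /r.
  have [u hu ->] : cls b (a (cls b)) by rewrite [X in X _]abE; exact: cls_self.
  apply/esym/P2 => //; first by case: Hb.
  by move=> q e; exact: Hgrp_filt.
move=> c Pc; have [Hc cE] := Ha c Pc.
have [u hu uE] := P1 (a c) (let: And3 l _ _ := Hc in l) (Hgrp_bij Hc)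
  (fun q e => Hgrp_filt (q := q) (e := e) Hc).
rewrite /r uE; split; first by apply: Hgrp_comp => //; exact: unit_cls_Hgrp.
by rewrite cls_comp.
Qed.

Lemma left_translation a : Hgrp a ->
  smooth_map (univ_group Q n.+1) (univ_group Q n.+1) (comp_set (cls a)).
Proof.
move=> Ha; have [la _ _] := Ha.
apply: smooth_map_gens => [c /univ_groupP[b Hb ->]|g gg].
  by rewrite cls_Hgrp2 //; apply/univ_groupP; exists (a \o b) => //; exact: Hgrp_comp.
apply: smooth_gen.
have sa : smooth_map (hat_group Q n.+1) (hat_group Q n.+1) (fun b => a \o b).
  have := @smooth_to_hat_group _ (hat_group Q n.+1) n (fun b => a \o b); apply.
    move=> b Pb; apply: Hgrp_comp => //; exact: (hat_group_Hgrp reg Pz0 hz0).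
  by move=> e; exact: (vsmooth_linear la (@hat_eval n.+1 e)).
have [_ /(_ _ gg)] := sa; apply: eq_smooth => b Pb /=.
by rewrite cls_Hgrp2 //; exact: (hat_group_Hgrp reg Pz0 hz0 Pb).
Qed.

Lemma univ_translation_diffeo c : pts (univ_group Q n.+1) c ->
  diffeomorphism (univ_group Q n.+1) (univ_group Q n.+1) (comp_set c).
Proof.
move=> /univ_groupP[a Ha ->]; have [b ab ba] := Hgrp_bij Ha.
have Hb := Hgrp_inv Ha ab ba.
split; first exact: left_translation.
exists (comp_set (cls b)); split; first exact: left_translation.
- move=> c' /univ_groupP[a' Ha' ->].
  rewrite !cls_Hgrp2 //; last exact: Hgrp_comp.
  by congr cls; apply/funext => e /=; rewrite ab.
- move=> c' /univ_groupP[a' Ha' ->].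
  rewrite !cls_Hgrp2 //; last exact: Hgrp_comp.
  by congr cls; apply/funext => e /=; rewrite ba.
Qed.

Hypothesis HL : lev Q n.+2 = univ_frame Q n.+1.

Lemma selection_Hgrp (O : set (A n.+1)) s (N : A n.+2 -> 'End(E n.+1)) :
  hatS_field O s ->
  (forall z, pts (univ_frame Q n.+1) z -> O z.1 -> z.2 (s z.1 \o N z)) ->
  forall z, pts (lev Q n.+2) z -> O z.1 ->
    Hgrp (N z) /\ z.2 = cls (s z.1 \o N z).
Proof.
move=> [oO hs ss] zN z Pz Oz; have [Pz1 _] := lev_point reg Pz.
have Pz' := Pz; rewrite HL in Pz'.
have [hN cN] := lev_class reg Pz (zN z Pz' Oz); split=> //.
exact: (hatS_comp_Hgrp Pz1 (hs _ Pz1 Oz) hN).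
Qed.

Lemma frame_field_comp {S} (Y : space R S) (O : set (A n.+1)) s (p : S -> A n.+1)
    (v : S -> E n.+1) f : hatS_field O s ->
  smooth_map Y (restrict (lev Q n.+1) O) p -> vsmooth Y v ->
  smooth_fun (lev Q n.+1) f -> smooth_fun Y (fun z => s (p z) (v z) f).
Proof.
move=> [oO hs ss] sp sv sf; have [pP psf] := sp.
apply: (@frame_apply _ _ _ (lev Q n.+1) Y _ (fun z => s (p z))) => //.
  by move=> z /pP[Pz Oz]; have [] := hatS_iso (hs _ Pz Oz).
by move=> e; exact: (psf _ (ss e f sf)).
Qed.

(** Relative to the frame field [s], the representative selected in the class of [z] has
    coefficients [N z] in [Hgrp], so the inverse sends [z] to [z.1] and the class of [N z]. *)
Lemma univ_triv (O : set (A n.+1)) s : hatS_field O s ->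
  diffeomorphism (prod_space (restrict (lev Q n.+1) O) (univ_group Q n.+1))
    (restrict (lev Q n.+2) (descend n.+1 @^-1` O))
    (fun u => act n.+1 (u.1, cls (s u.1)) u.2).
Proof.
move=> hsf; have [oO hs ss] := hsf; have [r [sr rP]] := group_section.
have [N [zN sN]] := class_selection reg (hatS_field_frame reg hsf).
have NP := selection_Hgrp hsf zN; have [sd _ _] := reg.
pose Y := prod_space (restrict (lev Q n.+1) O) (univ_group Q n.+1).
have actE u : pts Y u ->
    act n.+1 (u.1, cls (s u.1)) u.2 = uproj (u.1, s u.1 \o r u.2).
  move=> [_ Gc]; have [Hr {1}<-] := rP _ Gc.
  by rewrite /Defs.act /uproj /= cls_Hgrp2.
have sfstO : smooth_map Y (restrict (lev Q n.+1) O) fst by exact: smooth_map_fst.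
split.
  apply: smooth_map_restrict; last by move=> u [[_ Ou] _].
  apply: (eq_smooth_map (f := fun u => uproj (u.1, s u.1 \o r u.2))).
    by move=> u Yu; rewrite -actE.
  rewrite HL; apply: (smooth_map_comp (Y := hatS Q n.+1) _ (@uproj_smooth _ _ Q n.+1)).
  apply: smooth_to_hatS.
  - exact: (smooth_map_comp sfstO (@smooth_map_incl _ _ _ _)).
  - move=> u [[Pu Ou] Gc]; have [Hr _] := rP _ Gc.
    by apply: (hatS_Hgrp reg Pu) => //; exact: hs.
  - move=> e f sf; apply: (frame_field_comp hsf sfstO _ sf (v := fun u => r u.2 e)).
    apply: hom_apply; last exact: vsmooth_cst.
    exact: (vsmooth_comp (@smooth_map_snd _ _ _ _ _) sr).
exists (fun z => (z.1, cls (N z))); split.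
- apply: smooth_map_pair; first exact: smooth_map_restrict2.
  have : smooth_map (restrict (lev Q n.+2) (descend n.+1 @^-1` O)) (hat_group Q n.+1)
      (fun z => N z).
    apply: smooth_to_hat_group => [z [Pz Oz]|e]; first by have [] := NP z Pz Oz.
    by rewrite HL; apply: hom_apply => //; exact: vsmooth_cst.
  by move=> h; exact: (smooth_map_comp h (@class_smooth n.+1)).
- move=> [y c] Yu; rewrite actE //; have [[Py Oy] Gc] := Yu; rewrite /= in Py Oy Gc *.
  have [Hr {2}<-] := rP _ Gc; congr pair.
  have Pz : pts (univ_frame Q n.+1) (uproj (y, s y \o r c)).
    by exists (y, s y \o r c) => //; split=> //; apply: (hatS_Hgrp reg Py) => //; exact: hs.
  have /= := zN _ Pz Oy; move=> [u hu uE].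
  have -> : (N (uproj (y, s y \o r c)) : E n.+1 -> E n.+1) = r c \o u.
    have [_ is_ _] := hatS_iso (hs y Py Oy).
    by apply/funext => e; apply: is_; exact: (congr1 (fun g => g e) uE).
  by first [exact: (cls_comp _ hu) | rewrite (cls_comp _ hu) | rewrite cls_comp].
- move=> z [Pz Oz] /=; have [HN zE] := NP z Pz Oz.
  by rewrite /Defs.act /= cls_Hgrp2 // -zE; case: z {Pz Oz HN zE}.
Qed.

(** Locally [z] is the class of [s z.1 \o N z] and [c] the class of [r c]; the product is the class
    of [s z.1 \o (N z \o r c)], whose coefficients are smooth. *)
Lemma univ_act_smooth :
  (forall x, pts (lev Q n.+1) x -> exists O s, O x /\ hatS_field O s) ->
  smooth_map (prod_space (lev Q n.+2) (univ_group Q n.+1)) (lev Q n.+2)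
    (fun u => act n.+1 u.1 u.2).
Proof.
move=> cover; have [r [sr rP]] := group_section; have [sd _ _] := reg.
apply: smooth_map_of_local => -[z1 c1] [Pz1 Gc1]; rewrite /= in Pz1 Gc1.
have [Px _] := lev_point reg Pz1.
have [W [s [Wx hsf]]] := cover _ Px; have [oO hs ss] := hsf.
have [N [zN sN]] := class_selection reg (hatS_field_frame reg hsf).
have NP := selection_Hgrp hsf zN.
pose Y := prod_space (lev Q n.+2) (univ_group Q n.+1).
have s1 : smooth_map Y (lev Q n.+1) (fun u => u.1.1).
  exact: (smooth_map_comp (@smooth_map_fst _ _ _ _ _) (sd n.+1)).
pose Om := (fun u : A n.+2 * set (E n.+1 -> E n.+1) => u.1.1) @^-1` W.
exists Om; split=> //; first exact: (open_preimage s1 oO).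
have sO : smooth_map (restrict Y Om) (restrict (lev Q n.+1) W) (fun u => u.1.1).
  exact: smooth_map_restrict2.
have sN' : vsmooth (restrict Y Om) (fun u => N u.1).
  have sf : smooth_map (restrict Y Om) (restrict (univ_frame Q n.+1) (descend n.+1 @^-1` W)) fst.
    by rewrite -HL; apply: smooth_map_restrict2 => //; exact: smooth_map_fst.
  exact: (vsmooth_comp sf sN).
have sr' : vsmooth (restrict Y Om) (fun u => r u.2).
  apply: (vsmooth_comp _ sr).
  exact: (smooth_map_comp (@smooth_map_incl _ _ Y Om) (@smooth_map_snd _ _ _ _ _)).
apply: (eq_smooth_map (f := fun u => uproj (u.1.1, s u.1.1 \o (N u.1 \o r u.2)))).
  move=> [z c] [[Pz Gc] Oz]; rewrite /= in Pz Gc Oz *.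
  have [Hr rE] := rP _ Gc; have [HN zE] := NP z Pz Oz.
  by rewrite /Defs.act /uproj /= -{2}rE zE cls_Hgrp2.
have sp : smooth_map (hatS Q n.+1) (lev Q n.+2) (@uproj _ _ Q n.+1).
  by rewrite HL; exact: uproj_smooth.
apply: (smooth_map_comp _ sp); apply: smooth_to_hatS.
- exact: (smooth_map_comp sO (@smooth_map_incl _ _ _ _)).
- move=> u [[Pz Gc] Oz]; have [Pz1' _] := lev_point reg Pz.
  have [Hr rE] := rP _ Gc; have [HN zE] := NP _ Pz Oz.
  apply: (hatS_Hgrp reg Pz1'); first exact: hs.
  exact: Hgrp_comp.
- move=> e f sf.
  apply: (frame_field_comp hsf sO _ sf (v := fun u => N u.1 (r u.2 e))).
  by apply: hom_apply => //; apply: hom_apply => //; exact: vsmooth_cst.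
Qed.

Hypothesis HG : grp tau n.+1 = univ_group Q n.+1.

Lemma univ_good_group :
  (forall x, pts (lev Q n.+1) x -> exists O s, O x /\ hatS_field O s) ->
  good_group Q n.+1.
Proof.
move=> cover; rewrite /good_group HG; split.
- exact: univ_act_smooth.
- apply/univ_groupP; exists id.
    exact: (unit_cls_Hgrp (unit_cls_id n.+1)).
  apply/seteqP; split=> [a ha|_ [a ha ->] //]; by exists a.
- by move=> c /univ_groupP[a Ha ->]; rewrite comp_set_cls.
- by move=> c; exact: univ_translation_diffeo.
Qed.

Lemma univ_trivP (O : set (A n.+1)) s : hatS_field O s ->
  triv (n := n.+1) O (fun y => (y, cls (s y))).
Proof.
move=> hsf; have [oO _ _] := hsf; split=> //.
by rewrite HG; exact: univ_triv.
Qed.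

End Group.
End UniversalLevels.

(** * Existence of local frame fields at every level *)

Section Geometric.
Context {R : realType} {tau : struct_type R}.
Local Notation E := (Espace tau).
Local Notation unit n := (unit_cls (tau := tau) (n := n)).
Local Notation depth := (ndepth (gneg tau)).

Lemma section_through {T} (X : space R T) B x v : is_subbundle X B ->
  pts X x -> B x v -> exists2 W, section_of X B W & W x = v.
Proof.
move=> sB Xx Bv; have [BT B0 Bl [r [V [U [oU Ux sV uV]]]]] := sB x Xx.
have [c [vE _]] := uV x Xx Ux v Bv.
pose W y : functional (R := R) T := \sum_j c ord0 j *: V j y.
exists W; last by rewrite vE.
have BW y : pts X y -> B y (W y).
  move=> Xy; have [_ B0y Bly _] := sB y Xy; rewrite /W.
  elim/big_ind: _ => [//|u w hu hw|j _]; first by rewrite -[u]scale1r; exact: Bly.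
  have [_ hV] := sV j; rewrite -[_ *: _]addr0; apply: Bly => //; exact: hV.
split=> // y Xy; split.
  by have [BTy _ _ _] := sB y Xy; apply: BTy; exact: BW.
move=> h sh; apply: (@eq_smooth _ _ X (fun y => \sum_j c ord0 j * V j y h)).
  by move=> z _; rewrite /W functional_sumE.
apply: smooth_sum => j; apply: smooth_mul; first exact: smooth_cst.
by have [vV _] := sV j; have [y0 | ny] := pselect (exists y, pts X y);
  [case: y0 => y0 Xy0; have [_] := vV y0 Xy0; exact|
   move=> z Xz; elim: ny; exists z].
Qed.

Section OneTower.
Variable Q : tower tau.
Local Notation A n := (Amb tau (base Q) n).
Local Notation U n := (functional (R := R) (A n)).
Local Notation descend n := (@descend R tau Q n).
Local Notation act n := (@act R tau Q n).

Section Base.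
Hypothesis gr0 : forall x, pts (lev Q 0) x -> exists gamma, gr_iso (Q := Q) x gamma.

(** The images under [gamma] of bases of the graded components extend to sections of the
    corresponding [F^p], which define [t]. Independence persists where the determinant against
    functions dual at [x0] is nonzero. *)
Lemma base_frame (x0 : A 0) : pts (lev Q 0) x0 ->
  exists O t, O x0 /\ frame_field (n := 0) O t.
Proof.
move=> Px0; have [gamma gx] := gr0 Px0.
have giso := gr_iso_iso Px0 gx; have [lg ig rg] := giso.
pose B (i : 'I_depth) := ncomp (gneg tau) (- i.+1%:Z).
have defV : fullv = (\sum_(i < depth) B i)%VS by rewrite ncomp_full.
pose p i := sumv_pi_for defV i.
have pB i e : p i e \in B i by exact: memv_sum_pi.
have psum e : \sum_i p i e = e by apply: sumv_pi_sum; exact: memvf.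
have /choice[W HW] : forall ij : 'I_depth * nat, exists W,
    section_of (lev Q 0) (bfilt Q (- ij.1.+1%:Z)) W /\
    W x0 = gamma (vbasis (B ij.1))`_ij.2.
  move=> [i j] /=.
  have Fg : bfilt Q (- i.+1%:Z) x0 (gamma (vbasis (B i))`_j).
    have [_ h _ _ _] := gx; apply: h; rewrite -/(B i).
    have [jl|jl] := ltnP j (size (vbasis (B i))).
      by apply: vbasis_mem; exact: mem_nth.
    by rewrite nth_default // mem0v.
  by have [W sW WE] := section_through (filt_subbundle (bfilt Q) _) Px0 Fg; exists W.
pose t y (e : E 0) : U 0 := \sum_i \sum_(j < \dim (B i))
  coord (vbasis (B i)) j (p i e) *: W (i, val j) y.
have lt y : linear (t y).
  move=> c u v; rewrite /t scaler_sumr -big_split; apply: eq_bigr => i _ /=.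
  rewrite scaler_sumr -big_split; apply: eq_bigr => j _ /=.
  by rewrite !linearP scalerDl scalerA.
have sW (i : 'I_depth) (j : nat) : section_of (lev Q 0) (bfilt Q (- i.+1%:Z)) (W (i, j)).
  by have [] := HW (i, j).
have Ft y q e : pts (lev Q 0) y -> Efilt (n := 0) q e -> bfilt Q q y (t y e).
  move=> Py /= /memv_sumP[v hv eE].
  have [_ F0 _ _] := filt_subbundle (bfilt Q) q Py.
  (* Uniqueness of the graded decomposition: an element of filtration degree [q] has no components
     below [q]. *)
  have pv i : p i e = if q <= - i.+1%:Z then v i else 0.
    have dB : directv (\sum_(i < depth) B i) := ncomp_direct (gneg tau).
    have := (directv_sum_unique dB) (fun i => p i e)
      (fun i => if q <= - i.+1%:Z then v i else 0) (fun i _ => pB i e).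
    rewrite psum -big_mkcond /= -eE eqxx => h.
    have hB (j : 'I_depth) : true -> (if q <= - j.+1%:Z then v j else 0) \in B j.
      by move=> _; case: ifP => qj; [exact: hv|exact: mem0v].
    by move: (h hB) => /esym/forallP/(_ i)/eqP.
  rewrite /t; elim/big_ind: _ => [//|u w hu hw|i _]; first exact: filtD.
  rewrite pv; case: ifP => qi; last first.
    by rewrite big1 // => j _; rewrite linear0 scale0r.
  elim/big_ind: _ => [//|u w hu hw|j _]; first exact: filtD.
  rewrite -[_ *: _]addr0; apply: filt_lin => //.
  apply: (filt_decr_nat Py qi); have [_ h] := sW i j; exact: h.
have tx0 : t x0 = gamma.
  apply/funext => e; rewrite -{2}(psum e) linear_fun_sum //.
  apply: eq_bigr => i _; rewrite {2}(coord_vbasis (pB i e)) linear_fun_sum //.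
  apply: eq_bigr => j _; rewrite linear_funZ //.
  by have [_ ->] := HW (i, val j).
have st e f : smooth_fun (lev Q 0) f -> smooth_fun (lev Q 0) (fun y => t y e f).
  move=> sf; apply: (@eq_smooth _ _ _ (fun y => \sum_i \sum_(j < \dim (B i))
     coord (vbasis (B i)) j (p i e) * W (i, val j) y f)).
    move=> y _; rewrite /t functional_sumE; apply: eq_bigr => i _.
    by rewrite functional_sumE.
  apply: smooth_sum => i; apply: smooth_sum => j.
  apply: smooth_mul; first exact: smooth_cst.
  by have [vW _] := sW i j; have [_] := vW x0 Px0; exact.
have [f [sf fE]] := dual_functions giso.
pose M y : 'M[R]_(\dim {: E 0}) := \matrix_(i, j) t y (vb i) (f j).
have sM i j : smooth_fun (lev Q 0) (fun y => M y i j).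
  by apply: eq_smooth (st (vb i) _ (sf j)) => y _; rewrite mxE.
have sdet := smooth_det sM.
exists [set y | \det (M y) != 0], t; split.
  rewrite /= (_ : M x0 = 1%:M) ?det1 ?oner_eq0 //.
  by apply/matrixP => i j; rewrite !mxE tx0 fE.
split.
- move=> y Py /= dy; have dy0 : 0 < `|\det (M y)| by rewrite normr_gt0.
  have := smooth_continuous sdet Py dy0; apply: nbhS => z _ /=.
  by apply: contraTneq => ->; rewrite sub0r normrN ltxx.
- move=> y Py /= dy; have [gy ggy] := gr0 Py; have iy := gr_iso_iso Py ggy.
  have [lgy igy _] := iy.
  have it : injective (t y).
    apply: linear_inj => // e te0.
    have uM : M y \in unitmx by rewrite unitmxE unitfE.
    pose r : 'rV[R]_(\dim {: E 0}) := \row_i vc i e.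
    have r0 : r = 0.
      rewrite -[r](mulmxK uM) (_ : r *m M y = 0) ?mul0mx //.
      apply/rowP => j; rewrite !mxE.
      transitivity (t y e (f j)); last by rewrite te0.
      rewrite [in RHS](vcE e) linear_fun_sum // functional_sumE.
      by apply: eq_bigr => i _; rewrite linear_funZ // !mxE.
    rewrite (vcE e) big1 // => i _.
    by have := congr1 (fun w : 'rV_ _ => w ord0 i) r0; rewrite !mxE => ->; rewrite scale0r.
  have Tt e : tangent (lev Q 0) y (t y e).
    have [h _ _ _] := filt_subbundle (bfilt Q) (- depth%:Z) Py.
    by apply: h; apply: Ft => //; exact: Efilt_full.
  have /choice[m mE] : forall e, exists e', gy e' = t y e.
    by move=> e; exact: (linear_iso_onto iy).
  have lm : linear m by move=> c u v; apply: igy; rewrite mE lt lgy !mE.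
  have im : injective m by move=> u v uv; apply: it; rewrite -!mE uv.
  (* Strictness at [y] comes by comparison with some isomorphism [gy] of graded Lie algebras there:
     [m] is injective and filtered on a finite-dimensional space, hence reflects the filtration. *)
  have fm q e : Efilt (n := 0) q e -> Efilt (n := 0) q (m e).
    move=> he; have := Ft y q e Py he; rewrite -mE => /(gr_iso_onto Py ggy).
    by move=> [e' he' /igy ->].
  have tE : t y = gy \o m by apply/funext => e; rewrite /= mE.
  split.
    by rewrite tE; apply: linear_iso_comp => //; exact: linear_inj_bij.
  move=> q e; split; last exact: Ft.
  rewrite /= -mE => /(gr_iso_onto Py ggy)[e' he' /igy E1].
  by apply: (filt_reflect lm im fm); rewrite E1.
- by move=> e g sg; apply: smooth_restrict; exact: st.
Qed.

End Base.

Variable k : nat.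
Hypotheses (wf : wf_type tau k) (geo : is_geometric_structure Q k).

Lemma geom_regular : regular Q.
Proof.
have [_ _ g1 g2] := geo; split=> [n|n|]; last by case: wf.
- have [nk|nk] := leqP n k; first by have [[]] := g1 n nk.
  by have [-> _] := g2 n nk; exact: univ_frame_descend.
- have [nk|nk] := leqP n k; first by have [_ _] := g1 n nk.
  by have [-> _] := g2 n nk.
Qed.

Let reg := geom_regular.

Lemma low_good_group n : (n <= k)%N -> good_group Q n.
Proof.
move=> nk; have [_ _ g1 _] := geo; have [pb sG _] := g1 n nk.
have [_ _ sa _] := pb; have [lg _] := wf; have [_ Gu sm [inv si invE]] := lg n nk.
have cu c : pts (grp tau n) c -> comp_set c (unit n) = c.
  by have [h _] := sG => /h [a _ <-]; exact: comp_set_cls.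
have uc c : pts (grp tau n) c -> comp_set (unit n) c = c.
  move=> Gc; have [i1 i2] := invE c Gc.
  by rewrite -{1}i1 comp_setA i2 cu.
have sl c : pts (grp tau n) c -> smooth_map (grp tau n) (grp tau n) (comp_set c).
  move=> Gc; have sp : smooth_map (grp tau n) (prod_space (grp tau n) (grp tau n))
      (fun c' => (c, c')).
    by apply: smooth_map_pair => //; exact: smooth_map_cst.
  exact: (smooth_map_comp sp sm).
split=> // c Gc; split; first exact: sl.
have [iP _] := si; have [i1 i2] := invE c Gc.
exists (comp_set (inv c)); split; first exact/sl/iP.
- by move=> c' Gc'; rewrite -comp_setA i2 uc.
- by move=> c' Gc'; rewrite -comp_setA i1 uc.
Qed.

Lemma low_triv n x : (n <= k)%N -> pts (lev Q n) x ->
  exists O s, O x /\ triv (n := n) O s.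
Proof.
move=> nk Px; have [_ _ g1 _] := geo; have [[_ _ _ h] _ _] := g1 n nk.
have [W [s [oW Wx sW dW]]] := h x Px.
by exists W, s.
Qed.

(** Up to order [k] the trivialisations are given, with domains to be intersected with those of the
    frames. Above, the trivialisations and the smooth action are themselves produced from the frame
    fields of the level below, available by induction. *)
Lemma hatS_cover n x : pts (lev Q n.+1) x ->
  exists O s, O x /\ hatS_field (Q := Q) (n := n.+1) O s.
Proof.
have low m z : (m <= k)%N -> pts (lev Q m.+1) z ->
    (exists O t, O z.1 /\ frame_field (Q := Q) (n := m) O t) ->
    exists O s, O z /\ hatS_field (Q := Q) (n := m.+1) O s.
  move=> mk Pz [W [t [Wz ft]]]; have [Pz1 _] := lev_point reg Pz.
  have [W' [s [Wz' ts]]] := low_triv mk Pz1.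
  have [oW ft' st] := ft; have [oW' _ _] := ts.
  have ts' := triv_restrict ts oW.
  have ft2 : frame_field (Q := Q) (W' `&` W) t.
    split; first exact: open_inI.
      by move=> y Py [_ Wy]; exact: ft'.
    move=> e f sf; have [_] := smooth_map_restrict_incl (lev Q m)
      (O := W) (O' := W' `&` W) (fun y h => h.2).
    by move=> /(_ _ (st e f sf)).
  have [xi hxi] := frame_step reg (low_good_group mk) ts' ft2.
  by exists (descend m @^-1` (W' `&` W)), xi.
elim: n x => [|n IH] z Pz.
  apply: low => //; have [_ gr0 _ _] := geo; have [Pz1 _] := lev_point reg Pz.
  exact: base_frame.
have [Pz1 _] := lev_point reg Pz; have [W [s [Wz hs]]] := IH _ Pz1.
have fs := hatS_field_frame reg hs.
have [nk|nk] := leqP n.+1 k; first by apply: low => //; exists W, s.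
have [_ _ _ g2] := geo; have [HL HG] := g2 n.+1 nk; have [_ hs' _] := hs.
have gg := univ_good_group reg Pz1 (hs' _ Pz1 Wz) HL HG IH.
have tr := univ_trivP reg Pz1 (hs' _ Pz1 Wz) HL HG hs.
have [xi hxi] := frame_step reg gg tr fs.
by exists (descend n.+1 @^-1` W), xi.
Qed.

Lemma frame_cover n x : pts (lev Q n) x ->
  exists O t, O x /\ frame_field (Q := Q) (n := n) O t.
Proof.
case: n x => [|n] x Px.
  by have [_ gr0 _ _] := geo; exact: base_frame.
have [W [s [Wx hs]]] := hatS_cover Px.
by exists W, s; split=> //; exact: hatS_field_frame.
Qed.

Lemma geom_good_group n x : pts (lev Q n) x -> good_group Q n.
Proof.
have [nk|nk] := leqP n k; first by move=> _; exact: low_good_group.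
case: n nk x => [//|n] nk x Px.
have [W [s [Wx hs]]] := hatS_cover Px; have [_ hs' _] := hs.
have [_ _ _ g2] := geo; have [HL HG] := g2 n.+1 nk.
by apply: (univ_good_group reg Px (hs' _ Px Wx) HL HG) => y Py; exact: hatS_cover.
Qed.

Lemma geom_triv n x : pts (lev Q n) x -> exists O s, O x /\ triv (Q := Q) (n := n) O s.
Proof.
have [nk|nk] := leqP n k; first exact: low_triv.
case: n nk x => [//|n] nk x Px.
have [W [s [Wx hs]]] := hatS_cover Px; have [_ hs' _] := hs.
have [_ _ _ g2] := geo; have [HL HG] := g2 n.+1 nk.
by exists W, (fun y => (y, cls (s y))); split=> //;
  exact: (univ_trivP reg Px (hs' _ Px Wx) HL HG hs).
Qed.

Lemma local_section n x : pts (lev Q n) x -> exists O s,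
  [/\ open_in (lev Q n) O, O x, forall y, pts (lev Q n) y -> O y -> (s y).1 = y &
      smooth_map (restrict (lev Q n) O) (lev Q n.+1) s].
Proof.
move=> Px; have [W [s [Wx [oW sW [sf _]]]]] := geom_triv Px.
have [_ Gu _ _] := geom_good_group Px.
exists W, (fun y => act n (s y) (unit n)); split=> //.
have sp : smooth_map (restrict (lev Q n) W) (prod_space (restrict (lev Q n) W) (grp tau n))
    (fun y => (y, unit n)).
  by apply: smooth_map_pair => //; exact: smooth_map_cst.
exact: (smooth_map_comp (smooth_map_comp sp sf) (@smooth_map_incl _ _ _ _)).
Qed.

Lemma descend_onto n x : pts (lev Q n) x ->
  exists2 z, pts (lev Q n.+1) z & z.1 = x.
Proof.
move=> Px; have [W [s [_ Wx sW [sP _]]]] := local_section Px.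
by exists (s x); [exact: sP|exact: sW].
Qed.

(** The new field lives over the full preimage of [O]. As nothing shrinks, the step can be repeated
    infinitely often over one neighbourhood. *)
Lemma univ_extend n O s : (k < n.+1)%N -> hatS_field (Q := Q) (n := n.+1) O s ->
  (exists2 x, pts (lev Q n.+1) x & O x) ->
  exists s', hatS_field (Q := Q) (n := n.+2) (descend n.+1 @^-1` O) s'.
Proof.
move=> nk hs [x Px Ox]; have [_ hs' _] := hs.
have [_ _ _ g2] := geo; have [HL HG] := g2 n.+1 nk.
have tr := univ_trivP reg Px (hs' _ Px Ox) HL HG hs.
exact: (frame_step reg (geom_good_group Px) tr (hatS_field_frame reg hs)).
Qed.

End OneTower.
End Geometric.

(** * Lifting isomorphisms *)

Section Morphisms.
Context {R : realType} {tau : struct_type R}.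
Local Notation E := (Espace tau).

Lemma diffeo_ext {T T'} (X : space R T) (Y : space R T') f f' :
  (forall x, pts X x -> f x = f' x) -> diffeomorphism X Y f ->
  diffeomorphism X Y f'.
Proof.
move=> ff' [sf [g [sg gf fg]]]; split; first exact: eq_smooth_map sf.
exists g; split=> // [x Xx|y Yy]; first by rewrite -ff' // gf.
by rewrite -ff' ?fg //; have [gP _] := sg; exact: gP.
Qed.

Lemma diffeo_linear_iso (E0 : lmodType R) {T T'} (X : space R T)
    (Y : space R T') f x (zeta : E0 -> functional T) :
  diffeomorphism X Y f -> pts X x -> linear_iso X x zeta ->
  linear_iso Y (f x) (push Y f \o zeta).
Proof.
move=> df Xx hz; have [lz iz rz] := hz; have [sf _] := df.
have Tz e : tangent X x (zeta e) by exact: linear_iso_tangent.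
split; first by apply: linear_comp => //; exact: push_linear.
  by move=> u v /(diffeo_push_inj df (Tz u) (Tz v)); exact: iz.
apply/seteqP; split=> [D [e _ <-]|D TD]; first exact: (push_tangent sf (Tz e)).
have [D' TD' <-] := diffeo_push_onto df Xx TD.
by have [e <-] := linear_iso_onto hz TD'; exists e.
Qed.

Section OneDirection.
Variables P Q : tower tau.
Local Notation AP n := (Amb tau (base P) n).
Local Notation AQ n := (Amb tau (base Q) n).
Local Notation dP n := (@descend R tau P n).
Local Notation dQ n := (@descend R tau Q n).
Hypotheses (rP : regular P) (rQ : regular Q).
Hypothesis gP : forall n x, pts (lev P n) x -> good_group P n.

Definition frame_map n (phi : AP n -> AQ n) : Prop :=
  forall z zeta, pts (lev P n) z -> hatS_fibre z zeta ->
    hatS_fibre (phi z) (push (lev Q n) phi \o zeta).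

Lemma clift_act n (psi : AP n -> AQ n) z c :
  clift psi (act z c) = act (clift psi z) c.
Proof.
congr pair; apply/seteqP; split=> h /=.
  by move=> [_ [a ha [b hb ->]] ->]; exists (push (lev Q n) psi \o a); [exists a|exists b].
move=> [_ [a ha ->] [b hb ->]]; exists (a \o b) => //.
by exists a => //; exists b.
Qed.

Lemma clift_uproj n (psi : AP n -> AQ n) u :
  clift psi (uproj u) = uproj (psi u.1, push (lev Q n) psi \o u.2).
Proof.
congr pair; apply/seteqP; split=> h /=.
  by move=> [_ [a ha ->] ->]; exists a.
by move=> [a ha ->]; exists (u.2 \o a) => //; exists a.
Qed.

Lemma push_descend n (phi : AP n.+1 -> AQ n.+1) (psi : AP n -> AQ n) z D :
  smooth_map (lev P n.+1) (lev Q n.+1) phi ->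
  smooth_map (lev P n) (lev Q n) psi ->
  (forall w, pts (lev P n.+1) w -> (phi w).1 = psi w.1) ->
  tangent (lev P n.+1) z D ->
  push (lev Q n) (dQ n) (push (lev Q n.+1) phi D) =
  push (lev Q n) psi (push (lev P n) (dP n) D).
Proof.
move=> sphi spsi E1 TD; have [sdQ _ _] := rQ.
rewrite push_comp // push_comp //; apply: (push_ext _ TD) => w Pw.
exact: E1.
Qed.

(** The bracket condition of [gr_iso] on the target quantifies over sections of the target; it is
    checked by pulling them back to the source. *)
Lemma section_pull (phi : AP 0 -> AQ 0) psi p V :
  smooth_map (lev P 0) (lev Q 0) phi -> smooth_map (lev Q 0) (lev P 0) psi ->
  (forall x, pts (lev P 0) x -> psi (phi x) = x) ->
  (forall p x, pts (lev P 0) x -> push (lev Q 0) phi @` bfilt P p x = bfilt Q p (phi x)) ->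
  section_of (lev Q 0) (bfilt Q p) V ->
  section_of (lev P 0) (bfilt P p) (fun x => push (lev P 0) psi (V (phi x))).
Proof.
move=> sphi spsi psiK Fphi [vV BV]; have [phiP sphi'] := sphi.
split=> [x Px|x Px].
  have [TV _] := vV _ (phiP x Px); split.
    by have := push_tangent spsi TV; rewrite psiK.
  move=> h sh.
  apply: (@eq_smooth _ _ _ ((fun z => V z (h \o psi)) \o phi)).
    by move=> y Py; rewrite /= pushE.
  apply: sphi'; have [_] := vV _ (phiP x Px); apply.
  by have [_] := spsi; apply.
have : bfilt Q p (phi x) (V (phi x)) by apply: BV; exact: phiP.
rewrite -Fphi // => -[v Fv <-]; rewrite push_comp //.
have [h _ _ _] := filt_subbundle (bfilt P) p Px; have TV := h _ Fv.
by rewrite (push_ext _ TV psiK) (push_id TV).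
Qed.

Lemma lie_push (phi : AP 0 -> AQ 0) psi p q V W x :
  smooth_map (lev P 0) (lev Q 0) phi -> smooth_map (lev Q 0) (lev P 0) psi ->
  (forall x, pts (lev P 0) x -> psi (phi x) = x) ->
  (forall y, pts (lev Q 0) y -> phi (psi y) = y) ->
  section_of (lev Q 0) (bfilt Q p) V -> section_of (lev Q 0) (bfilt Q q) W ->
  pts (lev P 0) x ->
  push (lev Q 0) phi (lie_bracket (fun x => push (lev P 0) psi (V (phi x)))
    (fun x => push (lev P 0) psi (W (phi x))) x) = lie_bracket V W (phi x).
Proof.
move=> sphi spsi psiK phiK [vV _] [vW _] Px; have [phiP sphi'] := sphi.
have [psiP spsi'] := spsi.
have half V' W' h : vector_field (lev Q 0) V' -> vector_field (lev Q 0) W' ->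
    smooth_fun (lev Q 0) h ->
    push (lev P 0) psi (V' (phi x)) (fun y => push (lev P 0) psi (W' (phi y)) (h \o phi)) =
    V' (phi x) (fun y => W' y h).
  move=> vV' vW' sh; have [TV _] := vV' _ (phiP x Px).
  have Wh z : pts (lev Q 0) z -> push (lev P 0) psi (W' z) (h \o phi) = W' z h.
    move=> Pz; have [TW _] := vW' z Pz; rewrite pushE; last exact: sphi'.
    by apply: (tangent_ext TW) => y Py /=; rewrite phiK.
  rewrite pushE; last first.
    apply: (@eq_smooth _ _ _ ((fun z => W' z h) \o phi)).
      by move=> y Py; rewrite /= Wh //; exact: phiP.
    by apply: sphi'; have [_] := vW' _ (phiP x Px); apply.
  by apply: (tangent_ext TV) => y Py /=; rewrite phiK // Wh.
apply/funext => h; have [sh|nsh] := pselect (smooth_fun (lev Q 0) h).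
  by rewrite pushE // /lie_bracket !half.
(* For a function [h] that is not smooth, [push] gives 0 and the bracket must too: [W' y h] vanishes
   at every point, and [V'] kills a function that is 0 on the points. *)
have zero V' W' : vector_field (lev Q 0) V' -> vector_field (lev Q 0) W' ->
    V' (phi x) (fun y => W' y h) = 0.
  move=> vV' vW'; have [TV _] := vV' _ (phiP x Px).
  rewrite -(tangent_cst 0 TV); apply: (tangent_ext TV) => y Py.
  by have [[_ W0 _] _] := vW' y Py; rewrite W0.
by rewrite {1}/push asboolF // /lie_bracket !zero // subrr.
Qed.

Lemma iso_frame_map0 (phi : AP 0 -> AQ 0) :
  is_isomorphism (n := 0) phi -> frame_map phi.
Proof.
move=> [dphi Fphi] x zeta Px [[hz fz] gz].
have [sphi [psi [spsi psiK phiK]]] := dphi.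
have Timg p v : bfilt P p x v -> bfilt Q p (phi x) (push (lev Q 0) phi v).
  by move=> Fv; rewrite -Fphi //; exists v.
have TF p v : bfilt P p x v -> tangent (lev P 0) x v.
  by have [h _ _ _] := filt_subbundle (bfilt P) p Px; exact: h.
have Tz e : tangent (lev P 0) x (zeta e) by exact: linear_iso_tangent.
have pl := @push_linear R _ _ (lev Q 0) phi.
have [lz g2 g3 g4 g5] := gz.
have pinj v w : tangent (lev P 0) x v -> tangent (lev P 0) x w ->
  push (lev Q 0) phi v = push (lev Q 0) phi w -> v = w.
  exact: (diffeo_push_inj dphi).
split.
  split; first exact: (diffeo_linear_iso dphi Px hz).
  by move=> p e he; apply: Timg; exact: fz.
split.
- exact: linear_comp.
- by move=> p a ap; apply: Timg; exact: g2.
- move=> p v; rewrite -Fphi // => -[w Fw <-].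
  have [a ap Fa] := g3 p w Fw; exists a => //=.
  by rewrite -linear_funB //; exact: Timg.
- move=> p a ap /=; rewrite -Fphi // => -[w Fw /pinj wE].
  apply: (g4 p) => //; rewrite -wE //; exact: TF Fw.
- move=> p q a b V W ap bq sV sW hV hW.
  have sV' := section_pull sphi spsi psiK Fphi sV.
  have sW' := section_pull sphi spsi psiK Fphi sW.
  have pull r (c : gneg tau) V' :
      bfilt Q (r + 1) (phi x) (V' (phi x) - push (lev Q 0) phi (zeta c)) ->
      bfilt P (r + 1) x (push (lev P 0) psi (V' (phi x)) - zeta c).
    rewrite -Fphi // => -[w Fw wE].
    have -> : V' (phi x) = push (lev Q 0) phi (zeta c + w).
      by rewrite linear_funD // wE addrC subrK.
    have Tw : tangent (lev P 0) x (zeta c + w).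
      by rewrite -[zeta c]scale1r; apply: tangent_lin => //; exact: TF Fw.
    by rewrite push_comp // (push_ext _ Tw psiK) (push_id Tw) addrAC subrr add0r.
  have := g5 p q a b _ _ ap bq sV' sW' (pull p a V hV) (pull q b W hW).
  move=> /Timg; rewrite linear_funB //.
  by rewrite (lie_push sphi spsi psiK phiK sV sW Px).
Qed.

Lemma iso_diffeo n (phi : AP n -> AQ n) : is_isomorphism phi ->
  diffeomorphism (lev P n) (lev Q n) phi.
Proof. by case: n phi => [|n] phi []. Qed.

Lemma iso_Tfilt n (phi : AP n -> AQ n) p z D : is_isomorphism phi ->
  pts (lev P n) z -> Tfilt p z D -> Tfilt p (phi z) (push (lev Q n) phi D).
Proof.
elim: n phi z D => [|n IH] phi z D.
  by move=> [_ Fphi] Pz FD; rewrite /= -Fphi //; exists D.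
move=> [[sphi _] [psi [ipsi _ phiE]]] Pz [TD FD].
have [Pz1 _] := lev_point rP Pz.
have [spsi _] := iso_diffeo ipsi.
have E1 w : pts (lev P n.+1) w -> (phi w).1 = psi w.1 by move=> /phiE ->.
split; first exact: (push_tangent sphi TD).
move: FD; case: ifP => pn FD; last by rewrite FD push0.
rewrite (push_descend sphi spsi E1 TD) E1 //.
exact: IH.
Qed.

(** Lifts compose with frames on the left while the groups act on the right, so an isomorphism
    commutes with the action and carries fundamental vectors to fundamental vectors. *)
Lemma iso_frame_map n (phi : AP n -> AQ n) : is_isomorphism phi -> frame_map phi.
Proof.
elim: n phi => [|n IH] phi; first exact: iso_frame_map0.
move=> iphi; have [dphi [psi [ipsi _ phiE]]] := iphi.
move=> z zeta Pz hz; have [sphi _] := dphi; have [spsi _] := iso_diffeo ipsi.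
have [Pz1 _] := lev_point rP Pz.
have [hb cb] := hatS_fbar hz; have [[iz fz] vz _ _] := hz.
have E1 w : pts (lev P n.+1) w -> (phi w).1 = psi w.1 by move=> /phiE ->.
have bE : fbar (push (lev Q n.+1) phi \o zeta) = push (lev Q n) psi \o fbar zeta.
  apply/funext => e; rewrite /fbar /= (push_descend sphi spsi E1 (z := z)) //.
  exact: hatS_tangent hz.
have gg := gP Pz1.
split.
- split; first exact: (diffeo_linear_iso dphi Pz iz).
  by move=> p e he; apply: iso_Tfilt => //; exact: fz.
- move=> a /=; have sa := act_smooth gg Pz.
  rewrite vz push_comp //; apply: (push_ext _ (liealg_tangent rP a)) => c Gc.
  have [aP _] := sa; rewrite /= phiE; last exact: aP.
  by rewrite phiE // clift_act.
- by rewrite -/(fbar (push (lev Q n.+1) phi \o zeta)) bE E1 //; exact: IH.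
- rewrite -/(fbar (push (lev Q n.+1) phi \o zeta)) bE phiE //=.
  apply/seteqP; split=> h.
    by move=> [a ha ->]; exists (fbar zeta \o a) => //; rewrite -cb; exists a.
  by rewrite -cb; move=> [_ [a ha ->] ->]; exists a.
Qed.

Lemma clift_smooth n (phi : AP n -> AQ n) :
  smooth_map (lev P n) (lev Q n) phi -> frame_map phi ->
  smooth_map (univ_frame P n) (univ_frame Q n) (clift phi).
Proof.
move=> sphi fphi.
have sl : smooth_map (hatS P n) (hatS Q n) (fun u => (phi u.1, push (lev Q n) phi \o u.2)).
  apply: smooth_to_hatS.
  - exact: (smooth_map_comp (@hatS_fst _ _ P n) sphi).
  - by move=> u [Pu hu]; exact: fphi.
  - move=> e f sf; apply: (@eq_smooth _ _ _ (fun u => u.2 e (f \o phi))).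
      by move=> u _; rewrite /= pushE.
    by apply: hatS_eval; have [_] := sphi; apply.
have [slP _] := sl.
apply: smooth_map_gens => [_ [u Pu <-]|h gh].
  have -> : clift phi (u.1, cls u.2) = uproj (phi u.1, push (lev Q n) phi \o u.2).
    exact: clift_uproj.
  by exists (phi u.1, push (lev Q n) phi \o u.2) => //; exact: slP.
apply: smooth_gen; have [_ /(_ _ gh)] := sl.
apply: eq_smooth => u _ /=; congr h.
by rewrite -/(uproj u) clift_uproj.
Qed.

Lemma clift_ext n (phi phi' : AP n -> AQ n) z :
  (forall x, pts (lev P n) x -> phi x = phi' x) -> pts (lev P n.+1) z ->
  clift phi z = clift phi' z.
Proof.
move=> E1 Pz; have [Pz1 _] := lev_point rP Pz; congr pair; first exact: E1.
apply/seteqP; split=> h [zeta hz ->]; exists zeta => //; apply/funext => e /=;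
  have [hz' _] := lev_class rP Pz hz;
  have Tz := hatS_tangent e hz'; first exact: (push_ext _ Tz E1).
by apply: (push_ext _ Tz) => x Px; rewrite E1.
Qed.

Lemma iso_ext n (phi phi' : AP n -> AQ n) :
  (forall x, pts (lev P n) x -> phi x = phi' x) -> is_isomorphism phi ->
  is_isomorphism phi'.
Proof.
case: n phi phi' => [|n] phi phi' E1.
  move=> [dphi Fphi]; split; first exact: diffeo_ext dphi.
  move=> p x Px; rewrite -E1 // -Fphi //.
  have [h _ _ _] := filt_subbundle (bfilt P) p Px.
  by apply/seteqP; split=> D [v Fv <-]; exists v => //;
    rewrite (push_ext (lev Q 0) (h _ Fv) E1).
move=> [dphi [psi [ipsi opsi phiE]]]; split; first exact: diffeo_ext dphi.
by exists psi; split=> // z Pz; rewrite -E1 // phiE.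
Qed.

(** The form given by [zeta] at [z] is the pull-back of the form given by [push psi \o zeta] at
    [phi z]; the differential of [psi] cancels because it is injective. *)
Lemma lift_preserves_pfaff n (psi : AP n -> AQ n) (phi : AP n.+1 -> AQ n.+1) :
  diffeomorphism (lev P n) (lev Q n) psi ->
  diffeomorphism (lev P n.+1) (lev Q n.+1) phi ->
  (forall z, pts (lev P n.+1) z -> phi z = clift psi z) ->
  preserves_pfaff phi.
Proof.
move=> dpsi dphi phiE z Pz; have [spsi _] := dpsi; have [sphi [g [sg gphi phig]]] := dphi.
have E1 w : pts (lev P n.+1) w -> (phi w).1 = psi w.1 by move=> /phiE ->.
have [sdP _ _] := rP.
apply/seteqP; split=> alpha.
  move=> [beta [zeta' hz' hb] ha]; move: hz'; rewrite phiE // => -[zeta hz zE].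
  have [hz' _] := lev_class rP Pz hz.
  exists zeta => // X TX; have TX' := push_tangent sphi TX.
  have := hb _ TX'; rewrite zE -ha // (push_descend sphi spsi E1 TX) /=.
  apply: (diffeo_push_inj dpsi); first exact: hatS_tangent hz'.
  exact: (push_tangent (sdP n) TX).
move=> [zeta hz ha]; exists (fun Y => alpha (push (lev P n.+1) g Y)).
  exists (push (lev Q n) psi \o zeta); first by rewrite phiE //; exists zeta.
  move=> Y TY /=; have [X TX <-] := diffeo_push_onto dphi Pz TY.
  rewrite push_comp // (push_ext _ TX gphi) (push_id TX) ha //.
  by rewrite (push_descend sphi spsi E1 TX).
move=> X TX; rewrite push_comp // (push_ext _ TX gphi) (push_id TX) //.
Qed.

End OneDirection.

Section Inverses.
Variables P Q : tower tau.
Local Notation AP n := (Amb tau (base P) n).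
Local Notation AQ n := (Amb tau (base Q) n).

Lemma clift_inv n (psi : AP n -> AQ n) psi' z : regular P ->
  smooth_map (lev P n) (lev Q n) psi -> smooth_map (lev Q n) (lev P n) psi' ->
  (forall x, pts (lev P n) x -> psi' (psi x) = x) -> pts (lev P n.+1) z ->
  clift psi' (clift psi z) = z.
Proof.
move=> rP spsi spsi' psiK Pz; have [Pz1 _] := lev_point rP Pz.
have pK zeta : z.2 zeta -> push (lev P n) psi' \o (push (lev Q n) psi \o zeta) = zeta.
  move=> /(lev_class rP Pz)[hz _]; apply/funext => e /=.
  have Te := hatS_tangent e hz.
  by rewrite push_comp // (push_ext _ Te psiK) (push_id Te).
rewrite [RHS]surjective_pairing; congr pair => /=; first exact: psiK.
apply/seteqP; split=> h /=.
  by move=> [_ [zeta hz ->] ->]; rewrite pK.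
move=> hh; exists (push (lev Q n) psi \o h); first by exists h.
by rewrite pK.
Qed.

Lemma iso_inv n (phi : AP n -> AQ n) : regular P -> regular Q ->
  is_isomorphism phi -> exists phi' : AQ n -> AP n,
    [/\ is_isomorphism phi', forall x, pts (lev P n) x -> phi' (phi x) = x &
        forall y, pts (lev Q n) y -> phi (phi' y) = y].
Proof.
move=> rP rQ; elim: n phi => [|n IH] phi.
  move=> [[sphi [g [sg gK Kg]]] Fphi]; exists g; split=> //.
  split; first by split=> //; exists phi.
  move=> p y Qy; have [gP _] := sg; have Pg := gP _ Qy.
  have [h _ _ _] := filt_subbundle (bfilt P) p Pg.
  have gv v : bfilt P p (g y) v -> push (lev P 0) g (push (lev Q 0) phi v) = v.
    by move=> Fv; rewrite push_comp // (push_ext _ (h _ Fv) gK) (push_id (h _ Fv)).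
  rewrite -{1}(Kg y) // -Fphi //; apply/seteqP; split=> v.
    by move=> [_ [w Fw <-] <-]; rewrite gv.
  by move=> Fv; exists (push (lev Q 0) phi v); [exists v | exact: gv].
move=> [[sphi [g [sg gK Kg]]] [psi [ipsi opsi phiE]]].
have [psi' [ipsi' psiK Kpsi]] := IH psi ipsi.
have [spsi _] := iso_diffeo ipsi; have [spsi' _] := iso_diffeo ipsi'.
have [gP _] := sg; have [phiP _] := sphi.
have gE y : pts (lev Q n.+1) y -> g y = clift psi' y.
  move=> Qy; rewrite -{2}(Kg y) // phiE; last exact: gP.
  by rewrite clift_inv //; exact: gP.
exists g; split=> //; split; first by split=> //; exists phi.
exists psi'; split=> //; apply/seteqP; split=> z.
  by move=> [y Qy <-]; rewrite -gE //; exact: gP.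
by move=> Pz; exists (phi z); [exact: phiP | rewrite -gE ?gK //; exact: phiP].
Qed.
End Inverses.

(** * Iterated lifts and their limit *)

Section Lifts.
Variables P Q : tower tau.
Local Notation AP n := (Amb tau (base P) n).
Local Notation AQ n := (Amb tau (base Q) n).
Hypotheses (rP : regular P) (rQ : regular Q).
Hypothesis gP : forall n x, pts (lev P n) x -> good_group P n.
Hypothesis gQ : forall n x, pts (lev Q n) x -> good_group Q n.

Lemma lift_iso n (phi : AP n -> AQ n) : lev P n.+1 = univ_frame P n ->
  lev Q n.+1 = univ_frame Q n -> is_isomorphism phi -> is_isomorphism (clift phi).
Proof.
move=> EP EQ iphi; have [phi' [iphi' phiK Kphi]] := iso_inv rP rQ iphi.
have [sphi _] := iso_diffeo iphi; have [sphi' _] := iso_diffeo iphi'.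
have sc : smooth_map (lev P n.+1) (lev Q n.+1) (clift phi).
  by rewrite EP EQ; apply: clift_smooth => //; exact: iso_frame_map.
have sc' : smooth_map (lev Q n.+1) (lev P n.+1) (clift phi').
  by rewrite EP EQ; apply: clift_smooth => //; exact: iso_frame_map.
have [cP _] := sc; have [cP' _] := sc'.
split.
  split=> //; exists (clift phi'); split=> // z Pz; exact: clift_inv.
exists phi; split=> //; apply/seteqP; split=> z; first by move=> [y Py <-]; exact: cP.
by move=> Pz; exists (clift phi' z); [exact: cP' | exact: clift_inv].
Qed.

(** [is_isomorphism] hides the lower maps behind existentials. Rebuilding all maps from the one at
    level 0 names them at once, as a map of projective limits requires. *)
Fixpoint lift_tower (psi : AP 0 -> AQ 0) (i : nat) : AP i -> AQ i :=
  match i with 0 => psi | i'.+1 => clift (@lift_tower psi i') end.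
Arguments lift_tower psi i : clear implicits.

Lemma iso_tower n (phi : AP n -> AQ n) : is_isomorphism phi ->
  exists psi, (forall i, (i <= n)%N -> is_isomorphism (lift_tower psi i)) /\
    forall x, pts (lev P n) x -> lift_tower psi n x = phi x.
Proof.
elim: n phi => [|n IH] phi iphi.
  by exists phi; split=> // i; rewrite leqn0 => /eqP->.
have [_ [psi [ipsi _ phiE]]] := iphi; have [psi0 [i0 E0]] := IH _ ipsi.
have EE x : pts (lev P n.+1) x -> lift_tower psi0 n.+1 x = phi x.
  by move=> Px; rewrite phiE //; exact: clift_ext.
exists psi0; split=> // i; rewrite leq_eqVlt ltnS => /orP[/eqP->|]; last exact: i0.
by apply: (iso_ext _ iphi) => x Px; rewrite EE.
Qed.

Variable k : nat.
Hypothesis uP : forall n, (k < n)%N -> lev P n.+1 = univ_frame P n.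
Hypothesis uQ : forall n, (k < n)%N -> lev Q n.+1 = univ_frame Q n.

Lemma full_iso_tower (phi : AP k.+1 -> AQ k.+1) : is_isomorphism phi ->
  exists psi, (forall i, is_isomorphism (lift_tower psi i)) /\
    forall x, pts (lev P k.+1) x -> lift_tower psi k.+1 x = phi x.
Proof.
move=> /iso_tower[psi [ipsi psiE]]; exists psi; split=> // i.
elim: i => [|i IH]; first exact: ipsi.
have [ik|ki] := leqP i k; first exact: ipsi.
by apply: lift_iso; [exact: uP | exact: uQ | ].
Qed.

Lemma iter_lift_tower n (phi : AP n -> AQ n) psi m :
  (forall x, pts (lev P n) x -> lift_tower psi n x = phi x) ->
  forall x, pts (lev P (m + n)) x -> lift_tower psi (m + n) x = iter_lift (m := m) phi x.
Proof. by move=> E0; elim: m => [//|m IH] x Px /=; exact: clift_ext. Qed.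

Section Limit.
Variable psi : AP 0 -> AQ 0.
Hypothesis ipsi : forall i, is_isomorphism (lift_tower psi i).
Local Notation F i := (lift_tower psi i).

Definition limit_map (z : forall i, AP i) : forall i, AQ i := fun i => F i (z i).

Lemma SQ_proj (S : tower tau) n :
  smooth_map (SQ S) (lev S n) (fun z : forall i, Amb tau (base S) i => z n).
Proof.
apply: smooth_map_gens => [z Sz|g gg]; first by have [] := Sz n.
by apply: smooth_gen; exists n; exists g => //; exact: smooth_gen.
Qed.

Lemma smooth_to_SQ (S : tower tau) T (X : space R T)
    (G : T -> forall n, Amb tau (base S) n) :
  (forall x, pts X x -> forall n, (G x n.+1).1 = G x n) ->
  (forall n, smooth_map X (lev S n) (fun x => G x n)) -> smooth_map X (SQ S) G.
Proof.
move=> G1 sG; apply: smooth_map_gens => [x Xx n|_ [n [f sf ->]]].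
  by split; [have [h _] := sG n; exact: h | exact: G1].
by have [_] := sG n; exact.
Qed.

Lemma limit_map_diffeo : diffeomorphism (SQ P) (SQ Q) limit_map.
Proof.
have sF i := (iso_diffeo (ipsi i)).1.
have sPhi : smooth_map (SQ P) (SQ Q) limit_map.
  apply: smooth_to_SQ => [z Pz n|n]; first by rewrite /limit_map /= (Pz n).2.
  exact: (smooth_map_comp (SQ_proj P n) (sF n)).
split=> //.
have H : forall i, exists g : AQ i -> AP i, [/\ is_isomorphism g,
    forall x, pts (lev P i) x -> g (F i x) = x &
    forall y, pts (lev Q i) y -> F i (g y) = y].
  by move=> i; exact: iso_inv.
pose g i := projT1 (cid (H i)); have gP' i := projT2 (cid (H i)).
exists (fun w i => g i (w i)); split.
(* The inverses are chosen separately at each level; they are compatible because [F n.+1] covers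
   [F n] and inverses are unique on points. *)
- apply: smooth_to_SQ => [w Qw n|n].
    have [ig _ Kg] := gP' n.+1; have [_ gK _] := gP' n.
    have [[gp _] _] := iso_diffeo ig.
    have [Qn _] := Qw n.+1; have Pg := gp _ Qn; have [Pg1 _] := lev_point rP Pg.
    by rewrite -[LHS](gK _ Pg1) -(Qw n).2 -{2}(Kg _ Qn).
  have [ig _ _] := gP' n; have [sg _] := iso_diffeo ig.
  exact: (smooth_map_comp (SQ_proj Q n) sg).
- move=> z Pz; apply/functional_extensionality_dep => i.
  by have [_ gK _] := gP' i; apply: gK; have [] := Pz i.
- move=> z Pz; apply/functional_extensionality_dep => i.
  by have [_ _ Kg] := gP' i; apply: Kg; have [] := Pz i.
Qed.

Lemma limit_map_theta : preserves_theta limit_map.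
Proof.
move=> z X e TX; have [Pz _ _] := TX; have [sPhi _] := limit_map_diffeo.
have dF i := iso_diffeo (ipsi i).
have step N (e' : E N) zeta : (z N.+1).2 zeta ->
    ((push (lev Q N) (F N) \o zeta) e' =
      push (lev Q N) (fun w : forall n, AQ n => w N) (push (SQ Q) limit_map X)) <->
    zeta e' = push (lev P N) (fun w : forall n, AP n => w N) X.
  move=> hz; have [PN _] := Pz N.+1; have [hz' _] := lev_class rP PN hz.
  have TN := push_tangent (SQ_proj P N) TX.
  rewrite push_comp //; last exact: SQ_proj.
  have -> : (fun w : forall n, AQ n => w N) \o limit_map =
    F N \o (fun w : forall n, AP n => w N) by [].
  rewrite -(push_comp (Y := lev P N)); last exact: (dF N).1.
  split=> [|<-//]; apply: (diffeo_push_inj (dF N) (x := z N) _ TN).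
  by rewrite -(Pz N).2; exact: hatS_tangent hz'.
split=> th m; have [d0 hd0] := th m; exists d0 => d dd zeta hz.
  have [|e' /step] := hd0 d dd (push (lev Q (d + m)) (F (d + m)) \o zeta).
    by exists zeta.
  by move=> /(_ hz) <- ee; exists e'.
move: hz => [zeta0 hz0 ->]; have [e' he ee] := hd0 d dd zeta0 hz0.
by exists e' => //; apply/step.
Qed.
End Limit.
End Lifts.
End Morphisms.

(** * Descending Pfaff-preserving maps *)

Section Curves.
Context {R : realType}.

Lemma curve_const {T} (X : space R T) gamma phi : smooth_fun X phi ->
  (forall t : R, 0 <= t <= 1 ->
    curve_at X gamma t /\ velocity X gamma t phi = 0) ->
  phi (gamma 0) = phi (gamma 1).
Proof.
move=> sphi Hg; pose g := phi \o gamma : R -> R.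
have dg (t : R) : 0 <= t <= 1 -> is_derive t (1 : R) g 0.
  move=> t01; have [cg v0] := Hg t t01; split; first exact: curve_derivable cg sphi.
  by move: v0; rewrite /velocity asboolT.
have [||c _] := @MVT_segment R g (fun=> 0) 0 1 ler01.
- move=> t; rewrite in_itv /= => /andP[t0 t1]; apply: dg; lra.
- apply: derivable_within_continuous => t; rewrite in_itv /= => t01.
  by have [] := dg t t01.
- by rewrite mul0r => /eqP; rewrite subr_eq0 => /eqP.
Qed.

Lemma velocity_const {T T'} (X : space R T) (Y : space R T') f gamma t y :
  smooth_map X Y f -> (forall s, f (gamma s) = y) ->
  push Y f (velocity X gamma t) = 0.
Proof.
move=> [_ sf] fy; apply/funext => h; rewrite /push; case: asboolP => // sh.
rewrite /velocity asboolT; last exact: sf.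
rewrite (_ : _ \o gamma = cst (h y)); first exact: (@derive_cst R R^o R^o).
by apply/funext => s; rewrite /= fy.
Qed.

Lemma curve_cst {T} (X : space R T) x t : pts X x -> curve_at X (fun _ => x) t.
Proof.
move=> Xx; split; first exact: (@filterE _ (nbhs t)).
move=> g _; rewrite (_ : _ \o _ = cst (g x)) //; exact: (@derivable_cst R R^o R^o).
Qed.

Lemma line_curve d (W : set 'rV[R]_d) (u v : 'rV[R]_d) (t : R) : open W ->
  W ((1 - t) *: u + t *: v) ->
  curve_at (restrict (euclidean d) W) (fun s => (1 - s) *: u + s *: v) t.
Proof.
move=> oW Wt; split.
  have cl : (fun s : R => (1 - s) *: u + s *: v) @ t --> (1 - t) *: u + t *: v.
    apply: cvgD; apply: cvgZr_tmp; last exact: cvg_id.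
    by apply: cvgB; [exact: cvg_cst|exact: cvg_id].
  have /cl H := open_nbhs_nbhs (conj oW Wt).
  by apply: (@filterS _ (nbhs t) _ (fun s : R => W ((1 - s) *: u + s *: v))).
move=> g [i ->]; rewrite (_ : _ \o _ = fun s => (1 - s) * u ord0 i + s * v ord0 i).
  by apply: derivableD; apply: derivableM.
by apply/funext => s; rewrite /= !mxE.
Qed.

(** Inside a ball contained in the image of a chart, straight segments to the centre are curves
    along which [phi] has derivative 0. *)
Lemma locally_const {T} (X : space R T) (phi : T -> R) : is_manifold X ->
  smooth_fun X phi -> (forall x D, tangent X x D -> D phi = 0) ->
  forall x, pts X x -> nbh X x [set y | phi y = phi x].
Proof.
move=> [_ [d [U [W [c [Hc cov]]]]]] sphi phi0 x Xx.
have [j Ujx] := cov x Xx; have [oO oW [sc [g [sg gc cg]]]] := Hc j.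
have [cP _] := sc; have Wc : W j (c j x) by have [] := cP x (conj Xx Ujx).
have [e e0 He] : exists2 e : R, 0 < e & ball (c j x) e `<=` W j.
  by have /nbhs_ballP[e e0 He] := open_nbhs_nbhs (conj oW Wc); exists e.
have nb : nbh (restrict (euclidean d) (W j)) (c j x) (ball (c j x) e).
  exists d, (fun i (v : 'rV[R]_d) => v ord0 i), e; split=> // [i|v [_ vx]].
    by exists i.
  by split=> // i k; rewrite ord1 /ball /= distrC.
have := nbh_restrict oO Xx Ujx (nbh_preimage sc (conj Xx Ujx) nb).
move/(nbhI (oO x Xx Ujx)); apply: nbhS => y Xy [Oy By] /=.
rewrite -(gc x) // -(gc y) //.
have sgX : smooth_map (restrict (euclidean d) (W j)) X g.
  exact: (smooth_map_comp sg (@smooth_map_incl _ _ _ _)).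
pose l (s : R) : 'rV[R]_d := (1 - s) *: c j x + s *: c j y.
have l0 : l 0 = c j x by rewrite /l subr0 scale1r scale0r addr0.
have l1 : l 1 = c j y by rewrite /l subrr scale1r scale0r add0r.
rewrite -l0 -l1; apply/esym.
apply: (@curve_const _ X (g \o l) phi) => // t /andP[t0 t1].
have cl : curve_at X (g \o l) t.
  apply: (curve_map sgX); apply: line_curve => //; apply: He; split=> // i k.
  have [_ /(_ i k)] := By; rewrite /ball /= !mxE => Bik.
  rewrite (_ : _ - _ = t * (c j x i k - c j y i k)); last by ring.
  rewrite normrM (ger0_norm t0); apply: le_lt_trans Bik.
  by apply: ler_piMl.
by split=> //; exact: phi0 (velocity_tangent cl).
Qed.

Lemma connected_const {T} (X : space R T) (phi : T -> R) : is_manifold X ->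
  is_connected X -> smooth_fun X phi -> (forall x D, tangent X x D -> D phi = 0) ->
  forall x y, pts X x -> pts X y -> phi x = phi y.
Proof.
move=> mX cX sphi phi0 x y Xx Xy.
have lc := locally_const mX sphi phi0.
have [||||E|E] := cX [set z | phi z = phi x] [set z | phi z <> phi x].
- by move=> z Xz /= <-; exact: lc.
- move=> z Xz /= zx; have := lc z Xz; apply: nbhS => w _ /= -> //.
- by move=> z Xz; have [|] := pselect (phi z = phi x); [left|right].
- by apply/seteqP; split=> z // [[_ h1] h2].
- by have : (pts X `&` [set z | phi z = phi x]) x by []; rewrite E.
- have [<-//|yx] := pselect (phi y = phi x).
  by have : (pts X `&` [set z | phi z <> phi x]) y by []; rewrite E.
Qed.
End Curves.

(** * Constancy along the fibres of the projections *)

Section Fibres.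
Context {R : realType} {tau : struct_type R}.
Local Notation E := (Espace tau).
Local Notation unit n := (unit_cls (tau := tau) (n := n)).

(** Constancy of a map is established on smooth functions of its target. This is the part of the
    manifold property that the conclusion needs, and it remains provable at the levels without
    charts. *)
Definition separated {T} (X : space R T) : Prop := forall x y, pts X x -> pts X y ->
  (forall h, smooth_fun X h -> h x = h y) -> x = y.

Lemma manifold_separated {T} (X : space R T) : is_manifold X -> separated X.
Proof.
move=> [sep _] x y Xx Xy hxy; apply: contrapT => xy.
by have [h /hxy] := sep x y Xx Xy xy.
Qed.

Section OneTower.
Variables (k : nat) (Q : tower tau).
Hypotheses (wf : wf_type tau k) (geo : is_geometric_structure Q k).
Local Notation A n := (Amb tau (base Q) n).
Local Notation U n := (functional (R := R) (A n)).
Local Notation descend n := (@descend R tau Q n).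
Local Notation act n := (@act R tau Q n).
Let reg := geom_regular wf geo.

(** Over a common base point, two classes with the same normal form coincide. The coordinates of the
    normal form, cut off by a bump function of the base, are global smooth functions and hence
    separate classes. *)
Lemma lev_separated n : separated (lev Q n).
Proof.
have [m0 _ g1 g2] := geo.
elim: n => [|n IH]; first exact: manifold_separated.
have [nk|nk] := leqP n k.
  by have [[m1 _ _ _] _ _] := g1 n nk; exact: manifold_separated.
have [EQ _] := g2 n nk.
move=> z w Pz Pw hzw; have [Pz1 _] := lev_point reg Pz; have [Pw1 _] := lev_point reg Pw.
have zw1 : z.1 = w.1.
  apply: IH => // h sh; apply: (hzw (h \o descend n)).
  by have [sd _ _] := reg; have [_] := sd n; exact.
have [W [t [Wx ft]]] := frame_cover wf geo Pz1.
have [oW _ _] := ft; have [N [zN sN]] := class_selection reg ft.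
have [chi [schi chi1 chi0]] := bump Pz1 (oW _ Pz1 Wx).
have chi1z : chi z.1 = 1 by exact: (nbh_self Pz1 chi1).
have sd := univ_frame_descend Q n; have oW' := open_preimage sd oW.
have Nzw : N z = N w.
  rewrite (vcE (N z)) (vcE (N w)); apply: eq_bigr => i _; congr (_ *: _).
  have : smooth_fun (lev Q n.+1)
      (fun y => if `[< W y.1 >] then chi y.1 * vc i (N y) else 0).
    rewrite EQ; apply: (smooth_cutoff (chi := chi \o descend n) oW').
    - by have [_] := sd; exact.
    - by move=> y Py Wy; exact: (nbh_preimage sd Py (chi0 _ (sd.1 _ Py) Wy)).
    - by apply: sN; exact: vc_linear.
  by move=> /hzw; rewrite -zw1 asboolT // chi1z !mul1r.
rewrite EQ in Pz Pw; have hz := zN z Pz Wx.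
have hw : w.2 (t z.1 \o N z) by rewrite Nzw zw1; apply: zN; rewrite -?zw1.
rewrite -EQ in Pz Pw; have [_ cz] := lev_class reg Pz hz.
have [_ cw] := lev_class reg Pw hw.
by rewrite (surjective_pairing z) (surjective_pairing w) -cz -cw zw1.
Qed.

Lemma fibre_constant n T (Y : space R T) (f : A n.+1 -> T) :
  ((n <= k)%N -> is_connected (grp tau n)) ->
  smooth_map (lev Q n.+1) Y f -> separated Y ->
  (forall w X, tangent (lev Q n.+1) w X -> push (lev Q n) (descend n) X = 0 ->
     push Y f X = 0) ->
  forall z w, pts (lev Q n.+1) z -> pts (lev Q n.+1) w -> z.1 = w.1 -> f z = f w.
Proof.
move=> cG sf sY f0 z w Pz Pw zw1; have [fP _] := sf.
apply: sY; [exact: fP|exact: fP|move=> h sh].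
have shf : smooth_fun (lev Q n.+1) (h \o f) by have [_] := sf; exact.
have [Px _] := lev_point reg Pz.
have [nk|] := leqP n k.
  have [W [s [Wx ts]]] := geom_triv wf geo Px.
  have [oW s1 dG] := ts; have [c [sc cz c2]] := triv_inv ts.
  have sG : smooth_map (grp tau n) (lev Q n.+1) (act n (s z.1)).
    have sp : smooth_map (grp tau n) (prod_space (restrict (lev Q n) W) (grp tau n))
        (fun c => (z.1, c)).
      by apply: smooth_map_pair; [exact: smooth_map_cst|exact: smooth_map_id].
    exact: (smooth_map_comp (smooth_map_comp sp dG.1) (@smooth_map_incl _ _ _ _)).
  have [cP _] := sc.
  rewrite -(cz z) // -(cz w) // -?zw1 //.
  have [lg _] := wf; have [mG _ _ _] := lg n nk.
  (* Differentiated along the group, the orbit map gives vertical vectors, on which [f] has zero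
     differential; [c z] and [c w] are the group elements of the two points. *)
  apply: (connected_const mG (cG nk) (phi := h \o f \o act n (s z.1))).
  - by have [_] := sG; exact.
  - move=> c' D TD; have TD' := push_tangent sG TD.
    have := f0 _ _ TD' (descend_act reg _ TD).
    move=> /(congr1 (fun D : functional T => D h)); rewrite pushE // pushE //.
  - exact: cP.
  - by apply: cP; split=> //; rewrite /preimage /= /Defs.descend -zw1.
case: n z w Pz Pw zw1 Px f sf f0 {cG} fP h sh shf => // n z w Pz Pw zw1 Px f sf f0 fP h sh shf nk.
have [_ _ _ g2] := geo; have [EQ _] := g2 n.+1 nk.
have [_ [zeta hz zE]] := lev_point reg Pz; have [_ [zeta' hz' wE]] := lev_point reg Pw.
rewrite -zw1 in hz'; have [a Ha aE] := hatS_torsor reg Px hz hz'.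
have [la _ _] := Ha; have [lz _ _] := hatS_iso hz.
(* The segment from the identity to [a] stays in [Hgrp], so it moves the frame [zeta] to [zeta']
   through frames over one fixed point. On the generators of [hatS] this path is affine in [t]. *)
pose at_ (t : R) := fun e => (1 - t) *: e + t *: a e.
have Hid : Hgrp (id : E n.+1 -> E n.+1) by split=> //; exact: unit_cls_id.
pose u (t : R) : A n.+1 * (E n.+1 -> U n.+1) := (z.1, zeta \o at_ t).
have cu t : curve_at (hatS Q n.+1) u t.
  split.
    apply: (@filterE _ (nbhs t)) => s; split=> //; apply: hatS_Hgrp => //.
    exact: Hgrp_affine.
  move=> _ [[g sg ->]|[e [g sg ->]]].
    rewrite (_ : _ \o u = cst (g z.1)); first exact: (@derivable_cst R R^o R^o).
    by apply/funext.
  rewrite (_ : _ \o u = fun s => (1 - s) * (zeta e g : R) + s * (zeta (a e) g : R)).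
    by apply: derivableD; apply: derivableM.
  apply/funext => s.
  have zs : zeta (at_ s e) = (1 - s) *: zeta e + s *: zeta (a e).
    by rewrite /at_ (linear_funD _ _ lz) (linear_funZ _ _ lz) (linear_funZ _ _ lz).
  exact: (congr1 (fun D : functional (R := R) (A n.+1) => D g) zs).
have su : smooth_map (hatS Q n.+1) (lev Q n.+2) (@uproj _ _ Q n.+1).
  by rewrite EQ; exact: uproj_smooth.
have -> : z = uproj (u 0).
  rewrite [LHS]surjective_pairing zE; congr (_, cls _).
  by apply/funext => e; rewrite /= /at_ subr0 scale1r scale0r addr0.
have -> : w = uproj (u 1).
  rewrite [LHS]surjective_pairing wE -zw1 aE; congr (_, cls _).
  by apply/funext => e; rewrite /= /at_ subrr scale1r scale0r add0r.
apply: (@curve_const _ _ (lev Q n.+2) (@uproj _ _ Q n.+1 \o u) (h \o f)) => // t _.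
have cg := curve_map su (cu t); split=> //.
have Tv := velocity_tangent cg.
have v0 : push (lev Q n.+1) (descend n.+1)
    (velocity (lev Q n.+2) (@uproj _ _ Q n.+1 \o u) t) = 0.
  by have [sd _ _] := reg; exact: (velocity_const _ (y := z.1) (sd n.+1)).
by have /(congr1 (fun D : functional T => D h)) := f0 _ _ Tv v0; rewrite pushE.
Qed.

(** A frame at [z] projects to a frame at [z.1], so every tangent vector below is the projection of
    a frame vector above. *)
Lemma fibre_submersion n z D : pts (lev Q n.+1) z -> tangent (lev Q n) z.1 D ->
  exists2 X, tangent (lev Q n.+1) z X & push (lev Q n) (descend n) X = D.
Proof.
move=> Pz TD; have [W [s [Wz [_ hs _]]]] := hatS_cover wf geo Pz.
have hz := hs _ Pz Wz; have [hb _] := hatS_fbar hz.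
have [e <-] := linear_iso_onto (hatS_iso hb) TD.
exists (s z (e, 0)); first exact: hatS_tangent.
by rewrite (descend_frame reg _ hz).
Qed.
End OneTower.
End Fibres.

(** * Maps that preserve the canonical Pfaff class *)

Section Descent.
Context {R : realType} {tau : struct_type R}.
Local Notation E := (Espace tau).

Section OneDirection.
Variables P Q : tower tau.
Local Notation AP n := (Amb tau (base P) n).
Local Notation AQ n := (Amb tau (base Q) n).
Local Notation dP n := (@descend R tau P n).
Local Notation dQ n := (@descend R tau Q n).
Hypotheses (rP : regular P) (rQ : regular Q).

Definition some_frame_map n (phi : AP n -> AQ n) : Prop :=
  forall x, pts (lev P n) x -> exists2 zeta, hatS_fibre x zeta &
    hatS_fibre (phi x) (push (lev Q n) phi \o zeta).

(** With [X = zeta e], the form given by [fbar zeta] takes the value [e.1] on [X], and so does the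
    form given by [fbar zeta'] on the image of [X]. As each class is generated by one frame, this
    comparison covers all its forms. *)
Lemma some_frame_pfaff n (phi : AP n.+1 -> AQ n.+1) :
  diffeomorphism (lev P n.+1) (lev Q n.+1) phi -> some_frame_map phi ->
  preserves_pfaff phi.
Proof.
move=> dphi fphi z Pz; have [sphi [g [sg gphi phig]]] := dphi.
have [zeta hz hz'] := fphi z Pz.
have [hb cb] := hatS_fbar hz; have [hb' cb'] := hatS_fbar hz'.
set zeta' := push (lev Q n.+1) phi \o zeta in hz' hb' cb'.
have frame e u : (fbar zeta (u : E n) = push (lev P n) (dP n) (zeta e)) <->
    fbar zeta' u = push (lev Q n) (dQ n) (push (lev Q n.+1) phi (zeta e)).
  rewrite (descend_frame rP e hz) (descend_frame rQ e hz').
  have [_ ib _] := hatS_iso hb; have [_ ib' _] := hatS_iso hb'.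
  by split=> [/ib ->|/ib' ->].
apply/seteqP; split=> alpha.
  move=> [beta [zeta0 + hbeta] ha]; rewrite -cb' => -[u hu zE].
  exists (fbar zeta \o u); first by rewrite -cb; exists u.
  move=> X TX; have [e eX] := linear_iso_onto (hatS_iso hz) TX.
  rewrite -eX; apply/frame; rewrite eX ha //.
  by have := hbeta _ (push_tangent sphi TX); rewrite zE.
move=> [zeta0 + ha]; rewrite -cb => -[u hu zE].
exists (fun Y => alpha (push (lev P n.+1) g Y)); last first.
  by move=> X TX; rewrite push_comp // (push_ext _ TX gphi) (push_id TX).
exists (fbar zeta' \o u); first by rewrite -cb'; exists u.
move=> Y TY; have [e eY] := linear_iso_onto (hatS_iso hz') TY.
have TX := hatS_tangent e hz.
have gX : push (lev P n.+1) g Y = zeta e.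
  by rewrite -eY /zeta' /= push_comp // (push_ext _ TX gphi) (push_id TX).
rewrite gX -eY; apply/frame.
by have := ha _ TX; rewrite zE.
Qed.

Section PfaffMap.
Variables (n : nat) (Phi : AP n.+1 -> AQ n.+1).
Hypotheses (dPhi : diffeomorphism (lev P n.+1) (lev Q n.+1) Phi)
  (pPhi : preserves_pfaff Phi).

Definition related z (zeta : E n -> functional (AP n)) (zeta' : E n -> functional (AQ n)) :=
  forall X e, tangent (lev P n.+1) z X ->
    zeta e = push (lev P n) (dP n) X ->
    zeta' e = push (lev Q n) (dQ n) (push (lev Q n.+1) Phi X).

Lemma pfaff_push z zeta : pts (lev P n.+1) z -> z.2 zeta ->
  exists2 zeta', (Phi z).2 zeta' & related z zeta zeta'.
Proof.
move=> Pz hz; have [hz' _] := lev_class rP Pz hz; have [_ iz _] := hatS_iso hz'.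
have [sdP _ _] := rP.
(* The form defined by [zeta] has to be a total function for the hypothesis on [Phi] to apply; its
   value 0 off the tangent vectors does not matter to [pfaff]. *)
have /choice[alpha ha] : forall X, exists e, tangent (lev P n.+1) z X ->
    zeta e = push (lev P n) (dP n) X.
  move=> X; have [TX|nTX] := pselect (tangent (lev P n.+1) z X); last by exists 0.
  by have [e he] := linear_iso_onto (hatS_iso hz') (push_tangent (sdP n) TX); exists e.
have : pfaff_pullback Phi z alpha by rewrite pPhi //; exists zeta.
move=> [beta [zeta' hz2 hb] ab]; exists zeta' => // X e TX.
have [sPhi _] := dPhi.
rewrite -ha // => /iz ->; rewrite ab //; exact: hb (push_tangent sPhi TX).
Qed.

Lemma pfaff_pull z zeta' : pts (lev P n.+1) z -> (Phi z).2 zeta' ->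
  exists2 zeta, z.2 zeta & forall X e, tangent (lev P n.+1) z X ->
    zeta' e = push (lev Q n) (dQ n) (push (lev Q n.+1) Phi X) ->
    zeta e = push (lev P n) (dP n) X.
Proof.
move=> Pz hz; have [[PhiP sPhi] _] := dPhi.
have [hz' _] := lev_class rQ (PhiP _ Pz) hz; have [_ iz _] := hatS_iso hz'.
have [sdQ _ _] := rQ.
have /choice[beta hb] : forall Y, exists e, tangent (lev Q n.+1) (Phi z) Y ->
    zeta' e = push (lev Q n) (dQ n) Y.
  move=> Y; have [TY|nTY] := pselect (tangent (lev Q n.+1) (Phi z) Y); last by exists 0.
  by have [e he] := linear_iso_onto (hatS_iso hz') (push_tangent (sdQ n) TY); exists e.
have : pfaff_pullback Phi z (fun X => beta (push (lev Q n.+1) Phi X)).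
  by exists beta => //; exists zeta'.
rewrite pPhi // => -[zeta hz2 ha]; exists zeta => // X e TX.
have TY : tangent (lev Q n.+1) (Phi z) (push (lev Q n.+1) Phi X).
  by apply: push_tangent TX; split.
by rewrite -hb // => /iz ->; exact: ha.
Qed.

Lemma pfaff_vertical z X : tangent (lev P n.+1) z X ->
  push (lev P n) (dP n) X = 0 ->
  push (lev Q n) (dQ n) (push (lev Q n.+1) Phi X) = 0.
Proof.
move=> TX X0; have [Pz _ _] := TX; have [_ [zeta hz zE]] := lev_point rP Pz.
have [|zeta' hz' rel] := pfaff_push Pz (zeta := zeta); first by rewrite zE; exact: cls_self.
have [[PhiP _] _] := dPhi; have [hz2 _] := lev_class rQ (PhiP _ Pz) hz'.
have [lz _ _] := hatS_iso hz; have [lz' _ _] := hatS_iso hz2.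
by rewrite -(rel X 0) ?(linear_fun0 lz') // (linear_fun0 lz) X0.
Qed.

Lemma pfaff_inverse g : smooth_map (lev Q n.+1) (lev P n.+1) g ->
  (forall x, pts (lev P n.+1) x -> g (Phi x) = x) ->
  (forall y, pts (lev Q n.+1) y -> Phi (g y) = y) -> preserves_pfaff g.
Proof.
move=> sg gPhi Phig y Py; have [gP _] := sg; have [sPhi _] := dPhi.
have PgK Y : tangent (lev Q n.+1) y Y ->
    push (lev Q n.+1) Phi (push (lev P n.+1) g Y) = Y.
  by move=> TY; rewrite push_comp // (push_ext _ TY Phig) (push_id TY).
apply/seteqP; split=> alpha.
  rewrite /pfaff_pullback -pPhi; last exact: gP.
  move=> [beta [beta' [zeta hz hb'] hb] ha]; rewrite Phig // in hz hb'.
  exists zeta => // Y TY; rewrite ha // hb; last exact: push_tangent TY.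
  by rewrite PgK //; exact: hb'.
move=> ha; exists (fun X => alpha (push (lev Q n.+1) Phi X)); last first.
  by move=> Y TY; rewrite PgK.
rewrite -pPhi; last exact: gP.
by exists alpha; rewrite ?Phig.
Qed.
End PfaffMap.
End OneDirection.
End Descent.

Section PfaffDescent.
Context {R : realType} {tau : struct_type R}.
Local Notation E := (Espace tau).
Variables (k : nat) (wf : wf_type tau k).

(** The preimages [sec] are arbitrary, but constancy on the fibres lets them be replaced near each
    point by a smooth local section. *)
Lemma descend_map (P : tower tau) n T (Y : space R T) f :
  is_geometric_structure P k -> smooth_map (lev P n.+1) Y f ->
  (forall z w, pts (lev P n.+1) z -> pts (lev P n.+1) w -> z.1 = w.1 -> f z = f w) ->
  exists2 phi, smooth_map (lev P n) Y phi &
    forall z, pts (lev P n.+1) z -> phi z.1 = f z.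
Proof.
move=> geo sf fc; have reg := geom_regular wf geo.
have /choice[sec secP] : forall x : Amb tau (base P) n, exists z : Amb tau (base P) n.+1,
    pts (lev P n) x -> pts (lev P n.+1) z /\ z.1 = x.
  move=> x; have [Px|nPx] := pselect (pts (lev P n) x); last by exists (x, set0).
  by have [z Pz zx] := descend_onto wf geo Px; exists z.
exists (f \o sec); last first.
  move=> z Pz; have [Pz1 _] := lev_point reg Pz; have [Ps sz] := secP _ Pz1.
  exact: fc.
apply: smooth_map_of_local => x Px.
have [W [s [oW Wx sx ss]]] := local_section wf geo Px; exists W; split=> //.
apply: eq_smooth_map (smooth_map_comp ss sf) => y [Py Wy] /=.
have [Ps sy] := secP _ Py; have [sP _] := ss.
by apply: fc => //; [exact: sP|rewrite sx ?sy].
Qed.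

Section BaseMap.
Variables (P Q : tower tau).
Local Notation AP n := (Amb tau (base P) n).
Local Notation AQ n := (Amb tau (base Q) n).
Hypotheses (hP : is_geometric_structure P k) (hQ : is_geometric_structure Q k).
Hypothesis cG : forall n, (n <= k)%N -> is_connected (grp tau n).
Let rP := geom_regular wf hP.
Let rQ := geom_regular wf hQ.

Lemma pfaff_base_map n (Phi : AP n.+1 -> AQ n.+1) :
  diffeomorphism (lev P n.+1) (lev Q n.+1) Phi -> preserves_pfaff Phi ->
  exists2 phi, smooth_map (lev P n) (lev Q n) phi &
    forall z, pts (lev P n.+1) z -> phi z.1 = (Phi z).1.
Proof.
move=> dPhi pPhi; have [sPhi _] := dPhi; have [sdQ _ _] := rQ.
have sd := smooth_map_comp sPhi (sdQ n).
apply: (descend_map hP sd); apply: (fibre_constant wf hP (@cG n) sd).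
  exact: lev_separated wf hQ n.
move=> w X TX X0; rewrite -(push_comp (Y := lev Q n.+1)) //.
exact: (pfaff_vertical rP rQ dPhi pPhi TX X0).
Qed.
End BaseMap.

Section LiftedMaps.
Variables (P Q : tower tau).
Local Notation AP n := (Amb tau (base P) n).
Local Notation AQ n := (Amb tau (base Q) n).
Local Notation dP n := (@descend R tau P n).
Local Notation dQ n := (@descend R tau Q n).
Hypotheses (hP : is_geometric_structure P k) (hQ : is_geometric_structure Q k).
Hypothesis cG : forall n, (n <= k)%N -> is_connected (grp tau n).
Let rP := geom_regular wf hP.
Let rQ := geom_regular wf hQ.

Lemma pfaff_descends n (Phi : AP n.+1 -> AQ n.+1) :
  diffeomorphism (lev P n.+1) (lev Q n.+1) Phi -> preserves_pfaff Phi ->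
  exists phi : AP n -> AQ n,
    [/\ diffeomorphism (lev P n) (lev Q n) phi, some_frame_map phi,
        forall z, pts (lev P n.+1) z -> phi z.1 = (Phi z).1,
        clift phi @` pts (lev P n.+1) = pts (lev Q n.+1) &
        forall z, pts (lev P n.+1) z -> clift phi z = Phi z].
Proof.
move=> dPhi pPhi; have [sPhi [g [sg gPhi Phig]]] := dPhi.
have [PhiP _] := sPhi; have [gP _] := sg.
have [phi sphi phiE] := pfaff_base_map hP hQ cG dPhi pPhi.
have dg : diffeomorphism (lev Q n.+1) (lev P n.+1) g by split=> //; exists Phi.
have [psi spsi psiE] := pfaff_base_map hQ hP cG dg (pfaff_inverse dPhi pPhi sg gPhi Phig).
have dphi : diffeomorphism (lev P n) (lev Q n) phi.
  split=> //; exists psi; split=> // [x Px|y Py].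
    have [z Pz <-] := descend_onto wf hP Px.
    by rewrite phiE // psiE ?gPhi //; exact: PhiP.
  have [z Pz <-] := descend_onto wf hQ Py.
  by rewrite psiE // phiE ?Phig //; exact: gP.
have pushphi z X : tangent (lev P n.+1) z X ->
    push (lev Q n) (dQ n) (push (lev Q n.+1) Phi X) =
    push (lev Q n) phi (push (lev P n) (dP n) X).
  by move=> TX; apply: (push_descend rQ sPhi sphi _ TX) => w Pw; rewrite phiE.
(* Equality of Pfaff classes only speaks of tangent vectors at [z]. Every vector [zeta e] is the
   projection of one of them, so the corresponding [zeta'] is determined and equals the image of
   [zeta]. *)
have lift1 z zeta : pts (lev P n.+1) z -> z.2 zeta -> (Phi z).2 (push (lev Q n) phi \o zeta).
  move=> Pz hz; have [zeta' hz' rel] := pfaff_push rP dPhi pPhi Pz hz.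
  have [hz2 _] := lev_class rP Pz hz.
  suff -> : push (lev Q n) phi \o zeta = zeta' by [].
  apply/funext => e /=.
  have [X TX XE] := fibre_submersion wf hP Pz (hatS_tangent e hz2).
  by rewrite (rel X e TX (esym XE)) (pushphi _ _ TX) XE.
have liftE z : pts (lev P n.+1) z -> clift phi z = Phi z.
  move=> Pz; rewrite [RHS]surjective_pairing; congr pair; first exact: phiE.
  apply/seteqP; split=> [_ [zeta hz ->]|zeta' hz']; first exact: lift1.
  have [zeta hz rel] := pfaff_pull rQ dPhi pPhi Pz hz'; exists zeta => //.
  have PQ := PhiP _ Pz; have [hz2 _] := lev_class rQ PQ hz'.
  apply/funext => e /=.
  have [Y TY YE] := fibre_submersion wf hQ PQ (hatS_tangent e hz2).
  have [X TX XE] := diffeo_push_onto dPhi Pz TY.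
  by rewrite (rel X e TX) -?(pushphi _ _ TX) XE ?YE.
exists phi; split=> //.
- move=> x Px; have [z Pz zx] := descend_onto wf hP Px.
  have [_ [zeta hz zE]] := lev_point rP Pz.
  have hz2 : z.2 zeta by rewrite zE; exact: cls_self.
  exists zeta; first by rewrite -zx.
  have [h _] := lev_class rQ (PhiP _ Pz) (lift1 _ _ Pz hz2).
  by move: h; rewrite -phiE // zx.
- apply/seteqP; split=> z; first by move=> [w Pw <-]; rewrite liftE //; exact: PhiP.
  by move=> Pz; exists (g z); [exact: gP|rewrite liftE ?Phig //; exact: gP].
Qed.

Lemma frame_map_iso n (phi : AP n -> AQ n) :
  diffeomorphism (lev P n) (lev Q n) phi -> some_frame_map phi ->
  is_isomorphism phi.
Proof.
elim: n phi => [|n IH] phi dphi fphi.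
  split=> // p x Px; have [zeta hz hz'] := fphi x Px.
  have [sphi _] := dphi; have [phiP _] := sphi.
  have st := hatS_strict rP Px hz p; have st' := hatS_strict rQ (phiP x Px) hz' p.
  apply/seteqP; split=> v.
    move=> [w Fw <-]; have [h _ _ _] := filt_subbundle (bfilt P) p Px.
    have [e we] := linear_iso_onto (hatS_iso hz) (h _ Fw).
    by have := Fw; rewrite -we => /st /st'.
  move=> Fv; have [h _ _ _] := filt_subbundle (bfilt Q) p (phiP x Px).
  have [e ve] := linear_iso_onto (hatS_iso hz') (h _ Fv).
  by exists (zeta e) => //; apply/st/st'; rewrite ve.
have pphi := some_frame_pfaff rP rQ dphi fphi.
have [psi [dpsi fpsi _ cpsi psiE]] := pfaff_descends dphi pphi.
split=> //; exists psi; split=> //; first exact: IH.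
by move=> z Pz; rewrite psiE.
Qed.
End LiftedMaps.
End PfaffDescent.

(** * The completed frame bundle *)

Section Completed.
Context {R : realType} {tau : struct_type R}.
Local Notation E := (Espace tau).
Local Notation depth := (ndepth (gneg tau)).

Lemma Eproj_vanish m d (p : int) (e : E (d + m)) : m%:Z <= p ->
  Efilt p e -> Eproj (m := m) e = 0.
Proof.
move=> mp; elim: d e => [|d IH] e; first exact: Efilt_top.
by move=> [he _]; exact: IH.
Qed.

Lemma Eproj_linear m d : linear (@Eproj R tau m d).
Proof. by elim: d => [|d IH] c u v //=; rewrite IH. Qed.

Section OneTower.
Variables (k : nat) (Q : tower tau).
Hypotheses (wf : wf_type tau k) (geo : is_geometric_structure Q k).
Local Notation A n := (Amb tau (base Q) n).
Local Notation U n := (functional (R := R) (A n)).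
Local Notation descend n := (@descend R tau Q n).
Local Notation pr n := (fun w : forall i, A i => w n).
Let reg := geom_regular wf geo.

Lemma SQ_descend z X n : tangent (SQ Q) z X ->
  push (lev Q n) (descend n) (push (lev Q n.+1) (pr n.+1) X) = push (lev Q n) (pr n) X.
Proof.
move=> TX; have [sd _ _] := reg; rewrite push_comp //.
by apply: (push_ext _ TX) => w /(_ n)[].
Qed.

Lemma SQ_class z n zeta : pts (SQ Q) z -> (z n.+1).2 zeta ->
  hatS_fibre (z n) zeta /\ cls zeta = (z n.+1).2.
Proof.
by move=> Sz; have [Pz _] := Sz n.+1; have [_ <-] := Sz n; exact: lev_class.
Qed.

Lemma frame_descend z d m zeta : pts (SQ Q) z -> hatS_fibre (z (d + m)%N) zeta ->
  exists2 zeta', hatS_fibre (z m) zeta' &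
    forall e X, tangent (SQ Q) z X -> zeta e = push (lev Q (d + m)) (pr (d + m)%N) X ->
      zeta' (Eproj (m := m) e) = push (lev Q m) (pr m) X.
Proof.
move=> Sz; elim: d zeta => [|d IH] zeta hz; first by exists zeta.
have [hb _] := hatS_fbar hz; have [_ zE] := Sz (d + m)%N; rewrite zE in hb.
have [zeta' hz' H] := IH _ hb; exists zeta' => // e X TX eX.
apply: H => //; rewrite -(descend_frame reg e hz) eX.
exact: SQ_descend TX.
Qed.

Lemma class_Eproj d m (zeta zeta' : E (d + m) -> U (d + m)) e e' :
  (depth <= d)%N -> injective zeta -> cls zeta zeta' -> zeta e = zeta' e' ->
  Eproj (m := m) e = Eproj (m := m) e'.
Proof.
move=> dd iz [u hu ->] /= /iz ->; have [_ ru] := hu.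
have := ru _ _ (Efilt_full (p := - depth%:Z) e' (lexx _)).
move=> /(Eproj_vanish (m := m)) H; apply/eqP; rewrite -subr_eq0.
rewrite -(linear_funB _ _ (@Eproj_linear m d)) H //; lia.
Qed.

(* From [d = depth] on, [F^(d + m + 1) GL] moves vectors only within the kernel
   of the projection to [E m]. *)
Lemma theta_spec z X : tangent (SQ Q) z X -> exists e : forall m, E m,
  forall m d, (depth <= d)%N -> forall zeta e', (z (d + m).+1).2 zeta ->
    zeta e' = push (lev Q (d + m)) (pr (d + m)%N) X -> Eproj (m := m) e' = e m.
Proof.
move=> TX; have [Sz _ _] := TX.
have H m : exists e : E m, forall d, (depth <= d)%N -> forall zeta e', (z (d + m).+1).2 zeta ->
    zeta e' = push (lev Q (d + m)) (pr (d + m)%N) X -> Eproj (m := m) e' = e.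
  have [Pz _] := Sz (depth + m).+1; have [_ [zeta0 hz0 zE]] := lev_point reg Pz.
  have hz0' : (z (depth + m).+1).2 zeta0 by rewrite zE; exact: cls_self.
  have [hf0 _] := SQ_class Sz hz0'.
  have [e0 he0] := linear_iso_onto (hatS_iso hf0) (push_tangent (SQ_proj Q (depth + m)) TX).
  exists (Eproj (m := m) e0) => d dd; rewrite -(subnK dd).
  elim: (d - depth)%N => [|j IH] zeta e' hz he'; have [hf cE] := SQ_class Sz hz.
    have [_ iz _] := hatS_iso hf.
    apply: (class_Eproj (d := depth) (zeta' := zeta0) (leqnn _) iz).
      exact: (eq_ind_r (fun S => S zeta0) hz0' cE).
    exact: (etrans he' (esym he0)).
  have [hb cb] := hatS_fbar hf.
  apply: (IH (fbar zeta)); first by rewrite -cb; exact: cls_self.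
  by rewrite -(descend_frame reg e' hf) he'; exact: SQ_descend TX.
exists (fun m => projT1 (cid (H m))) => m; exact: (projT2 (cid (H m))).
Qed.

Lemma theta_total z X : tangent (SQ Q) z X -> exists e, theta z X e.
Proof.
move=> TX; have [Sz _ _] := TX; have [e he] := theta_spec TX; exists e => m.
exists depth => d dd zeta hz; have [hz' _] := SQ_class Sz hz.
have [e' he'] := linear_iso_onto (hatS_iso hz') (push_tangent (SQ_proj Q (d + m)) TX).
by exists e' => //; exact: he he'.
Qed.

(** A member of the class stored [depth] levels further up is stable enough to compute the component
    of the form at [n]; projected down to level [n], it is a frame that recovers the projection of
    [X] from this component. *)
Lemma theta_frame z n : pts (SQ Q) z -> exists2 zeta, hatS_fibre (z n) zeta &
  forall X e, tangent (SQ Q) z X -> theta z X e ->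
    zeta (e n) = push (lev Q n) (pr n) X.
Proof.
move=> Sz; have [Pz _] := Sz (depth + n).+1; have [_ [zeta0 hz0 zE]] := lev_point reg Pz.
have hz0' : (z (depth + n).+1).2 zeta0 by rewrite zE; exact: cls_self.
have [hf0 _] := SQ_class Sz hz0'.
have [zeta hz H] := frame_descend Sz hf0; exists zeta => // X e TX th.
have [e1 he1] := theta_spec TX.
have -> : e n = e1 n.
  (* Large enough both for the unknown bound in [theta] and for [theta_spec]. *)
  have [d0 hd0] := th n; pose d := (d0 + depth)%N.
  have [Pd _] := Sz (d + n).+1; have [_ [zetad _ dE]] := lev_point reg Pd.
  have hd : (z (d + n).+1).2 zetad by rewrite dE; exact: cls_self.
  have [e' he' <-] := hd0 d (leq_addr _ _) zetad hd.
  by apply: he1 hd he'; exact: leq_addl.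
have [e' he'] := linear_iso_onto (hatS_iso hf0) (push_tangent (SQ_proj Q (depth + n)) TX).
by rewrite -(he1 n depth (leqnn _) zeta0 e' hz0' he'); exact: H.
Qed.

Local Notation hsf m := (hatS_field (Q := Q) (n := m)).

(** Frame fields on all levels above [k] simultaneously, each over the full preimage of one
    neighbourhood [W]; the domains below level [k.+1] are dummies. *)
Lemma upper_fields x : pts (lev Q k.+1) x ->
  exists (F : forall m, set (A m)) (sigma : forall m, A m -> E m -> U m),
    [/\ F k.+1 x, forall m, (k < m)%N -> F m.+1 = descend m @^-1` F m &
        forall m, (k < m)%N -> hsf m (F m) (sigma m)].
Proof.
move=> Px; have [W [s [Wx hs]]] := hatS_cover wf geo Px.
(* The type of the domain depends on the level, so [W] is placed at level [k.+1] by a dependent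
   update instead of a case distinction. *)
pose W0 := dfwith (fun m => (setT : set (A m))) k.+1 W.
pose F : forall m, set (A m) := nat_rect (fun m => set (A m)) (W0 0)
  (fun m Fm => if (m <= k)%N then W0 m.+1 else descend m @^-1` Fm).
have FW : F k.+1 = W by rewrite /F /= leqnn /W0 dfwithin.
have FS m : (k < m)%N -> F m.+1 = descend m @^-1` F m.
  by move=> km; rewrite {1}/F /= leqNgt km.
have H m : (k < m)%N -> (exists s, hsf m (F m) s) /\
    exists2 y, pts (lev Q m) y & F m y.
  elim: m => [//|m IH]; rewrite ltnS leq_eqVlt => /orP[/eqP <-|km].
    by rewrite FW; split; [exists s | exists x].
  have [[s' hs'] [y Py Fy]] := IH km; rewrite FS //; split.
    case: m km {IH} s' y hs' Py Fy => // m km s' y hs' Py Fy.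
    by apply: (univ_extend wf geo km hs'); exists y.
  by have [w Pw wy] := descend_onto wf geo Py; exists w => //; rewrite /preimage /= /Defs.descend wy.
have H' m : exists s, (k < m)%N -> hsf m (F m) s.
  have [km|km] := boolP (k < m)%N; last by exists (fun _ _ => 0).
  by have [[s' hs'] _] := H m km; exists s'.
exists F, (fun m => projT1 (cid (H' m))); split=> //; first by rewrite FW.
by move=> m; exact: (projT2 (cid (H' m))).
Qed.

(** A point of level [n] is continued upwards by [s] and downwards by first components. To go down
    one level, [s] is modified at [n] so that it returns [y] over [y.1]. *)
Lemma tower_builder n (s : forall m, A m -> A m.+1) (y : A n) :
  exists L : forall m, A m, [/\ L n = y, forall m, (n <= m)%N -> L m.+1 = s m (L m) &
    forall m, (m < n)%N -> (L m.+1).1 = L m].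
Proof.
elim: n s y => [|n IH] s y.
  by exists (nat_rect (fun m => A m) y s); split.
have [L [Ln Ls Ld]] := IH (dfwith s n (fun _ => y)) y.1.
have Ln1 : L n.+1 = y by rewrite Ls // dfwithin.
exists L; split=> // m.
  by move=> nm; rewrite Ls ?dfwithout // ?(ltnW nm) // ltn_eqF.
rewrite ltnS leq_eqVlt => /orP[/eqP ->|mn]; last exact: Ld.
by rewrite Ln1 Ln.
Qed.

Lemma upper_step m F sigma : (k < m)%N -> hsf m F sigma ->
  smooth_map (restrict (lev Q m) F) (lev Q m.+1) (fun y => (y, cls (sigma y))).
Proof.
move=> km [oF hs ss]; have [_ _ _ g2] := geo; have [-> _] := g2 m km.
have : smooth_map (restrict (lev Q m) F) (hatS Q m) (fun y => (y, sigma y)).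
  apply: smooth_to_hatS => [|y [Py Fy]|//]; first exact: smooth_map_incl.
  exact: hs.
by move=> sh; exact: (smooth_map_comp sh (@uproj_smooth _ _ Q m)).
Qed.

Lemma SQ_section x : pts (lev Q k.+1) x -> exists W (S : A k.+1 -> forall m, A m),
  [/\ open_in (lev Q k.+1) W, W x,
      forall y, pts (lev Q k.+1) y -> W y -> S y k.+1 = y &
      smooth_map (restrict (lev Q k.+1) W) (SQ Q) S].
Proof.
move=> Px; have [F [sigma [Fx FS hs]]] := upper_fields Px.
have /choice[S HS] : forall y : A k.+1, exists L : forall m, A m, [/\ L k.+1 = y,
    forall m, (k < m)%N -> L m.+1 = (L m, cls (sigma m (L m))) &
    forall m, (m < k.+1)%N -> (L m.+1).1 = L m].
  by move=> y; have := tower_builder (fun m w => (w, cls (sigma m w))) y.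
have [oF _ _] := hs k.+1 (ltnSn k).
have SF y m : F k.+1 y -> (k < m)%N -> F m (S y m).
  have [Sk Ss _] := HS y.
  move=> Fy; elim: m => [//|m IH]; rewrite ltnS leq_eqVlt => /orP[/eqP <-|km].
    by rewrite Sk.
  by rewrite FS // Ss //; exact: IH.
have up m : (k < m)%N -> smooth_map (restrict (lev Q k.+1) (F k.+1)) (lev Q m) (fun y => S y m).
  elim: m => [//|m IH]; rewrite ltnS leq_eqVlt => /orP[/eqP <-|km].
    apply: (eq_smooth_map _ (@smooth_map_incl _ _ (lev Q k.+1) _)) => y _.
    by have [-> _ _] := HS y.
  have sm : smooth_map (restrict (lev Q k.+1) (F k.+1)) (restrict (lev Q m) (F m)) (fun y => S y m).
    by apply: smooth_map_restrict; [exact: IH | move=> y [_ Fy]; exact: SF].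
  apply: (eq_smooth_map _ (smooth_map_comp sm (upper_step km (hs m km)))) => y _ /=.
  by have [_ -> //] := HS y.
have S1 y m : (S y m.+1).1 = S y m.
  have [_ Ss Sd] := HS y; have [km|km] := ltnP k m; first by rewrite Ss.
  exact: Sd.
(* The levels up to [k.+1] are reached by projecting down, hence the induction on the distance [j]
   from [k.+1]. *)
have low j : smooth_map (restrict (lev Q k.+1) (F k.+1)) (lev Q (k.+1 - j))
    (fun y => S y (k.+1 - j)%N).
  elim: j => [|j IH]; first by rewrite subn0; exact: up.
  have [jk|jk] := leqP k.+1 j.
    by move: IH; rewrite (eqP (jk : (_ == _)%N)) (eqP (leqW jk : (_ == _)%N)).
  have E1 : (k.+1 - j = (k.+1 - j.+1).+1)%N by rewrite subnSK.
  move: IH; rewrite E1 => IH; have [sd _ _] := reg.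
  apply: (eq_smooth_map _ (smooth_map_comp IH (sd _))) => y _; exact: S1.
exists (F k.+1), S; split=> //; first by move=> y _ _; have [] := HS y.
apply: smooth_to_SQ => [y _ m|m]; first exact: S1.
have [km|km] := ltnP k m; first exact: up.
by have := low (k.+1 - m)%N; rewrite subKn // ltnW.
Qed.

Lemma SQ_below z z' n m : pts (SQ Q) z -> pts (SQ Q) z' -> (m <= n)%N ->
  z n = z' n -> z m = z' m.
Proof.
move=> Sz Sz'; elim: n => [|n IH]; first by rewrite leqn0 => /eqP->.
rewrite leq_eqVlt ltnS => /orP[/eqP->//|mn] zz; apply: IH => //.
by have [_ <-] := Sz n; have [_ <-] := Sz' n; rewrite zz.
Qed.

(** On each level above [k] the coefficients of the two points with respect to the frame field are
    interpolated linearly, and the frame field is evaluated at the moving point of the curve already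
    built below. *)
Lemma SQ_curve z z' : pts (SQ Q) z -> pts (SQ Q) z' -> z k.+1 = z' k.+1 ->
  exists gamma : R -> forall m, A m, [/\ gamma 0 = z, gamma 1 = z',
    forall t, gamma t k.+1 = z k.+1 & forall t, curve_at (SQ Q) gamma t].
Proof.
move=> Sz Sz' zz; have [Px _] := Sz k.+1.
have [F [sigma [Fx FS hs]]] := upper_fields Px.
have inF w m : pts (SQ Q) w -> w k.+1 = z k.+1 -> (k < m)%N -> F m (w m).
  move=> Sw wz; elim: m => [//|m IH]; rewrite ltnS leq_eqVlt => /orP[/eqP <-|km].
    by rewrite wz.
  by rewrite FS // /preimage /= /Defs.descend (Sw m).2; exact: IH.
have coef w m : pts (SQ Q) w -> w k.+1 = z k.+1 -> (k < m.+1)%N ->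
    exists2 a : E m.+1 -> E m.+1, Hgrp a &
      w m.+2 = (w m.+1, cls (sigma m.+1 (w m.+1) \o a)).
  move=> Sw wz km; have [Pm _] := Sw m.+1; have [Pm2 _] := Sw m.+2; have [_ E1] := Sw m.+1.
  have [_ hs' _] := hs m.+1 km; have hsw := hs' _ Pm (inF _ _ Sw wz km).
  have [_ [zeta hz zE]] := lev_point reg Pm2; rewrite E1 in hz.
  have [a Ha aE] := hatS_torsor reg Pm hsw hz.
  by exists a => //; rewrite [LHS]surjective_pairing E1 zE aE.
have C m : exists a : (E m -> E m) * (E m -> E m), (k < m)%N ->
    [/\ z m.+1 = (z m, cls (sigma m (z m) \o a.1)),
        z' m.+1 = (z' m, cls (sigma m (z' m) \o a.2)) &
        forall (t : R) y, pts (lev Q m) y -> F m y ->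
          hatS_fibre y (sigma m y \o (fun e => (1 - t) *: a.1 e + t *: a.2 e))].
  have [km|nk] := boolP (k < m)%N; last by exists (id, id).
  case: m km => [//|m] km.
  have [a Ha aE] := coef z m Sz erefl km.
  have [b Hb bE] := coef z' m Sz' (esym zz) km.
  exists (a, b) => _; split=> // t y Py Fy; have [_ hs' _] := hs m.+1 km.
  by apply: (hatS_Hgrp reg Py (hs' _ Py Fy)); exact: Hgrp_affine.
pose a m := projT1 (cid (C m)).
have Ha m : (k < m)%N -> [/\ z m.+1 = (z m, cls (sigma m (z m) \o (a m).1)),
    z' m.+1 = (z' m, cls (sigma m (z' m) \o (a m).2)) &
    forall (t : R) y, pts (lev Q m) y -> F m y ->
      hatS_fibre y (sigma m y \o (fun e => (1 - t) *: (a m).1 e + t *: (a m).2 e))].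
  exact: (projT2 (cid (C m))).
(* Applied to [sigma m y] at an arbitrary point [y] of [F m], the interpolated coefficients still
   give a frame, because membership in [Hgrp] makes no reference to the point. *)
pose u (t : R) m y : A m * (E m -> U m) :=
  (y, sigma m y \o (fun e => (1 - t) *: (a m).1 e + t *: (a m).2 e)).
pose gamma (t : R) : forall m, A m := nat_rect (fun m => A m) (z 0)
  (fun m y => if (m <= k)%N then z m.+1 else uproj (u t m y)).
have glow t m : (m <= k.+1)%N -> gamma t m = z m.
  by case: m => [//|m] mk; rewrite /gamma /= (mk : (m <= k)%N).
have gup t m : (k < m)%N -> gamma t m.+1 = uproj (u t m (gamma t m)).
  by move=> km; rewrite {1}/gamma /= leqNgt km.
have gF t m : (k < m)%N -> F m (gamma t m).
  elim: m => [//|m IH]; rewrite ltnS leq_eqVlt => /orP[/eqP <-|km].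
    by rewrite glow.
  by rewrite FS // gup //; exact: IH.
have EQ m : (k < m)%N -> lev Q m.+1 = univ_frame Q m.
  by move=> km; have [_ _ _ g2] := geo; have [] := g2 m km.
have gP t m : pts (lev Q m) (gamma t m).
  elim: m => [|m IH]; first by rewrite glow //; have [] := Sz 0.
  have [mk|km] := leqP m k; first by rewrite glow //; have [] := Sz m.+1.
  rewrite gup // EQ //; exists (u t m (gamma t m)) => //.
  by split=> //; have [_ _ h] := Ha m km; exact: h IH (gF t m km).
have g1 t m : (gamma t m.+1).1 = gamma t m.
  have [mk|km] := leqP m k; last by rewrite gup.
  by rewrite !glow // ?(leqW mk) //; have [] := Sz m.
have ends (t : R) w : (t = 0 /\ w = z) \/ (t = 1 /\ w = z') -> gamma t = w.
  move=> tw; have wlow m : (m <= k.+1)%N -> w m = z m.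
    move=> mk; case: tw => -[_ ->] //; apply: SQ_below mk _ => //; exact/esym.
  apply/functional_extensionality_dep => m; elim: m => [|m IH].
    by rewrite glow ?wlow.
  have [mk|km] := leqP m k; first by rewrite glow ?wlow.
  rewrite gup // IH /u; have [h0 h1 _] := Ha m km.
  case: tw => -[-> ->]; rewrite ?h0 ?h1; congr (_, cls _); apply/funext => e /=.
    by rewrite subr0 scale1r scale0r addr0.
  by rewrite subrr scale1r scale0r add0r.
have cg t m : curve_at (lev Q m) (fun s => gamma s m) t.
  elim: m => [|m IH].
    by apply: curve_cst; have [] := Sz 0.
  have [mk|km] := leqP m k.
    rewrite (_ : (fun s => _) = fun _ => z m.+1); last by apply/funext => s; rewrite glow.
    by apply: curve_cst; have [] := Sz m.+1.
  rewrite (_ : (fun s => _) = @uproj _ _ Q m \o (fun s => u s m (gamma s m))); last first.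
    by apply/funext => s; rewrite gup.
  have su : smooth_map (hatS Q m) (lev Q m.+1) (@uproj _ _ Q m).
    by rewrite EQ //; exact: uproj_smooth.
  apply: (curve_map su); have [_ hs' ss] := hs m km; have [_ _ ha] := Ha m km; split.
    by apply: (@filterE _ (nbhs t)) => s; split; [exact: gP | exact: (ha s _ (gP s m) (gF s m km))].
  (* The field [sigma m] is smooth over [F m] only, so the lower curve is regarded as a curve there
     before [sigma m] is differentiated along it. *)
  have cr : curve_at (restrict (lev Q m) (F m)) (fun s => gamma s m) t.
    have [_ dg] := IH; split=> //.
    by apply: (@filterE _ (nbhs t)) => s; split=> //; exact: gF.
  move=> _ [[g sg ->]|[e [g sg ->]]].
    exact: (curve_derivable IH sg).
  rewrite (_ : _ \o _ = fun s => (1 - s) * (sigma m (gamma s m) ((a m).1 e) g : R)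
      + s * (sigma m (gamma s m) ((a m).2 e) g : R)).
    apply: derivableD; apply: derivableM => //.
      exact: (curve_derivable cr (ss ((a m).1 e) g sg)).
    exact: (curve_derivable cr (ss ((a m).2 e) g sg)).
  apply/funext => s; have [ls _ _] := hatS_iso (hs' _ (gP s m) (gF s m km)).
  have zs : sigma m (gamma s m) ((1 - s) *: (a m).1 e + s *: (a m).2 e) =
      (1 - s) *: sigma m (gamma s m) ((a m).1 e) + s *: sigma m (gamma s m) ((a m).2 e).
    by rewrite (linear_funD _ _ ls) (linear_funZ _ _ ls) (linear_funZ _ _ ls).
  exact: (congr1 (fun D : functional (R := R) (A m) => D g) zs).
exists gamma; split=> [||t|t].
- by apply: ends; left.
- by apply: ends; right.
- exact: glow.
- split; first by apply: (@filterE _ (nbhs t)) => s m; split.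
  by move=> _ [m [f sf ->]]; exact: (curve_derivable (cg t m) sf).
Qed.
End OneTower.

(** * Maps that preserve the canonical form *)

Section TwoTowers.
Variables (k : nat) (wf : wf_type tau k).

Section BaseMap.
Variables P Q : tower tau.
Local Notation AP n := (Amb tau (base P) n).
Local Notation AQ n := (Amb tau (base Q) n).
Local Notation prP n := (fun w : forall i, AP i => w n).
Local Notation prQ n := (fun w : forall i, AQ i => w n).
Hypotheses (hP : is_geometric_structure P k) (hQ : is_geometric_structure Q k).
Variable Phi : (forall i, AP i) -> (forall i, AQ i).
Hypotheses (sPhi : smooth_map (SQ P) (SQ Q) Phi) (tPhi : preserves_theta Phi).

Lemma theta_vertical z X n : tangent (SQ P) z X -> push (lev P n) (prP n) X = 0 ->
  push (lev Q n) (prQ n) (push (SQ Q) Phi X) = 0.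
Proof.
move=> TX X0; have [Sz _ _] := TX; have [e th] := theta_total wf hP TX.
have [zeta hz He] := theta_frame wf hP n Sz.
have [zeta' hz' He'] := theta_frame wf hQ n (sPhi.1 _ Sz).
have [lz iz _] := hatS_iso hz; have [lz' _ _] := hatS_iso hz'.
have e0 : e n = 0 by apply: iz; rewrite (linear_fun0 lz) (He X e TX th).
rewrite -(He' _ e (push_tangent sPhi TX)) ?e0 ?(linear_fun0 lz') //.
exact/(tPhi e TX).
Qed.

Lemma theta_fibre z z' : pts (SQ P) z -> pts (SQ P) z' -> z k.+1 = z' k.+1 ->
  Phi z k.+1 = Phi z' k.+1.
Proof.
move=> Sz Sz' zz; have [gamma [<- <- gk cg]] := SQ_curve wf hP Sz Sz' zz.
have Sg t : pts (SQ P) (gamma t) by have [/nbhs_singleton] := cg t.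
apply: (lev_separated wf hQ).
- by have [] := sPhi.1 _ (Sg 0) k.+1.
- by have [] := sPhi.1 _ (Sg 1) k.+1.
move=> h sh; have sf := smooth_map_comp sPhi (SQ_proj Q k.+1).
apply: (@curve_const _ _ (SQ P) gamma (fun w => h (Phi w k.+1))).
  by have [_] := sf; exact.
move=> t _; split=> //; have TX := velocity_tangent (cg t).
have X0 : push (lev P k.+1) (prP k.+1) (velocity (SQ P) gamma t) = 0.
  exact: (velocity_const _ (SQ_proj P k.+1) gk).
have := theta_vertical TX X0; rewrite push_comp; last exact: SQ_proj.
by move=> /(congr1 (fun D : functional (R := R) (AQ k.+1) => D h)); rewrite pushE.
Qed.

Lemma theta_base_map : exists2 phi, smooth_map (lev P k.+1) (lev Q k.+1) phi &
  forall z, pts (SQ P) z -> phi (z k.+1) = Phi z k.+1.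
Proof.
have /choice[sec secP] : forall x : AP k.+1, exists z : forall i, AP i,
    pts (lev P k.+1) x -> pts (SQ P) z /\ z k.+1 = x.
  move=> x; have [Px|nPx] := pselect (pts (lev P k.+1) x).
    have [W [S [_ Wx Sx sS]]] := SQ_section wf hP Px.
    by exists (S x) => _; split; [apply: sS.1 | exact: Sx].
  have [L _] := tower_builder (fun m w => (w, set0)) x.
  by exists L.
exists (fun x => Phi (sec x) k.+1); last first.
  move=> z Sz; have [Px _] := Sz k.+1; have [Ss sz] := secP _ Px.
  exact: theta_fibre.
apply: smooth_map_of_local => x Px; have [W [S [oW Wx Sx sS]]] := SQ_section wf hP Px.
exists W; split=> //.
apply: eq_smooth_map (smooth_map_comp (smooth_map_comp sS sPhi) (SQ_proj Q k.+1)).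
move=> y [Py Wy] /=; have [Ss sy] := secP _ Py.
by apply: theta_fibre => //; [exact: sS.1 | rewrite sy Sx].
Qed.

(** A frame vector [zeta e] at level [k.+1] is lifted to the limit by a local section. The lift has
    component [e] under [theta], which [Phi] keeps, so on the other side the frame [zeta'] reads off
    the image of [zeta e]. *)
Lemma theta_frame_map phi : smooth_map (lev P k.+1) (lev Q k.+1) phi ->
  (forall z, pts (SQ P) z -> phi (z k.+1) = Phi z k.+1) -> some_frame_map phi.
Proof.
move=> sphi phiE x Px; have [W [S [oW Wx Sx sS]]] := SQ_section wf hP Px.
have Sz := sS.1 _ (conj Px Wx); have zx := Sx x Px Wx.
have [zeta hz He] := theta_frame wf hP k.+1 Sz.
have [zeta' hz' He'] := theta_frame wf hQ k.+1 (sPhi.1 _ Sz).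
rewrite -phiE // in hz'; rewrite zx in hz hz'; exists zeta => //.
suff -> : push (lev Q k.+1) phi \o zeta = zeta' by [].
apply/funext => e /=; have TD := hatS_tangent e hz.
have [D TD' DE] := restrict_tangent_onto oW Wx TD.
pose X := push (SQ P) S D; have TX : tangent (SQ P) (S x) X by exact: push_tangent sS TD'.
have XE : push (lev P k.+1) (prP k.+1) X = zeta e.
  rewrite /X push_comp; last exact: SQ_proj.
  by rewrite -DE; apply: (push_ext _ TD') => y [Py Wy]; exact: Sx.
have [f th] := theta_total wf hP TX.
have fe : f k.+1 = e.
  by have [_ iz _] := hatS_iso hz; apply: iz; rewrite (He X f TX th).
have th' : theta (Phi (S x)) (push (SQ Q) Phi X) f by exact/(tPhi f TX).
rewrite -[in RHS]fe (He' _ f (push_tangent sPhi TX) th') -XE.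
rewrite (@push_comp _ _ _ _ _ _ _ _ _ sphi).
rewrite (@push_comp _ _ _ _ _ _ _ _ _ (SQ_proj Q k.+1)).
by apply: (push_ext _ TX) => w Sw; exact: phiE.
Qed.

Lemma theta_inverse Psi : smooth_map (SQ Q) (SQ P) Psi ->
  (forall w, pts (SQ Q) w -> Phi (Psi w) = w) -> preserves_theta Psi.
Proof.
move=> sPsi PhiK w Y e TY; have [Sw _ _] := TY.
have := tPhi e (push_tangent sPsi TY).
by rewrite push_comp // (push_ext _ TY PhiK) (push_id TY) PhiK // => h; split=> /h.
Qed.
End BaseMap.

Variables P Q : tower tau.
Local Notation AP n := (Amb tau (base P) n).
Local Notation AQ n := (Amb tau (base Q) n).
Hypotheses (hP : is_geometric_structure P k) (hQ : is_geometric_structure Q k).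

Lemma theta_descends Phi : diffeomorphism (SQ P) (SQ Q) Phi -> preserves_theta Phi ->
  exists phi : AP k.+1 -> AQ k.+1,
    diffeomorphism (lev P k.+1) (lev Q k.+1) phi /\ some_frame_map phi.
Proof.
move=> [sPhi [Psi [sPsi PsiK PhiK]]] tPhi.
have tPsi := theta_inverse sPhi tPhi sPsi PhiK.
have [phi sphi phiE] := theta_base_map hP hQ sPhi tPhi.
have [psi spsi psiE] := theta_base_map hQ hP sPsi tPsi.
exists phi; split; last exact: (theta_frame_map hP hQ sPhi tPhi).
split=> //; exists psi; split=> // [x Px|y Py].
  have [W [S [_ Wx Sx sS]]] := SQ_section wf hP Px.
  have Sz := sS.1 _ (conj Px Wx).
  by rewrite -(Sx x Px Wx) phiE // psiE ?PsiK //; exact: sPhi.1.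
have [W [S [_ Wy Sy sS]]] := SQ_section wf hQ Py.
have Sw := sS.1 _ (conj Py Wy).
by rewrite -(Sy y Py Wy) psiE // phiE ?PhiK //; exact: sPsi.1.
Qed.
End TwoTowers.
End Completed.

Theorem theorem2p1 (R : realType) (k : nat) (tau : struct_type R)
    (P Q : tower tau) (htau : wf_type tau k)
    (hP : is_geometric_structure P k) (hQ : is_geometric_structure Q k) :
  [/\ forall phi : Amb tau (base P) k.+1 -> Amb tau (base Q) k.+1,
        is_isomorphism phi ->
        (forall m : nat,
           let phim := @iter_lift R tau P Q m.+1 k.+1 phi in
           [/\ @is_isomorphism R tau P Q (m.+1 + k.+1) phim,
               diffeomorphism (lev P (m.+1 + k.+1)) (lev Q (m.+1 + k.+1)) phim &
               @preserves_pfaff R tau P Q (m + k.+1) phim]) /\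
        (exists Phi, [/\ is_limit_lift phi Phi,
                         diffeomorphism (SQ P) (SQ Q) Phi &
                         preserves_theta Phi]),
      (forall n : nat, (n <= k)%N -> is_connected (grp tau n)) ->
      forall (i : nat) (Phi : Amb tau (base P) i.+1 -> Amb tau (base Q) i.+1),
        diffeomorphism (lev P i.+1) (lev Q i.+1) Phi ->
        preserves_pfaff Phi ->
        exists phi : Amb tau (base P) i -> Amb tau (base Q) i,
          [/\ is_isomorphism phi,
              forall z, pts (lev P i.+1) z -> phi z.1 = (Phi z).1,
              clift phi @` pts (lev P i.+1) = pts (lev Q i.+1) &
              forall z, pts (lev P i.+1) z -> clift phi z = Phi z]
    & (forall n : nat, (n <= k)%N -> is_connected (grp tau n)) ->
      ((exists phi : Amb tau (base P) k.+1 -> Amb tau (base Q) k.+1,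
          is_isomorphism phi) <->
       (exists Phi, diffeomorphism (SQ P) (SQ Q) Phi /\
                    preserves_theta Phi))].
Proof.
have rP := geom_regular htau hP; have rQ := geom_regular htau hQ.
have gP := geom_good_group htau hP; have gQ := geom_good_group htau hQ.
have uP n : (k < n)%N -> lev P n.+1 = univ_frame P n.
  by have [_ _ _ g2] := hP; move=> /g2[].
have uQ n : (k < n)%N -> lev Q n.+1 = univ_frame Q n.
  by have [_ _ _ g2] := hQ; move=> /g2[].
(* A given isomorphism agrees with the tower of lifts from level 0 on points only, so the iterated
   lifts of [phi] inherit their properties by extensionality on points. *)
have tower (phi : Amb tau (base P) k.+1 -> Amb tau (base Q) k.+1) : is_isomorphism phi ->
    exists2 psi, forall i, is_isomorphism (@lift_tower R tau P Q psi i) &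
      forall m x, pts (lev P (m + k.+1)) x ->
        @lift_tower R tau P Q psi (m + k.+1) x = iter_lift (m := m) phi x.
  move=> /(full_iso_tower rP rQ gP gQ uP uQ)[psi [ipsi psiE]]; exists psi => // m x Px.
  exact: (iter_lift_tower rP psiE).
split.
- move=> phi /tower[psi ipsi psiE]; split=> [m|].
    have iphi : is_isomorphism (iter_lift (m := m.+1) phi).
      by apply: (iso_ext _ (ipsi (m.+1 + k.+1)%N)) => x Px; exact: (psiE m.+1).
    split=> //; first exact: (iso_diffeo iphi).
    apply: (lift_preserves_pfaff rP rQ (psi := iter_lift (m := m) phi)) => //.
      by apply: (diffeo_ext _ (iso_diffeo (ipsi (m + k.+1)%N))) => x Px; exact: psiE.
    exact: (iso_diffeo iphi).
  exists (limit_map psi); split.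
  + by move=> z Sz m; apply: psiE; have [] := Sz (m + k.+1)%N.
  + exact: limit_map_diffeo.
  + exact: limit_map_theta.
- move=> cG i Phi dPhi pPhi.
  have [phi [dphi fphi phiE cphi liftE]] := pfaff_descends htau hP hQ cG dPhi pPhi.
  by exists phi; split=> //; exact: (frame_map_iso htau hP hQ cG).
- move=> cG; split=> [[phi /tower[psi ipsi _]]|[Phi [dPhi tPhi]]].
    by exists (limit_map psi); split; [exact: limit_map_diffeo|exact: limit_map_theta].
  have [phi [dphi fphi]] := theta_descends htau hP hQ dPhi tPhi.
  by exists phi; exact: (frame_map_iso htau hP hQ cG).
Qed.
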